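(* Let $\varepsilon>0$, $C\ge 1$ and $c>0$. There is a constant $K=K(\varepsilon,C,c)$ such that the following holds. Let $M$ be a positive integer, $\lambda>0$, and let $f:[1,M]\to\mathbb{R}$ be four times continuously differentiable with $$\lambda\le f^{(4)}(x)\le C\lambda\quad\text{for }1\le x\le M.$$ Put $S_M=\sum_{m=1}^M e(f(m))$. Then $$|S_M|\le K\,M^{\varepsilon}\bigl(M\lambda^{1/13}+\lambda^{-7/13}\bigr),$$ and, if in addition $M\ge c\,\lambda^{-8/13}$, then $$|S_M|\le K\,M^{1+\varepsilon}\lambda^{1/13}.$$
   Context: $e(x)=e^{2\pi i x}$ for real $x$. *)

(* Defs.v *)
(* Stdlib reals, with Coquelicot for complex numbers and finite sums. *)
From Stdlib Require Import Reals.
From Coquelicot Require Import Coquelicot.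
Open Scope R_scope.

(* e^{2 pi i x}, written through Euler's formula since Coquelicot has no
   complex exponential. *)
Definition e (x : R) : C := (cos (2 * PI * x), sin (2 * PI * x)).

Definition Icc (a b : R) : R -> Prop := fun x => a <= x <= b.

(* [deriv_n_on n D f g]: on D, f is n times differentiable relatively to D,
   with n-th derivative g. [D_in] takes limits along points of D only, so the
   derivatives at the endpoints of a closed interval are one-sided and the
   values of f outside D are irrelevant. (If D is a single point, any value is
   a derivative there.) *)
Fixpoint deriv_n_on (n : nat) (D : R -> Prop) (f g : R -> R) : Prop :=
  match n with
  | O => forall x, D x -> f x = g x
  | S k => exists h : R -> R,
      (forall x, D x -> D_in f h D x) /\ deriv_n_on k D h g
  end.

(* f is n times continuously differentiable on D, with n-th derivative g;
   the derivatives of lower order are continuous because differentiable. *)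
Definition Cn_deriv_on (n : nat) (D : R -> Prop) (f g : R -> R) : Prop :=
  deriv_n_on n D f g /\ (forall x, D x -> continue_in g D x).

Definition expsum (f : R -> R) (M : nat) : C :=
  sum_n_m (fun m : nat => e (f (INR m))) 1 M.

(* Main.v *)
Require Import Defs.

(** Put P = lambda^(-1/13). Weyl differencing with shifts h <= P^2, followed by an average over n <= P^3,
    replaces f(m+n+h) - f(m+n) by its cubic Taylor polynomial at m: the coefficients f'(m), f''(m)/2 and
    f'''(m)/24 get the frequencies h, h nu and 3 h nu^2 + h^3, where nu = 2n + h. In the mean square over m
    the terms are grouped by the difference of the two shifts, which eliminates f', and the large sieve for
    the pairs (f''/2 mod 1, f'''/24) leaves two counting problems. The first concerns pairs of close points,
    and is settled by the monotonicity of f''(m+d) - f''(m). The second concerns quadruples of frequencies: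
    with h1 + h4 = h2 + h3 = s, p = nu1 - nu4, q = nu2 - nu3, k = nu4 - nu3 it asks for
      h1 p + s k = h2 q   and   h1 h4 (p^2 - s^2) - h2 h3 (q^2 - s^2) = O(s P^5).
    Cutting the range of (p, q) into blocks and subtracting two solutions in a block removes the terms in
    s^2. For the homogeneous system one fixes a primitive (h1, h2, s), when the slopes q/p are well spaced,
    or a primitive (p, q, k), when the ratios h4/h1 are; the smaller of the two bounds sums to the number of
    trivial solutions up to logarithms. *)

(** On a piece of length P^8 the target is P^7, and the pieces add up to M / P + P^7. Weyl's
    inequality with P^2 shifts gives no less than P^8 / P, which is enough if the correlations over
    all shifts add up to P^8. After the average over n this asks for P^11 against the trivial P^13.
    The Taylor error is about lambda h n^3 <= P^(-13) P^2 P^9 = P^(-2) per term, exactly the saving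
    wanted, so neither the shifts nor the average can be longer. Over a piece f''' varies by
    O(P^(-5)), so the frequencies 3 h nu^2 + h^3 are resolved only up to P^5; this is the tolerance
    of the second counting problem. The obstacle there is that the terms in s^2 reach X^4 for shifts
    of size X, which exceeds the tolerance X P^5 by up to a factor P. Differences of solutions in a
    short block satisfy a homogeneous system, for which common divisors and spacing are available.
    As p nearly determines q, the number of blocks is only linear in 1 + X^3 / P^5, and the smaller
    range and tolerance of the differences make up for it. *)

Module Analysis.
From Stdlib Require Import Reals Lra Lia.
From Coquelicot Require Import Coquelicot.
Open Scope R_scope.

(** * Extension of one-sided derivatives *)

Definition clamp (a b x : R) : R := Rmax a (Rmin x b).

Lemma clamp_in a b x : a <= b -> a <= clamp a b x <= b.
Proof. intros; unfold clamp, Rmax, Rmin; repeat destruct Rle_dec; lra. Qed.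

Lemma clamp_id a b x : a <= x <= b -> clamp a b x = x.
Proof. intros; unfold clamp, Rmax, Rmin; repeat destruct Rle_dec; lra. Qed.

Lemma clamp_lip a b x y : a <= b -> Rabs (clamp a b x - clamp a b y) <= Rabs (x - y).
Proof. intros; unfold clamp, Rmax, Rmin, Rabs; repeat destruct Rle_dec; repeat destruct Rcase_abs; lra. Qed.

Lemma clamp_continuous a b F x : a <= b -> (forall y, Icc a b y -> continue_in F (Icc a b) y) ->
  continuity_pt (fun y => F (clamp a b y)) x.
Proof.
intros ab cF eps He.
destruct (cF (clamp a b x) (clamp_in a b x ab) eps He) as [d [d0 Hd]].
exists d; split; [exact d0|]; intros y [_ Hy]; simpl in *.
destruct (Req_dec (clamp a b x) (clamp a b y)) as [E|E].
  unfold Rdist; rewrite E, Rminus_diag, Rabs_R0; exact He.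
apply Hd; repeat split; try apply clamp_in; auto.
apply Rle_lt_trans with (2 := Hy); apply clamp_lip; exact ab.
Qed.

Lemma clamp_derive a b F F' x : D_in F F' (Icc a b) x -> a < x < b ->
  is_derive (fun y => F (clamp a b y)) x (F' x).
Proof.
intros DF xab; apply is_derive_Reals; intros eps He.
destruct (DF eps He) as [d [d0 Hd]]; simpl in Hd.
assert (m0 : 0 < Rmin d (Rmin (x - a) (b - x))) by (repeat apply Rmin_glb_lt; lra).
exists (mkposreal _ m0); intros h h0 Hh; simpl in Hh.
assert (h1 := Rlt_le_trans _ _ _ Hh (Rmin_l _ _)).
assert (h2 := Rlt_le_trans _ _ _ Hh (Rmin_r _ _)).
assert (h3 := Rlt_le_trans _ _ _ h2 (Rmin_l _ _)).
assert (h4 := Rlt_le_trans _ _ _ h2 (Rmin_r _ _)).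
apply Rabs_def2 in h3; apply Rabs_def2 in h4.
rewrite !clamp_id by lra.
assert (E : x + h - x = h) by ring.
specialize (Hd (x + h)); unfold Rdist, D_x, Icc in Hd; rewrite E in Hd.
apply Hd; repeat split; try lra.
Qed.

Lemma mean_value G G' a b : (forall x, is_derive G x (G' x)) -> a <= b ->
  exists c, a <= c <= b /\ G b - G a = G' c * (b - a).
Proof.
intros DG ab.
destruct (MVT_gen G a b G') as [c Hc].
- intros; apply DG.
- intros x _; apply continuity_pt_filterlim, (ex_derive_continuous G x); eexists; apply DG.
- rewrite Rmin_left, Rmax_right in Hc by exact ab; exists c; exact Hc.
Qed.

(** [F] composed with [clamp] is continuous on the line but need not be differentiable at the
    endpoints, so the extension is an integral of [G']. The two agree on the interval because their
    difference is continuous there and has zero derivative inside. *)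
Lemma extend_primitive a b F F' G' : a <= b -> (forall x, Icc a b x -> D_in F F' (Icc a b) x) ->
  (forall x, continuous G' x) -> (forall x, Icc a b x -> G' x = F' x) ->
  exists G, (forall x, is_derive G x (G' x)) /\ (forall x, Icc a b x -> G x = F x).
Proof.
intros ab DF cG GF.
set (G := fun x => F a + RInt G' a x).
assert (DG : forall x, is_derive G x (G' x)).
  intros x; unfold G; evar_last.
    apply (is_derive_plus (fun _ => F a) (RInt G' a)); [apply is_derive_const|].
    apply (is_derive_RInt G' (RInt G' a) a x); [|apply cG].
    apply filter_forall; intros y; apply (RInt_correct (V := R_CompleteNormedModule)), (ex_RInt_continuous (V := R_CompleteNormedModule)).
    intros z _; apply cG.
  apply plus_zero_l.
exists G; split; [exact DG|]; intros x [ax xb].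
destruct (MVT_gen (fun y => F (clamp a b y) - G y) a x (fun _ => 0)) as [c [_ Hc]].
- rewrite Rmin_left, Rmax_right by exact ax; intros y Hy.
  evar_last.
    apply (is_derive_minus (K := R_AbsRing) (V := R_NormedModule)); [apply (clamp_derive a b F F' y)|apply DG]; [apply DF; split; lra|lra].
  rewrite GF by (split; lra); apply (minus_eq_zero (G := R_AbelianGroup)).
- intros y _; apply continuity_pt_minus.
    apply clamp_continuous; [exact ab|]; intros z Hz; apply (cont_deriv F F'); apply DF; exact Hz.
  apply continuity_pt_filterlim, (ex_derive_continuous G y); eexists; apply DG.
- rewrite !clamp_id in Hc by lra.
  assert (Ga : G a = F a) by (unfold G; rewrite RInt_point; apply Rplus_0_r).
  lra.
Qed.

Definition quartic (lam Lam : R) (F F1 F2 F3 F4 : R -> R) : Prop :=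
  (forall x, is_derive F x (F1 x)) /\ (forall x, is_derive F1 x (F2 x)) /\
  (forall x, is_derive F2 x (F3 x)) /\ (forall x, is_derive F3 x (F4 x)) /\
  (forall x, lam <= F4 x <= Lam).

(** Only the fourth derivative is extended by hand, as a constant beyond each endpoint, which keeps
    its two bounds; the others are successive primitives. With a function on the whole line, later
    arguments may run over any block of consecutive integers. *)
Lemma extend_quartic a b lam Lam f f4 : a <= b -> Cn_deriv_on 4 (Icc a b) f f4 ->
  (forall x, a <= x <= b -> lam <= f4 x <= Lam) ->
  exists F F1 F2 F3 F4, quartic lam Lam F F1 F2 F3 F4 /\ (forall x, a <= x <= b -> F x = f x).
Proof.
intros ab [[h1 [D1 [h2 [D2 [h3 [D3 [h4 [D4 E4]]]]]]]] cf] Hf.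
assert (ex : forall (G : R -> R) (x l : R), is_derive G x l -> continuous G x).
  intros G x l H; apply (ex_derive_continuous G x); exists l; exact H.
set (F4 := fun x => f4 (clamp a b x)).
assert (c4 : forall x, continuous F4 x).
  intros x; apply continuity_pt_filterlim, clamp_continuous; [exact ab|exact cf].
assert (F4E : forall x, Icc a b x -> F4 x = h4 x).
  intros x Hx; unfold F4; rewrite clamp_id by exact Hx; symmetry; apply E4; exact Hx.
destruct (extend_primitive a b h3 h4 F4 ab D4 c4 F4E) as [F3 [d3 e3]].
destruct (extend_primitive a b h2 h3 F3 ab D3 (fun x => ex _ _ _ (d3 x)) e3) as [F2 [d2 e2]].
destruct (extend_primitive a b h1 h2 F2 ab D2 (fun x => ex _ _ _ (d2 x)) e2) as [F1 [d1 e1]].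
destruct (extend_primitive a b f h1 F1 ab D1 (fun x => ex _ _ _ (d1 x)) e1) as [F [d0 e0]].
exists F, F1, F2, F3, F4; split; [|exact e0].
exact (conj d0 (conj d1 (conj d2 (conj d3 (fun x => Hf _ (clamp_in a b x ab)))))).
Qed.

Lemma derive_minus (G H : R -> R) x g h l : is_derive G x g -> is_derive H x h -> g - h = l ->
  is_derive (fun t => G t - H t) x l.
Proof. intros DG DH <-; apply (is_derive_minus (K := R_AbsRing) (V := R_NormedModule)); assumption. Qed.

Lemma derive_shift (G G' : R -> R) d x : (forall y, is_derive G y (G' y)) ->
  is_derive (fun t => G (d + t)) x (G' (d + x)).
Proof.
intros DG; evar_last.
  apply (is_derive_comp G (fun t => d + t) x (G' (d + x)) 1); [apply DG|auto_derive; auto].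
apply Rmult_1_l.
Qed.

Lemma mean_value_bound (g g' : R -> R) B y : (forall t, is_derive g t (g' t)) -> 0 <= y ->
  (forall t, 0 <= t <= y -> Rabs (g' t) <= B) -> Rabs (g y - g 0) <= B * y.
Proof.
intros Dg y0 H; destruct (mean_value g g' 0 y Dg y0) as [c [Hc ->]].
rewrite Rminus_0_r, Rabs_mult, (Rabs_right y) by lra.
apply Rmult_le_compat_r; auto.
Qed.

Section Quartic.
Variables (lam Lam : R) (F F1 F2 F3 F4 : R -> R).

Lemma quartic_steep1 : quartic lam Lam F F1 F2 F3 F4 -> forall x y, x <= y ->
  lam * (y - x) <= F3 y - F3 x <= Lam * (y - x).
Proof.
intros [_ [_ [_ [D3 B4]]]] x y xy; destruct (mean_value F3 F4 x y D3 xy) as [c [_ ->]].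
destruct (B4 c); split; apply Rmult_le_compat_r; lra.
Qed.

Lemma quartic_steep2 : quartic lam Lam F F1 F2 F3 F4 -> forall x y d, x <= y -> 0 <= d ->
  lam * d * (y - x) <= (F2 (d + y) - F2 y) - (F2 (d + x) - F2 x) <= Lam * d * (y - x).
Proof.
intros Q x y d xy d0; assert (S1 := quartic_steep1 Q); destruct Q as [_ [_ [D2 _]]].
destruct (mean_value (fun t => F2 (d + t) - F2 t) (fun t => F3 (d + t) - F3 t) x y) as [c [_ ->]].
- intros t; apply (derive_minus _ _ _ _ _ _ (derive_shift F2 F3 d t D2) (D2 t)); reflexivity.
- exact xy.
- assert (H := S1 c (d + c)); replace (d + c - c) with d in H by ring.
  destruct H; [lra|]; split; apply Rmult_le_compat_r; lra.
Qed.

(** The bounds on [F4] are carried down to the increment of [F] by one mean value step per order.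
    Bounding each derivative by its value at the far end loses the factorials, which only affects
    constants. *)
Lemma quartic_taylor : quartic lam Lam F F1 F2 F3 F4 -> 0 <= lam -> forall x n h, 0 <= n -> 0 <= h ->
  Rabs (F (x + n + h) - F (x + n) -
    (h * F1 x + h * (2 * n + h) / 2 * F2 x + (3 * h * (2 * n + h) ^ 2 + h ^ 3) / 24 * F3 x))
  <= Lam * h * (n + h) ^ 3.
Proof.
intros Q l0 x n h n0 h0; assert (S1 := quartic_steep1 Q); destruct Q as [D0 [D1 [D2 [D3 B4]]]].
assert (L0 : 0 <= Lam) by (destruct (B4 0); lra).
assert (T3 : forall y, 0 <= y -> Rabs (F3 (x + y) - F3 x) <= Lam * y).
  intros y y0; destruct (S1 x (x + y)) as [H1 H2]; [lra|].
  replace (x + y - x) with y in H1, H2 by ring.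
  apply Rabs_le; assert (0 <= lam * y) by (apply Rmult_le_pos; lra); lra.
assert (T2 : forall y, 0 <= y -> Rabs (F2 (x + y) - F2 x - F3 x * y) <= Lam * y ^ 2).
  intros y y0; replace (Lam * y ^ 2) with (Lam * y * y) by ring.
  replace (F2 (x + y) - F2 x - F3 x * y) with
    ((F2 (x + y) - F3 x * y) - (F2 (x + 0) - F3 x * 0)) by (rewrite Rplus_0_r; ring).
  apply (mean_value_bound (fun t => F2 (x + t) - F3 x * t) (fun t => F3 (x + t) - F3 x)); auto.
    intros t; apply (derive_minus (fun t => F2 (x + t)) (fun t => F3 x * t) t _ _ _ (derive_shift F2 F3 x t D2)
      (is_derive_scal (fun t => t) t (F3 x) 1 (is_derive_id t))); ring.
  intros t Ht; apply Rle_trans with (1 := T3 t (proj1 Ht)); apply Rmult_le_compat_l; lra.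
assert (T1 : forall y, 0 <= y -> Rabs (F1 (x + y) - F1 x - F2 x * y - F3 x * y ^ 2 / 2) <= Lam * y ^ 3).
  intros y y0; replace (Lam * y ^ 3) with (Lam * y ^ 2 * y) by ring.
  replace (F1 (x + y) - F1 x - F2 x * y - F3 x * y ^ 2 / 2) with
    ((F1 (x + y) - (F2 x * y + F3 x * y ^ 2 / 2)) - (F1 (x + 0) - (F2 x * 0 + F3 x * 0 ^ 2 / 2)))
    by (rewrite Rplus_0_r; field).
  apply (mean_value_bound (fun t => F1 (x + t) - (F2 x * t + F3 x * t ^ 2 / 2))
    (fun t => F2 (x + t) - F2 x - F3 x * t)); auto.
    intros t; apply (derive_minus (fun t => F1 (x + t)) (fun t => F2 x * t + F3 x * t ^ 2 / 2) t _
      (F2 x + F3 x * t) _ (derive_shift F1 F2 x t D1)); [auto_derive; auto; field|ring].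
  intros t Ht; apply Rle_trans with (1 := T2 t (proj1 Ht)); apply Rmult_le_compat_l; [lra|].
  apply pow_incr; lra.
(* With nu = 2 n + h one has (n + h)^2 - n^2 = h nu and 4 ((n + h)^3 - n^3) = 3 h nu^2 + h^3, so
   [p h - p 0] is the polynomial of the statement; this is the origin of the denominator 24. *)
set (p := fun t => F1 x * t + F2 x * (n + t) ^ 2 / 2 + F3 x * (n + t) ^ 3 / 6).
replace (Lam * h * (n + h) ^ 3) with (Lam * (n + h) ^ 3 * h) by ring.
replace (F (x + n + h) - F (x + n) - (h * F1 x + h * (2 * n + h) / 2 * F2 x
  + (3 * h * (2 * n + h) ^ 2 + h ^ 3) / 24 * F3 x)) with
  ((F (x + n + h) - p h) - (F (x + n + 0) - p 0)) by (unfold p; rewrite Rplus_0_r; field).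
apply (mean_value_bound (fun t => F (x + n + t) - p t)
  (fun t => F1 (x + (n + t)) - F1 x - F2 x * (n + t) - F3 x * (n + t) ^ 2 / 2)); auto.
  intros t; apply (derive_minus (fun t => F (x + n + t)) p t _
     (F1 x + F2 x * (n + t) + F3 x * (n + t) ^ 2 / 2) _ (derive_shift F F1 (x + n) t D0)).
    unfold p; auto_derive; auto; field.
  rewrite Rplus_assoc; ring.
intros t Ht; assert (nt : 0 <= n + t) by lra.
apply Rle_trans with (1 := T1 (n + t) nt); apply Rmult_le_compat_l; [lra|]; apply pow_incr; lra.
Qed.
End Quartic.
End Analysis.

(** * The exponential as a character, and the passage from integral P to the stated bounds *)

Module Assembly.
From Stdlib Require Import ZArith Reals Lra Lia.
From Coquelicot Require Import Coquelicot.
Import Analysis.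
Open Scope R_scope.

Lemma sin_sqr_le a : sin a ^ 2 <= a ^ 2.
Proof.
assert (H : forall b, 0 <= b -> sin b ^ 2 <= b ^ 2).
  intros b b0; rewrite <- (pow2_abs (sin b)); apply pow_incr; split; [apply Rabs_pos|].
  replace (sin b) with (sin b - sin 0) by (rewrite sin_0; ring).
  rewrite <- (Rmult_1_l b) at 2; apply (mean_value_bound sin cos); auto.
    intros t; apply is_derive_Reals, derivable_pt_lim_sin.
  intros t _; apply Rabs_le, COS_bound.
destruct (Rle_or_lt 0 a) as [a0|a0]; [apply H; exact a0|].
replace (sin a ^ 2) with (sin (- a) ^ 2) by (rewrite sin_neg; ring).
replace (a ^ 2) with ((- a) ^ 2) by ring; apply H; lra.
Qed.

Lemma PI_le : PI <= 7 / 2.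
Proof.
destruct (PI_ineq 1) as [_ H]; unfold tg_alt, PI_tg in H; simpl in H; lra.
Qed.

(** The squared chord is 4 sin^2(pi x), at most (2 pi x)^2; the 7 comes from the crude bound pi <=
    7/2. *)
Lemma e_dist1 x : (fst (e x) - 1) ^ 2 + snd (e x) ^ 2 <= (7 * x) ^ 2.
Proof.
unfold e; simpl fst; simpl snd.
rewrite Rmult_assoc, cos_2a_sin, sin_2a.
set (s := sin (PI * x)); set (t := cos (PI * x)).
assert (st : s ^ 2 + t ^ 2 = 1) by (generalize (sin2_cos2 (PI * x)); unfold Rsqr, s, t; lra).
replace ((1 - 2 * s * s - 1) ^ 2 + (2 * s * t) ^ 2) with (4 * s ^ 2 * (s ^ 2 + t ^ 2)) by ring.
rewrite st, Rmult_1_r.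
assert (H := sin_sqr_le (PI * x)); fold s in H.
assert (P1 := PI_le); assert (P0 := PI_RGT_0).
assert (PI * PI <= 49 / 4) by nra.
assert (0 <= x * x) by nra.
replace ((PI * x) ^ 2) with (PI * PI * (x * x)) in H by ring.
replace ((7 * x) ^ 2) with (49 * (x * x)) by ring; nra.
Qed.

Lemma e_neq1 x : 0 < x < 1 -> fst (e x) <> 1.
Proof.
unfold e; simpl fst.
intros [x0 x1]; rewrite Rmult_assoc, cos_2a_sin; intros H.
assert (P0 := PI_RGT_0).
assert (S := sin_gt_0 (PI * x)); assert (0 < PI * x) by nra.
assert (PI * x < PI) by nra; specialize (S H0 H1); nra.
Qed.

Lemma e_add x y : e (x + y) = Cmult (e x) (e y).
Proof.
unfold e, Cmult; simpl; rewrite (Rmult_plus_distr_l (2 * PI) x y), cos_plus, sin_plus.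
f_equal; ring.
Qed.

Lemma e_norm x : fst (e x) ^ 2 + snd (e x) ^ 2 = 1.
Proof. unfold e; simpl; generalize (sin2_cos2 (2 * PI * x)); unfold Rsqr; lra. Qed.

Lemma e_1 : e 1 = RtoC 1.
Proof. unfold e, RtoC; rewrite Rmult_1_r, cos_2PI, sin_2PI; reflexivity. Qed.

Lemma Cmod_e x : Cmod (e x) = 1.
Proof. unfold Cmod; rewrite e_norm; apply sqrt_1. Qed.

Lemma expsum_trivial f M : Cmod (expsum f M) <= INR M.
Proof.
induction M as [|M IH].
  unfold expsum; rewrite sum_n_m_zero by lia; change (Cmod (RtoC 0) <= 0); rewrite Cmod_0; lra.
unfold expsum; rewrite sum_n_Sm by lia; rewrite S_INR.
apply Rle_trans with (1 := Cmod_triangle _ _); rewrite Cmod_e; unfold expsum in IH; lra.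
Qed.

(** Interface between the arithmetic and the final estimate: [P] is an integer that equals
    lambda^(-1/13) up to a factor 2, and [k] bounds its number of binary digits, so a squared
    logarithm is all that is lost. *)
Definition short_bound (K0 C0 : R) : Prop := forall (M : nat) (lambda : R) (f f4 : R -> R) (P k : nat),
  (1 <= M)%nat -> 0 < lambda -> Cn_deriv_on 4 (Icc 1 (INR M)) f f4 ->
  (forall x : R, 1 <= x <= INR M -> lambda <= f4 x <= C0 * lambda) ->
  (1 <= P)%nat -> / INR P ^ 13 <= lambda -> lambda <= (2 / INR P) ^ 13 -> INR P < 2 ^ k ->
  Cmod (expsum f M) <= K0 * (INR k + 1) ^ 2 * (INR M / INR P + INR P ^ 7).

Lemma Rpower_ge1 x y : 1 <= x -> 0 <= y -> 1 <= Rpower x y.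
Proof.
intros x1 y0; rewrite <- (Rpower_O x) by lra; apply Rle_Rpower; assumption.
Qed.

(** From exp y >= y one gets d ln P <= P^d. Taking d = eps / 2 leaves one such factor for each of
    the two logarithms, and ln 2 > 1/2 converts binary logarithms. *)
Lemma log_le_power eps P : 0 < eps -> (1 <= P)%nat ->
  (INR (S (Nat.log2 P)) + 1) ^ 2 <= (2 + 4 / eps) ^ 2 * Rpower (INR P) eps.
Proof.
intros e0 P1; assert (P1r : 1 <= INR P) by (apply (le_INR 1); exact P1).
set (d := eps / 2); assert (d0 : 0 < d) by (unfold d; lra).
replace eps with (d + d) at 2 by (unfold d; field); rewrite Rpower_plus.
set (E := Rpower (INR P) d).
assert (E1 : 1 <= E) by (apply Rpower_ge1; lra).
assert (lnE : d * ln (INR P) <= E).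
  unfold E, Rpower; assert (H := exp_ineq1_le (d * ln (INR P))); lra.
assert (l2 : INR (Nat.log2 P) <= 2 * ln (INR P)).
  destruct (Nat.log2_spec P) as [H _]; [lia|].
  apply le_INR in H; rewrite pow_INR in H.
  apply ln_le in H; [|apply pow_lt; simpl; lra].
  rewrite ln_pow in H by (simpl; lra); replace (INR 2) with 2 in H by (simpl; ring).
  assert (L := ln_lt_2); assert (0 <= INR (Nat.log2 P)) by apply pos_INR; nra.
assert (4 / eps * E >= 2 * ln (INR P)).
  replace (4 / eps * E) with (2 / d * E) by (unfold d; field; lra).
  apply Rle_ge, Rmult_le_reg_l with d; [exact d0|].
  replace (d * (2 / d * E)) with (2 * E) by (field; lra); lra.
replace ((2 + 4 / eps) ^ 2 * (E * E)) with (((2 + 4 / eps) * E) ^ 2) by ring.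
rewrite S_INR; apply pow_incr; split; [assert (H0 := pos_INR (Nat.log2 P)); lra|].
rewrite Rmult_plus_distr_r; lra.
Qed.

(** Logarithms of P are absorbed by M^eps once P <= M. The other cases follow from |S| <= M: if
    lambda >= 1 directly, and if M <= P^7 because P^7 <= 128 lambda^(-7/13), P being less than twice
    lambda^(-1/13) up to rounding; this is the 128 in [K1]. *)
Lemma assembly K0 C0 eps c : short_bound K0 C0 -> 0 <= K0 -> 0 < eps -> 0 < c ->
  exists K : R,
    forall (M : nat) (lambda : R) (f f4 : R -> R),
      (1 <= M)%nat ->
      0 < lambda ->
      Cn_deriv_on 4 (Icc 1 (INR M)) f f4 ->
      (forall x : R, 1 <= x <= INR M -> lambda <= f4 x <= C0 * lambda) ->
      Cmod (expsum f M)
        <= K * Rpower (INR M) eps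
             * (INR M * Rpower lambda (1 / 13) + Rpower lambda (- (7 / 13)))
      /\
      (c * Rpower lambda (- (8 / 13)) <= INR M ->
       Cmod (expsum f M)
         <= K * Rpower (INR M) (1 + eps) * Rpower lambda (1 / 13)).
Proof.
intros HS K00 e0 c0; set (A := (2 + 4 / eps) ^ 2); set (K1 := 128 * (K0 * A + 1)).
assert (A0 : 0 <= A) by apply pow2_ge_0.
assert (KA : 0 <= K0 * A) by (apply Rmult_le_pos; assumption).
(* The summand 1 / c serves the second bound, where the hypothesis on M gives lambda^(-7/13) <= M
   lambda^(1/13) / c. *)
exists (K1 * (1 + / c)); intros M lambda f f4 M1 l0 Df Bf.
set (q := Rpower lambda (1 / 13)).
assert (q0 : 0 < q) by apply exp_pos.
assert (qn : forall n, Rpower lambda (INR n / 13) = q ^ n).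
  intros n; rewrite <- Rpower_pow by exact q0; unfold q; rewrite Rpower_mult; f_equal; field.
assert (q13 : q ^ 13 = lambda).
  rewrite <- qn; replace (INR 13 / 13) with 1 by (simpl; field); apply Rpower_1; exact l0.
assert (q7 : Rpower lambda (- (7 / 13)) = (/ q) ^ 7).
  rewrite pow_inv, <- qn, <- Rpower_Ropp; f_equal; simpl; field.
assert (q8 : Rpower lambda (- (8 / 13)) = (/ q) ^ 8).
  rewrite pow_inv, <- qn, <- Rpower_Ropp; f_equal; simpl; field.
rewrite q7, q8; assert (M1r : 1 <= INR M) by (apply (le_INR 1); exact M1).
assert (iq0 : 0 < / q) by (apply Rinv_0_lt_compat; exact q0).
set (E := Rpower (INR M) eps); assert (E1 : 1 <= E) by (apply Rpower_ge1; lra).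
assert (W7 : 0 < (/ q) ^ 7) by (apply pow_lt; exact iq0).
assert (Mq : 0 < INR M * q) by (apply Rmult_lt_0_compat; lra).
assert (main : Cmod (expsum f M) <= K1 * E * (INR M * q + (/ q) ^ 7)).
  assert (T := expsum_trivial f M).
  assert (low : forall X, 0 <= X -> 128 * X <= K1 * E * X).
    intros X X0; apply Rmult_le_compat_r; [exact X0|].
    unfold K1; nra.
  destruct (Rle_or_lt 1 q) as [q1|q1].
    apply Rle_trans with (1 := T); assert (H := low (INR M * q + (/ q) ^ 7)); nra.
  set (r := / q); assert (r1 : 1 < r) by (unfold r; rewrite <- Rinv_1; apply Rinv_lt_contravar; lra).
  destruct (archimed r) as [u1 u2]; set (P := Z.to_nat (up r)).
  assert (PE : INR P = IZR (up r)).
    unfold P; rewrite INR_IZR_INZ, Z2Nat.id; [reflexivity|]; apply le_IZR; lra.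
  assert (Pr : r < INR P <= 2 * r) by (rewrite PE; lra).
  assert (P1 : (1 <= P)%nat) by (apply INR_le; simpl; lra).
  assert (iP : / INR P <= q).
    rewrite <- (Rinv_inv q); apply Rinv_le_contravar; [exact iq0|]; fold r; lra.
  assert (P7 : INR P ^ 7 <= 128 * r ^ 7).
    replace (128 * r ^ 7) with ((2 * r) ^ 7) by ring; apply pow_incr; lra.
  destruct (Rle_or_lt (INR M) (INR P ^ 7)) as [MP|MP].
    fold r in W7; fold r; assert (H := low (INR M * q + r ^ 7)); lra.
  assert (k2 : INR P < 2 ^ S (Nat.log2 P)).
    destruct (Nat.log2_spec P) as [_ H]; [lia|].
    apply lt_INR in H; rewrite pow_INR in H; simpl INR in H.
    replace (1 + 1) with 2 in H by ring; exact H.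
  assert (B := HS M lambda f f4 P (S (Nat.log2 P)) M1 l0 Df Bf P1).
  assert (l1 : / INR P ^ 13 <= lambda).
    rewrite <- q13, <- pow_inv; apply pow_incr; split; [|exact iP].
    apply Rlt_le, Rinv_0_lt_compat; lra.
  assert (l2 : lambda <= (2 / INR P) ^ 13).
    rewrite <- q13; apply pow_incr; split; [lra|].
    apply Rmult_le_reg_r with (INR P); [lra|]; unfold Rdiv; rewrite Rmult_assoc, Rinv_l by lra.
    apply Rle_trans with (q * (2 * r)); [apply Rmult_le_compat_l; lra|].
    unfold r; rewrite Rmult_comm, Rmult_assoc, Rinv_l by lra; lra.
  apply Rle_trans with (1 := B l1 l2 k2).
  assert (LP := log_le_power eps P e0 P1); fold A in LP.
  assert (PM : Rpower (INR P) eps <= E).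
    apply Rle_Rpower_l; [lra|]; split; [lra|].
    apply Rle_trans with (INR P ^ 7); [|lra].
    rewrite <- (pow_1 (INR P)) at 1; apply Rle_pow; [lra|lia].
  assert (LE : K0 * (INR (S (Nat.log2 P)) + 1) ^ 2 <= K0 * A * E).
    rewrite Rmult_assoc; apply Rmult_le_compat_l; [exact K00|].
    apply Rle_trans with (1 := LP); apply Rmult_le_compat_l; assumption.
  assert (V : INR M / INR P + INR P ^ 7 <= 128 * (INR M * q + r ^ 7)).
    assert (INR M / INR P <= INR M * q) by (apply Rmult_le_compat_l; lra).
    lra.
  assert (V0 : 0 <= INR M / INR P + INR P ^ 7).
    apply Rplus_le_le_0_compat; [apply Rdiv_le_0_compat; lra|apply pow_le; lra].
  fold r in W7; fold r.
  apply Rle_trans with (K0 * A * E * (128 * (INR M * q + r ^ 7))).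
    apply Rmult_le_compat; try assumption; apply Rmult_le_pos; [exact K00|apply pow2_ge_0].
  assert (0 <= E * (INR M * q + r ^ 7)) by (apply Rmult_le_pos; lra).
  unfold K1; replace (128 * (K0 * A + 1) * E * (INR M * q + r ^ 7)) with
    (K0 * A * E * (128 * (INR M * q + r ^ 7)) + 128 * (E * (INR M * q + r ^ 7))) by ring; lra.
assert (K1E : 0 <= K1 * E) by (apply Rmult_le_pos; unfold K1; lra).
assert (ic : 0 < / c) by (apply Rinv_0_lt_compat; exact c0).
split.
  apply Rle_trans with (1 := main); apply Rmult_le_compat_r; [lra|].
  assert (0 <= K1 * E * / c) by (apply Rmult_le_pos; lra).
  replace (K1 * (1 + / c) * E) with (K1 * E + K1 * E * / c) by ring; lra.
intros Hc; apply Rle_trans with (1 := main).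
rewrite Rpower_plus, Rpower_1 by lra; fold E.
replace (K1 * (1 + / c) * (INR M * E) * q) with (K1 * E * (INR M * q * (1 + / c))) by ring.
apply Rmult_le_compat_l; [exact K1E|].
assert ((/ q) ^ 7 <= INR M * q * / c); [|lra].
apply Rmult_le_reg_l with c; [exact c0|].
replace (c * (INR M * q * / c)) with (INR M * q) by (field; lra).
replace (c * (/ q) ^ 7) with (c * (/ q) ^ 8 * q) by (field; lra).
apply Rmult_le_compat_r; lra.
Qed.
End Assembly.

From HB Require Import structures.
From mathcomp Require Import all_boot all_order all_algebra.
From mathcomp Require Import complex archimedean.
From mathcomp Require Import zify ring lra.
Set Implicit Arguments.
Unset Strict Implicit.
Unset Printing Implicit Defensive.
Import Order.TTheory GRing.Theory Num.Theory.
Local Open Scope ring_scope.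


(** * Counting *)

(** A cardinality bound for sets of integer vectors that are not known to be finite beforehand. The
    bound lives in the field, so sums and products of estimates need no rounding. *)
Definition atmost (R : numDomainType) (T : eqType) (P : pred T) (x : R) :=
  forall s : seq T, uniq s -> all P s -> (size s)%:R <= x.

Definition zint (a : int) (n : nat) : seq int := [seq a + i%:Z | i <- iota 0 n].

Lemma mem_zint a n z : (z \in zint a n) = (a <= z < a + n%:Z).
Proof.
apply/mapP/idP => [[ i]|/andP[az zn]].
  by rewrite mem_iota => Hi ->; lia.
exists `|z - a|%N; last by lia.
by rewrite mem_iota; lia.
Qed.

Lemma uniq_zint a n : uniq (zint a n).
Proof. by rewrite map_inj_uniq ?iota_uniq // => i j; lia. Qed.

Lemma size_zint a n : size (zint a n) = n.
Proof. by rewrite size_map size_iota. Qed.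

Section Counting.
Variable R : archiRealFieldType.
Implicit Types (T U : eqType) (x y b : R).

Lemma atmost_ge0 T (P : pred T) x : atmost P x -> 0 <= x.
Proof. by move=> /(_ [::]); apply. Qed.

Lemma atmost_sub T (P Q : pred T) x y :
  (forall t, P t -> Q t) -> x <= y -> atmost Q x -> atmost P y.
Proof.
move=> PQ xy Qx s us Ps; apply: le_trans xy; apply: Qx => //.
by apply/allP => t /(allP Ps)/PQ.
Qed.

Lemma atmost_le T (P : pred T) x y : x <= y -> atmost P x -> atmost P y.
Proof. by move=> xy Px s us Ps; apply: le_trans xy; apply: Px. Qed.

Lemma atmost_inj T U (f : T -> U) (P : pred T) (Q : pred U) x :
  (forall t, P t -> Q (f t)) -> (forall t t', P t -> P t' -> f t = f t' -> t = t') ->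
  atmost Q x -> atmost P x.
Proof.
move=> PQ finj Qx s us Ps; rewrite -(size_map f); apply: Qx.
  by rewrite map_inj_in_uniq // => t t' /(allP Ps) Pt /(allP Ps) Pt'; apply: finj.
by apply/allP => _ /mapP[t /(allP Ps) Pt ->]; apply: PQ.
Qed.

(** The empty set satisfies every nonnegative bound, so a member may be assumed. This is how
    additive constants get absorbed later: a member forces the parameters to be at least 1. *)
Lemma atmost_sup T (P : pred T) x : 0 <= x ->
  (forall t, P t -> atmost P x) -> atmost P x.
Proof.
move=> x0 H [|t s] us Ps; first by [].
by apply: (H t) => //; case/andP: Ps.
Qed.

Lemma atmost_seq T (r : seq T) (P : pred T) :
  (forall t, P t -> t \in r) -> atmost P ((size r)%:R : R).
Proof.
move=> Pr s us Ps; rewrite ler_nat; apply: uniq_leq_size => //.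
by move=> t /(allP Ps)/Pr.
Qed.

Lemma atmost_fib T U (g : T -> U) (r : seq U) (b : U -> R) (P : pred T) :
  (forall t, P t -> g t \in r) ->
  (forall u, u \in r -> atmost (fun t => P t && (g t == u)) (b u)) ->
  atmost P (\sum_(u <- r) b u).
Proof.
elim: r P => [|u r IH] P Pr Hb s us Ps.
  case: s us Ps => [|t s] us Ps; first by rewrite big_nil.
  by have := Pr t; have /andP[Pt _] := Ps; rewrite in_nil => /(_ Pt).
rewrite big_cons -(count_predC (fun t => g t == u)) natrD lerD //.
  rewrite -size_filter; apply: (Hb u); rewrite ?mem_head ?filter_uniq //.
  apply/allP => t; rewrite mem_filter => /andP[gt ts].
  by rewrite gt andbT; apply: (allP Ps).
rewrite -size_filter; apply: (IH (fun t => P t && (g t != u))).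
- by move=> t /andP[/Pr]; rewrite inE => /orP[->|].
- move=> v vr; apply: (@atmost_sub _ _ (fun t => P t && (g t == v)) (b v)) => //.
    by move=> t /andP[/andP[-> _] ->].
  by apply: Hb; rewrite inE vr orbT.
- by rewrite filter_uniq.
- by apply/allP => t; rewrite mem_filter => /andP[/= gt ts]; rewrite gt andbT (allP Ps).
Qed.

Lemma atmost_fibc T U (g : T -> U) (r : seq U) b (P : pred T) :
  (forall t, P t -> g t \in r) ->
  (forall u, u \in r -> atmost (fun t => P t && (g t == u)) b) ->
  atmost P ((size r)%:R * b).
Proof.
move=> Pr Hb; apply: atmost_sub (fun _ => id) _ (atmost_fib Pr Hb).
by rewrite big_const_seq count_predT iter_addr_0 mulr_natl.
Qed.

Lemma atmost_or T (P Q1 Q2 : pred T) x y :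
  (forall t, P t -> Q1 t || Q2 t) -> atmost Q1 x -> atmost Q2 y ->
  atmost P (x + y).
Proof.
move=> PQ Q1x Q2y s us Ps.
rewrite -(count_predC Q1) natrD lerD // -size_filter.
  by apply: Q1x; rewrite ?filter_uniq ?filter_all.
apply: Q2y; rewrite ?filter_uniq //.
apply/allP => t; rewrite mem_filter => /andP[/= nQ ts].
by have := PQ _ (allP Ps _ ts); rewrite (negPf nQ).
Qed.

Lemma floor_cell (U a c : R) : 0 < U -> Num.floor (a / U) = Num.floor (c / U) ->
  `|a - c| < U.
Proof.
move=> U0 E.
have U0' : U != 0 by rewrite gt_eqF.
have Ha := floor_le (a / U); have Ha' := floorD1_gt (a / U).
have Hc := floor_le (c / U); have Hc' := floorD1_gt (c / U).
rewrite E in Ha Ha'; rewrite intrD in Ha' Hc'.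
have aE : a / U * U = a by rewrite divfK.
have cE : c / U * U = c by rewrite divfK.
by rewrite ltr_norml; apply/andP; split; nra.
Qed.

(** If n is the floor of l / U, the floor of [g t / U] stays within n + 1 of its value at one chosen
    member, which leaves 2 n + 3 cells. *)
Lemma atmost_cells T (g : T -> R) (P : pred T) (l U b : R) : 0 < U -> 0 <= l ->
  (forall t t', P t -> P t' -> `|g t - g t'| <= l) ->
  (forall z : int, atmost (fun t => P t && (Num.floor (g t / U) == z)) b) ->
  atmost P ((2 * (l / U) + 3) * b).
Proof.
move=> U0 l0 gl Hz; have b0 := atmost_ge0 (Hz 0).
have lU0 : 0 <= l / U by rewrite divr_ge0 // ltW.
apply: atmost_sup => [|t0 Pt0]; first by apply: mulr_ge0 => //; lra.
set z0 := Num.floor (g t0 / U); set n := `|Num.floor (l / U)|%N.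
have nE : n%:Z = Num.floor (l / U) by rewrite /n gez0_abs // floor_ge0.
have nle : n%:R <= l / U by rewrite -[n%:R]/(n%:Z%:~R) nE floor_le.
have ngt : l / U < n%:R + 1.
  by rewrite -[n%:R]/(n%:Z%:~R) nE -[1]/(1%:~R) -intrD floorD1_gt.
apply: (@atmost_sub _ _ P ((2 * n + 3)%N%:R * b)) => //.
  apply: ler_wpM2r => //; rewrite natrD natrM lerD2r; lra.
rewrite -[in (2 * n + 3)%N](size_zint (z0 - n%:Z - 1) (2 * n + 3)).
apply: (@atmost_fibc _ _ (fun t => Num.floor (g t / U))) => // t Pt.
have U0' : U != 0 by rewrite gt_eqF.
have := gl _ _ Pt Pt0; rewrite ler_norml => /andP[g1 g2].
have E : (g t - g t0) / U = g t / U - g t0 / U by rewrite mulrBl.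
have E1 : (g t - g t0) / U <= l / U by rewrite ler_pM2r ?invr_gt0.
have E2 : - (l / U) <= (g t - g t0) / U by rewrite -mulNr ler_pM2r ?invr_gt0.
have F1 := floor_le (g t / U); have F2 := floorD1_gt (g t / U).
have F3 := floor_le (g t0 / U); have F4 := floorD1_gt (g t0 / U).
rewrite mem_zint; set z := Num.floor _ in F1 F2 *.
rewrite -/z0 in F3 F4; rewrite !intrD in F2 F4.
have A1 : (z0 - n%:Z - 2)%:~R < z%:~R :> R by rewrite !intrB -pmulrn; lra.
have A2 : z%:~R < (z0 + n%:Z + 2)%:~R :> R by rewrite !intrD -pmulrn; lra.
by move: A1 A2; rewrite !ltr_int; clear; move: z z0 n => z z0 n; lia.
Qed.

(** Cells of length r hold at most one member each. *)
Lemma atmost_spaced T (g : T -> R) (P : pred T) (l r : R) : 0 < r -> 0 <= l ->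
  (forall t t', P t -> P t' -> `|g t - g t'| <= l) ->
  (forall t t', P t -> P t' -> t != t' -> r <= `|g t - g t'|) ->
  atmost P (2 * (l / r) + 3).
Proof.
move=> r0 l0 gl gr; rewrite -[2 * _ + 3]mulr1.
apply: (atmost_cells r0 l0 gl) => z [|t [|t' s]] //=.
rewrite inE negb_or => /andP[/andP[tt' _] _] /and3P[/andP[Pt /eqP zt] /andP[Pt' /eqP zt'] _].
have := gr _ _ Pt Pt' tt'.
by rewrite leNgt floor_cell // zt zt'.
Qed.

(* Two vectors in a common class have slopes that differ by at least their
   determinant over the product of their abscissas. *)
Lemma atmost_slopes T (a c : T -> int) (P : pred T) (m l r : R) :
  0 < m -> 0 < r -> 0 <= l ->
  (forall t, P t -> m <= (a t)%:~R < 2 * m) ->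
  (forall t t', P t -> P t' ->
     `|(c t)%:~R / (a t)%:~R - (c t')%:~R / (a t')%:~R| <= l) ->
  (forall t t', P t -> P t' -> t != t' ->
     r <= `|(a t * c t' - a t' * c t)%:~R|) ->
  atmost P (8 * (l * m ^+ 2 / r) + 3).
Proof.
move=> m0 r0 l0 am cl cr.
have m2 : 0 < 4 * m ^+ 2 by rewrite mulr_gt0 ?exprn_gt0.
have := @atmost_spaced T (fun t => (c t)%:~R / (a t)%:~R) P l (r / (4 * m ^+ 2)).
set B := 2 * _ + 3; suff -> : B = 8 * (l * m ^+ 2 / r) + 3.
  apply=> //; first by rewrite divr_gt0.
  move=> t t' Pt Pt' tt'; have := cr _ _ Pt Pt' tt'.
  case/andP: (am _ Pt); case/andP: (am _ Pt').
  set x := (a t)%:~R; set x' := (a t')%:~R => x'1 x'2 x1 x2.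
  have x0 : 0 < x by lra.
  have x'0 : 0 < x' by lra.
  have -> : (c t)%:~R / x - (c t')%:~R / x' =
    - (a t * c t' - a t' * c t)%:~R / (x * x').
    by rewrite intrB !intrM -/x -/x'; field; rewrite !gt_eqF.
  rewrite normrM normrN normfV (gtr0_norm (mulr_gt0 x0 x'0)) => H.
  apply: ler_pM => //; [by rewrite ltW|by rewrite invr_ge0 ltW|].
  by rewrite lef_pV2 ?posrE ?mulr_gt0 //; nra.
rewrite /B; field; rewrite gt_eqF //=; rewrite gt_eqF //.
Qed.
End Counting.

(** * The homogeneous system *)

Definition coprime3 (x y z : int) := gcdz (gcdz x y) z == 1.

Lemma coprime3P x y z : coprime3 x y z ->
  exists u v w, u * x + v * y + w * z = 1.
Proof.
move=> /eqP E.
have [u [v Huv]] := Bezoutz (gcdz x y) z.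
have [u' [v' Huv']] := Bezoutz x y.
exists (u * u'), (u * v'), v.
by rewrite -E -Huv -Huv'; ring.
Qed.

(** Proportional primitive vectors agree up to sign: by Bezout the first coordinates divide each
    other, and the positivity of [x * x'] fixes the sign. *)
Lemma coprime3_eq x y z x' y' z' : coprime3 x y z -> coprime3 x' y' z' ->
  0 < x * x' -> x' * y = x * y' -> x' * z = x * z' ->
  [/\ x = x', y = y' & z = z'].
Proof.
move=> /coprime3P[u [v [w E]]] /coprime3P[u' [v' [w' E']]] xx Ey Ez.
have d1 : (x %| x')%Z.
  apply/dvdzP; exists (u * x' + v * y' + w * z'); rewrite -[LHS]mul1r -E.
  transitivity (u * (x * x') + v * (x' * y) + w * (x' * z)); first ring.
  by rewrite Ey Ez; ring.
have d2 : (x' %| x)%Z.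
  apply/dvdzP; exists (u' * x + v' * y + w' * z); rewrite -[LHS]mul1r -E'.
  transitivity (u' * (x * x') + v' * (x * y') + w' * (x * z')); first ring.
  by rewrite -Ey -Ez; ring.
have xx' : x = x'.
  move: d1 d2; rewrite !dvdzE => d1 d2.
  have /eqP : `|x|%N == `|x'|%N by rewrite eqn_dvd d1 d2.
  move=> E0; have [//|Ex] : x = x' \/ x = - x' by move: E0; clear; lia.
  by move: xx; rewrite Ex mulNr oppr_gt0 => /lt_geF; rewrite sqr_ge0.
have x0 : x' != 0 by apply: contraTneq xx => ->; rewrite mulr0 ltxx.
by split=> //; [move: Ey|move: Ez]; rewrite xx' => /(mulfI x0).
Qed.

Lemma dvdz_coprime3 d x y z D : coprime3 x y z ->
  (d %| x * D)%Z -> (d %| y * D)%Z -> (d %| z * D)%Z -> (d %| D)%Z.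
Proof.
move=> /coprime3P[u [v [w E]]] dx dy dz.
have -> : D = u * (x * D) + v * (y * D) + w * (z * D) by rewrite -[LHS]mul1r -E; ring.
by rewrite !rpredD // dvdz_mull.
Qed.

Section Homogeneous.
Variable R : archiRealFieldType.
Implicit Types (X V D : R).
(* [h = (h1, h2, h4)] leaves [h3 = h1 + h4 - h2] implicit; [n = (p, q, k)]. *)
Notation vec := (int * int * int)%type.

Definition lin (h n : vec) : bool :=
  let: (h1, h2, h4) := h in let: (p, q, k) := n in
  h1 * p + (h1 + h4) * k == h2 * q.

Definition quad (h n : vec) : int :=
  let: (h1, h2, h4) := h in let: (p, q, k) := n in
  h1 * h4 * p ^+ 2 - h2 * (h1 + h4 - h2) * q ^+ 2.

Definition hbox X (h : vec) : bool :=
  let: (h1, h2, h4) := h in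
  [&& X <= h1%:~R < 2 * X, X <= h2%:~R < 2 * X, X <= h4%:~R < 2 * X
    & X <= (h1 + h4 - h2)%:~R < 2 * X].

Definition nbox V (n : vec) : bool :=
  let: (p, q, k) := n in
  [&& `|p|%:~R <= V, `|q|%:~R <= V & (p != 0) || (q != 0)].

Definition hprim (h : vec) := let: (h1, h2, h4) := h in coprime3 h1 h2 (h1 + h4).
Definition nprim (n : vec) := let: (p, q, k) := n in coprime3 p q k.

Definition hsol X V D (t : vec * vec) : bool :=
  [&& hbox X t.1, nbox V t.2, lin t.1 t.2 & `|(quad t.1 t.2)%:~R| <= D].

(** Both numbers are near the square root of al / be. If d >= X^2 / 8 the bound is at least 1;
    otherwise both are at least 1/4, so x + y >= 1/2 and the difference of the squares controls that
    of the numbers. *)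
Lemma slope_close X (d al be x y : R) : 0 < X -> X ^+ 2 <= al ->
  X ^+ 2 <= be <= 4 * X ^+ 2 -> 0 <= x <= 1 -> 0 <= y <= 1 ->
  `|al - be * x ^+ 2| <= d -> `|al - be * y ^+ 2| <= d ->
  `|x - y| <= 8 * (d / X ^+ 2).
Proof.
move=> X0 al1 /andP[be1 be2] /andP[x0 x1] /andP[y0 y1].
have X2 : 0 < X ^+ 2 by rewrite exprn_gt0.
rewrite mulrA ler_pdivlMr // !ler_norml => /andP[A1 A2] /andP[B1 B2].
set X2' := X ^+ 2 in X2 al1 be1 be2 *.
have [dl|dl] := lerP (X2' / 8) d.
  have xy : `|x - y| <= 1 by rewrite ler_norml; lra.
  by apply: le_trans (_ : 1 * X2' <= _); [rewrite ler_wpM2r // ltW|lra].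
have lower z : 0 <= z -> al - be * z ^+ 2 <= d -> 1 / 4 <= z.
  move=> z0 zd; rewrite leNgt; apply/negP => zl.
  have z2 : z ^+ 2 <= 1 / 16 by nra.
  have : be * z ^+ 2 <= (4 * X2') * (1 / 16) by apply: ler_pM => //; [lra|nra].
  by lra.
have x2 := lower _ x0 A2; have y2 := lower _ y0 B2.
wlog yx : x y x0 x1 y0 y1 A1 A2 B1 B2 x2 y2 / y <= x.
  move=> W; have /orP[yx|xy] := le_total y x; first by apply: W.
  by rewrite distrC; apply: W.
rewrite ger0_norm ?subr_ge0 //.
have : be * ((x - y) * (x + y)) <= 2 * d.
  have -> : be * ((x - y) * (x + y)) = be * x ^+ 2 - be * y ^+ 2 by ring.
  by lra.
have : X2' * ((x - y) * (1/2)) <= be * ((x - y) * (x + y)).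
  apply: ler_pM => //; [exact: ltW|by lra|by apply: ler_wpM2l; lra].
by lra.
Qed.

(** Modulo h1 + h4 both solutions satisfy h1 p = h2 q. Hence the determinant multiplied by h1, by h2
    or by h1 + h4 is a multiple of h1 + h4, and primitivity of the triple removes the multiplier. *)
Lemma lin_det h p q k p' q' k' : hprim h -> lin h (p, q, k) -> lin h (p', q', k') ->
  let: (h1, h2, h4) := h in ((h1 + h4) %| p * q' - p' * q)%Z.
Proof.
move: h => [[h1 h2] h4] /= hp /eqP E /eqP E'.
apply: (dvdz_coprime3 hp).
- apply/dvdzP; exists (k' * q - k * q').
  have -> : h1 * (p * q' - p' * q) = (h1 * p) * q' - (h1 * p') * q by ring.
  have -> : h1 * p = h2 * q - (h1 + h4) * k by rewrite -E; ring.
  have -> : h1 * p' = h2 * q' - (h1 + h4) * k' by rewrite -E'; ring.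
  ring.
- apply/dvdzP; exists (k' * p - k * p' ).
  have -> : h2 * (p * q' - p' * q) = (h2 * q') * p - (h2 * q) * p' by ring.
  rewrite -E -E'; ring.
- by rewrite dvdz_mulr.
Qed.

Lemma lin_det0 h p q k p' q' k' : 0 < h.1.1 + h.2 -> lin h (p, q, k) -> lin h (p', q', k') ->
  nprim (p, q, k) -> nprim (p', q', k') -> 0 < p * p' -> p * q' = p' * q ->
  (p, q, k) = (p', q', k').
Proof.
move: h => [[h1 h2] h4] /= s0 /eqP E /eqP E' np np' pp det.
have kE : p' * k = p * k'.
  have s0' : h1 + h4 != 0 by rewrite gt_eqF.
  apply: (mulfI s0').
  have -> : (h1 + h4) * (p' * k) = p' * (h2 * q) - h1 * p * p' by rewrite -E; ring.
  have -> : (h1 + h4) * (p * k') = p * (h2 * q') - h1 * p * p' by rewrite -E'; ring.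
  have -> : p' * (h2 * q) = h2 * (p' * q) by ring.
  by rewrite -det; ring.
by have [-> -> ->] := coprime3_eq np np' pp (esym det) kE.
Qed.

(** For a fixed h the slopes q / p lie in an interval of length 8 D / (m^2 X^2), by [slope_close],
    while distinct solutions have determinant at least 2 X in absolute value, by [lin_det]. The size
    m cancels, so all dyadic classes get the same bound. *)
Lemma nprim_class X D h (sp sq : int) (m : R) : 0 < X -> 0 < m -> 0 <= D ->
  hbox X h -> hprim h -> `|sp| = 1 -> `|sq| = 1 ->
  atmost (fun n : vec => [&& nprim n, lin h n, `|(quad h n)%:~R| <= D,
      m <= (sp * n.1.1)%:~R < 2 * m, 0 <= sq * n.1.2 & `|n.1.2| <= `|n.1.1| ])
    (32 * (D / X ^+ 3) + 3).
Proof.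
move=> X0 m0 D0 hb hp sp1 sq1.
have X2 : 0 < X ^+ 2 by rewrite exprn_gt0.
have m2 : 0 < m ^+ 2 by rewrite exprn_gt0.
have sp2 : sp ^+ 2 = 1 by rewrite -(real_normK (num_real sp)) sp1 expr1n.
have sq2 : sq ^+ 2 = 1 by rewrite -(real_normK (num_real sq)) sq1 expr1n.
have -> : 32 * (D / X ^+ 3) + 3 =
   8 * ((8 * (D / m ^+ 2 / X ^+ 2)) * m ^+ 2 / (2 * X)) + 3.
  by field; rewrite !gt_eqF.
apply: (@atmost_slopes _ _ (fun n : vec => sp * n.1.1) (fun n => sq * n.1.2)) => //.
- by rewrite mulr_gt0.
- by rewrite mulr_ge0 // divr_ge0 ?divr_ge0 // ltW.
- by move=> n /and5P[_ _ _ ->].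
- move: h hb {hp} => [[h1 h2] h4] /= /and4P[/andP[h1a h1b] /andP[h2a h2b] /andP[h4a h4b]].
  rewrite intrB intrD => /andP[h3a h3b].
  move=> [[p q] k] [[p' q'] k'] /= /and5P[_ _ Q /andP[pm _] /andP[q0 qp]].
  move=> /and5P[_ _ Q' /andP[pm' _] /andP[q0' qp']].
  have key (x y : int) : `|(h1 * h4 * x ^+ 2 - h2 * (h1 + h4 - h2) * y ^+ 2)%:~R| <= D ->
      m <= (sp * x)%:~R -> 0 <= sq * y -> `|y| <= `|x| ->
      0 <= ((sq * y)%:~R / (sp * x)%:~R : R) <= 1 /\
      `|h1%:~R * h4%:~R - h2%:~R * (h1%:~R + h4%:~R - h2%:~R) *
         ((sq * y)%:~R / (sp * x)%:~R) ^+ 2| <= D / m ^+ 2.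
    move=> Qxy mx y0 yx.
    have sx0 : 0 < (sp * x)%:~R :> R by lra.
    split.
      apply/andP; split; first by apply: divr_ge0; [rewrite ler0z|exact: ltW].
      rewrite ler_pdivrMr // mul1r ler_int.
      have : 0 < sp * x by rewrite -(ltr0z R).
      move: sp1 sq1 y0 yx; clear; nia.
    have sx2 : (sp * x)%:~R ^+ 2 = x%:~R ^+ 2 :> R.
      rewrite -!rmorphXn /=; congr _%:~R.
      by rewrite exprMn sp2 mul1r.
    have sy2 : (sq * y)%:~R ^+ 2 = y%:~R ^+ 2 :> R.
      rewrite -!rmorphXn /=; congr _%:~R.
      by rewrite exprMn sq2 mul1r.
    rewrite exprMn exprVn sx2 sy2.
    have x2 : 0 < x%:~R ^+ 2 :> R by rewrite -sx2 exprn_gt0.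
    have xn0 : x%:~R != 0 :> R by move: x2; apply: contraTneq => ->; rewrite expr0n ltxx.
    have -> : h1%:~R * h4%:~R - h2%:~R * (h1%:~R + h4%:~R - h2%:~R) * (y%:~R ^+ 2 / x%:~R ^+ 2) =
       (h1 * h4 * x ^+ 2 - h2 * (h1 + h4 - h2) * y ^+ 2)%:~R / x%:~R ^+ 2 :> R.
      by rewrite !(intrB, intrD, intrM, rmorphXn) /=; field.
    rewrite normrM normfV (gtr0_norm x2).
    apply: ler_pM; rewrite ?invr_ge0 ?(ltW x2) ?normr_ge0 //.
    rewrite lef_pV2 ?posrE // -sx2; nra.
  have [K1 K2] := key _ _ Q pm q0 qp; have [K1' K2'] := key _ _ Q' pm' q0' qp'.
  apply: (slope_close X0 _ _ K1 K1' K2 K2'); first by rewrite expr2; apply: ler_pM => //; exact: ltW.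
  by apply/andP; split; nra.
move=> [[p q] k] [[p' q'] k'] /= /and5P[np L Q /andP[pm _] /andP[q0 qp]].
move=> /and5P[np' L' Q' /andP[pm' _] /andP[q0' qp']] nn.
have := lin_det hp L L'.
have D0' := lin_det0 _ L L' np np'.
move: h hb {hp L L' Q Q'} D0' => [[h1 h2] h4] /= /and4P[/andP[h1a h1b] /andP[h2a h2b] /andP[h4a h4b] _] D0'.
have s0 : 0 < h1 + h4 by rewrite -(ltr0z R) intrD; lra.
have pp : 0 < p * p'.
  have -> : p * p' = (sp * p) * (sp * p') by rewrite mulrACA -expr2 sp2 mul1r.
  by apply: mulr_gt0; rewrite -(ltr0z R); lra.
have dn0 : p * q' - p' * q != 0.
  by apply: contra nn => /eqP E; apply/eqP/D0' => //; apply/eqP; rewrite -subr_eq0 E.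
move=> /dvdzP[c Ec].
have -> : sp * p * (sq * q') - sp * p' * (sq * q) = sp * sq * (p * q' - p' * q) by ring.
rewrite -intr_norm !normrM sp1 sq1 !mul1r.
have : h1 + h4 <= `|p * q' - p' * q|.
  have c0 : c != 0 by apply: contraNneq dn0 => c0; rewrite Ec c0 mul0r.
  rewrite Ec normrM (gtr0_norm s0) ler_peMl ?(ltW s0) //.
  by rewrite -gtz0_ge1 normr_gt0.
rewrite -(ler_int R) intrD => ?; lra.
Qed.
End Homogeneous.

Lemma coprime3_bezout x y z u v w : u * x + v * y + w * z = 1 -> coprime3 x y z.
Proof.
move=> E; rewrite /coprime3.
have : (gcdz (gcdz x y) z %| u * x + v * y + w * z)%Z.
  rewrite !rpredD // dvdz_mull //.
  - exact: dvdz_trans (dvdz_gcdl _ _) (dvdz_gcdl _ _).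
  - exact: dvdz_trans (dvdz_gcdl _ _) (dvdz_gcdr _ _).
  - exact: dvdz_gcdr.
by rewrite E dvdzE dvdn1 => /eqP; rewrite -[gcdz _ _]gez0_abs // => ->.
Qed.

(** * Vectors (p, q, k) for given shifts, and ratios of shifts for given (p, q, k) *)

Section HomogeneousCounts.
Variable R : archiRealFieldType.
Implicit Types (X V D : R).
Notation vec := (int * int * int)%type.

Lemma trunc_log_bounds (p : int) : p != 0 ->
  (2 ^+ trunc_log 2 `|p|%N <= `|p|%:~R :> R) && (`|p|%:~R < 2 * 2 ^+ trunc_log 2 `|p|%N :> R).
Proof.
move=> p0.
have /(trunc_log_bounds (isT : (1 < 2)%N)) : (0 < `|p|)%N by rewrite absz_gt0.
case/andP=> H1 H2.
have -> : `|p|%:~R = `|p|%N%:R :> R by rewrite -abszE.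
by rewrite -exprS -!natrX ler_nat ltr_nat H1 H2.
Qed.

Definition nsol h V D : pred vec := fun n =>
  [&& nprim n, nbox V n, lin h n & `|(quad h n)%:~R| <= D].

Lemma nsol_half X V D (L : nat) h : 0 < X -> 0 <= D -> V < 2 ^+ L -> hbox X h -> hprim h ->
  atmost (fun n : vec => nsol h V D n && (`|n.1.2| <= `|n.1.1|))
    (4 * L%:R * (32 * (D / X ^+ 3) + 3)).
Proof.
move=> X0 D0 VL hb hp.
have -> : 4 * L%:R = (size [seq (b, i) | b <- enum {: bool * bool}, i <- iota 0 L])%:R :> R.
  by rewrite size_allpairs -cardE card_prod card_bool size_iota natrM.
apply: (@atmost_fibc _ _ _ (fun n : vec => ((0 < n.1.1, 0 <= n.1.2), trunc_log 2 `|n.1.1|%N))).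
  move=> [[p q] k] /= /andP[/and4P[_ /and3P[pV _ n0] _ _] qp].
  have p0 : p != 0.
    by apply: contraTneq n0 => p0; move: qp; rewrite p0 normr0 normr_le0 => /eqP ->; rewrite eqxx.
  apply/allpairsP; exists ((0 < p, 0 <= q), trunc_log 2 `|p|%N).
  split=> //=; first by rewrite mem_enum.
  rewrite mem_iota /= add0n -(@ltn_exp2l 2) // -(ltr_nat R) !natrX.
  have /andP[H1 _] := trunc_log_bounds p0.
  by apply: le_lt_trans VL; apply: le_trans H1 pV.
move=> [[bp bq] i] _.
pose sp : int := if bp then 1 else -1; pose sq : int := if bq then 1 else -1.
apply: (@atmost_sub _ _ _ _ _ _ _ (lexx _)
  (@nprim_class _ X D h sp sq (2 ^+ i) X0 _ D0 hb hp _ _)).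
- move=> [[p q] k] /= /andP[/andP[/and4P[np /and3P[pV _ n0] ln Q] qp]] /eqP[bpE bqE iE].
  have p0 : p != 0.
    by apply: contraTneq n0 => p0; move: qp; rewrite p0 normr0 normr_le0 => /eqP ->; rewrite eqxx.
  have spp : sp * p = `|p|.
    rewrite /sp -bpE; case: (ltP 0 p) => H; first by rewrite mul1r gtr0_norm.
    by rewrite mulN1r ler0_norm.
  have sqq : 0 <= sq * q by rewrite /sq -bqE; case: (leP 0 q) => H; clear -H; lia.
  apply/and5P; split=> //; last by rewrite sqq.
  by rewrite spp -iE trunc_log_bounds.
- by rewrite exprn_gt0.
- by rewrite /sp; case: (bp); rewrite ?normrN normr1.
- by rewrite /sq; case: (bq); rewrite ?normrN normr1.
Qed.

(** With [nswap], the symmetry that exchanges (h1, p) with (h2, q). The last entry is h3, since h1 +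
    h4 = h2 + h3. The linear relation is preserved and the quadratic form changes sign, so one order
    of |p| and |q| suffices in every count. *)
Definition hswap (h : vec) : vec := let: (h1, h2, h4) := h in (h2, h1, h1 + h4 - h2).
Definition nswap (n : vec) : vec := let: (p, q, k) := n in (q, p, - k).

Lemma hswap_box X h : hbox X h -> hbox X (hswap h).
Proof.
case: h => [[h1 h2] h4] /= /and4P[-> -> h4b ->] /=.
by have -> : h2 + (h1 + h4 - h2) - h1 = h4 by ring.
Qed.

Lemma hswap_prim h : hprim h -> hprim (hswap h).
Proof.
case: h => [[h1 h2] h4] /= /coprime3P[u [v [w E]]].
by apply: (@coprime3_bezout _ _ _ v u w); rewrite -E; ring.
Qed.

Lemma nswap_prim n : nprim n -> nprim (nswap n).
Proof.
case: n => [[p q] k] /= /coprime3P[u [v [w E]]].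
by apply: (@coprime3_bezout _ _ _ v u (- w)); rewrite -E; ring.
Qed.

Lemma nswap_inj : injective nswap.
Proof. by move=> [[p q] k] [[p' q'] k'] [-> -> /oppr_inj ->]. Qed.

Lemma lin_swap h n : lin (hswap h) (nswap n) = lin h n.
Proof.
case: h n => [[h1 h2] h4] [[p q] k] /=; rewrite -subr_eq0 -[RHS]subr_eq0 -oppr_eq0.
by congr (_ == _); ring.
Qed.

Lemma quad_swap h n : quad (hswap h) (nswap n) = - quad h n.
Proof. by case: h n => [[h1 h2] h4] [[p q] k] /=; ring. Qed.

Lemma nbox_swap V n : nbox V n -> nbox V (nswap n).
Proof. by case: n => [[p q] k] /= /and3P[-> ->]; rewrite orbC => ->. Qed.

Lemma nsol_count X V D (L : nat) h : 0 < X -> 0 <= D -> V < 2 ^+ L -> hbox X h -> hprim h ->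
  atmost (nsol h V D) (8 * L%:R * (32 * (D / X ^+ 3) + 3)).
Proof.
move=> X0 D0 VL hb hp.
have -> : 8 * L%:R = 4 * L%:R + 4 * L%:R :> R by ring.
rewrite mulrDl.
apply: (@atmost_or _ _ _ (fun n => nsol h V D n && (`|n.1.2| <= `|n.1.1|))
   (fun n => nsol h V D n && (`|n.1.1| <= `|n.1.2|))).
- by move=> n /= ->; rewrite /=; apply: le_total.
- exact: nsol_half.
- apply: atmost_inj (nsol_half X0 D0 VL (hswap_box hb) (hswap_prim hp)); last first.
    by move=> n n' _ _; apply: nswap_inj.
  move=> n /andP[/and4P[H1 H2 H3 H4] H5].
  apply/andP; split; last by case: (n) H5 => [[]].
  by apply/and4P; split; rewrite ?nswap_prim ?nbox_swap ?lin_swap // quad_swap intrN normrN.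
Qed.

(* The ratios [h.2 / h.1.1] of the solutions for fixed shifts are spaced by the
   congruence modulo [c], and confined by the approximate equation. *)
Lemma ratio_count X D (a b c : int) (A B : R) : 0 < X -> 0 <= D -> c != 0 -> B != 0 ->
  coprime3 a b c ->
  atmost (fun h : vec => [&& coprime3 h.1.1 h.2 h.1.2, X <= h.1.1%:~R < 2 * X,
     X <= h.2%:~R < 2 * X, h.1.1 * a + h.2 * b == h.1.2 * c &
     `|h.1.1%:~R * A + h.2%:~R * B| <= D / (2 * X)])
   (8 * D * `|B|^-1 * `|c|%:~R^-1 + 3).
Proof.
move=> X0 D0 c0 B0 cop.
have nB0 : 0 < `|B| by rewrite normr_gt0.
have nc0 : 0 < `|c|%:~R :> R by rewrite ltr0z normr_gt0.
have -> : 8 * D * `|B|^-1 * `|c|%:~R^-1 + 3 = 8 * ((D / (X ^+ 2 * `|B|)) * X ^+ 2 / `|c|%:~R) + 3.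
  by field; rewrite !gt_eqF.
apply: (@atmost_slopes _ _ (fun h : vec => h.1.1) (fun h : vec => h.2)) => //.
- by rewrite divr_ge0 // mulr_ge0 ?exprn_ge0 ?ltW.
- by move=> h /and5P[_ -> _ _ _].
- move=> [[u w] v] [[u' w'] v'] /= /and5P[_ /andP[u1 _] _ _ H] /and5P[_ /andP[u1' _] _ _ H'].
  have key (x y : int) : X <= x%:~R -> `|x%:~R * A + y%:~R * B| <= D / (2 * X) ->
      `|A + y%:~R / x%:~R * B| <= D / (2 * X ^+ 2).
    move=> Xx Hxy; have x0 : 0 < x%:~R :> R by lra.
    have -> : A + y%:~R / x%:~R * B = (x%:~R * A + y%:~R * B) / x%:~R by field; rewrite gt_eqF.
    rewrite normrM normfV (gtr0_norm x0).
    have -> : D / (2 * X ^+ 2) = D / (2 * X) * X^-1 by field; rewrite gt_eqF.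
    by apply: ler_pM; rewrite ?invr_ge0 ?(ltW x0) // lef_pV2 ?posrE.
  have := key _ _ u1 H; have := key _ _ u1' H'.
  set x := _ / _; set y := v%:~R / _ => Hx Hy.
  have E : (y - x) * B = (A + y * B) - (A + x * B) by ring.
  have : `|y - x| * `|B| <= D / (2 * X ^+ 2) + D / (2 * X ^+ 2).
    by rewrite -normrM E; apply: le_trans (ler_normB _ _) _; apply: lerD.
  have -> : D / (2 * X ^+ 2) + D / (2 * X ^+ 2) = D / X ^+ 2 by field; rewrite gt_eqF.
  by move=> Hxy; rewrite invfM mulrA ler_pdivlMr.
- move=> [[u w] v] [[u' w'] v'] /= /and5P[co /andP[u1 _] _ /eqP E _] /and5P[co' /andP[u1' _] _ /eqP E' _] nn.
  have uu : 0 < u * u' by apply: mulr_gt0; rewrite -(ltr0z R); lra.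
  have : (c %| u * v' - u' * v)%Z.
    apply: (dvdz_coprime3 cop).
    - apply/dvdzP; exists (w * v' - w' * v).
      transitivity (v' * (u * a + v * b) - v * (u' * a + v' * b)); first by ring.
      by rewrite E E'; ring.
    - apply/dvdzP; exists (u * w' - u' * w).
      transitivity (u * (u' * a + v' * b) - u' * (u * a + v * b)); first by ring.
      by rewrite E E'; ring.
    - by rewrite dvdz_mulr.
  case/dvdzP=> d Ed.
  have dn0 : u * v' - u' * v != 0.
    apply: contra nn; rewrite subr_eq0 => /eqP det.
    have wE : u' * w = u * w'.
      apply: (mulIf c0).
      transitivity (u' * (u * a + v * b)); first by rewrite E; ring.
      transitivity (u * (u' * a + v' * b)); last by rewrite E'; ring.
      transitivity (u' * u * a + (u' * v) * b); first by ring.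
      by rewrite -det; ring.
    by have [-> -> ->] := coprime3_eq co co' uu (esym det) wE.
  have d0 : d != 0 by apply: contraNneq dn0 => d0; rewrite Ed d0 mul0r.
  rewrite -intr_norm Ed normrM ler_int ler_peMl ?normr_ge0 //.
  by rewrite -gtz0_ge1 normr_gt0.
Qed.
End HomogeneousCounts.

Section MoreCounting.
Variable R : archiRealFieldType.
Implicit Types (T U : eqType) (x y b : R).

Lemma atmost_fibA T U (g : T -> U) (P : pred T) (Q : pred U) x b : 0 <= b ->
  (forall t, P t -> Q (g t)) -> atmost Q x ->
  (forall u, Q u -> atmost (fun t => P t && (g t == u)) b) ->
  atmost P (x * b).
Proof.
move=> b0 PQ Qx Hb s us Ps.
have : atmost (fun t => (t \in s)) ((size (undup (map g s)))%:R * b).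
  apply: (atmost_fibc (g := g)) => [t ts|u]; first by rewrite mem_undup map_f.
  rewrite mem_undup => /mapP[t ts ->].
  apply: atmost_sub (Hb (g t) _) => // [t' /andP[/(allP Ps) -> ->]|] //.
  exact/PQ/(allP Ps).
move=> /(_ s us) H; apply: le_trans (H _) _; first exact/allP.
apply: ler_wpM2r => //; apply: Qx; first exact: undup_uniq.
by apply/allP => u; rewrite mem_undup => /mapP[t ts ->]; apply/PQ/(allP Ps).
Qed.

Lemma sum_subset T (F : T -> R) (s t : seq T) : (forall i, 0 <= F i) -> uniq s ->
  {subset s <= t} -> \sum_(i <- s) F i <= \sum_(i <- t) F i.
Proof.
move=> F0; elim: s t => [|i s IH] t /=; first by rewrite big_nil sumr_ge0.
move=> /andP[iNs us] st.
have it : i \in t by rewrite st // mem_head.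
rewrite big_cons (perm_big _ (perm_to_rem it)) big_cons lerD2l IH // => j js.
have : j \in t by rewrite st // inE js orbT.
by rewrite (perm_mem (perm_to_rem it)) inE; case: eqP => // ji; rewrite -ji js in iNs.
Qed.

Lemma harmonic_le (L : nat) : \sum_(1 <= i < 2 ^ L) (i%:R)^-1 <= L%:R :> R.
Proof.
elim: L => [|L IH]; first by rewrite expn0 big_geq.
have l1 : (1 <= 2 ^ L)%N by rewrite expn_gt0.
have l2 : (2 ^ L <= 2 ^ L.+1)%N by rewrite leq_exp2l.
rewrite (big_cat_nat l1 l2) -natr1 /= lerD //.
apply: le_trans (_ : \sum_(2 ^ L <= i < 2 ^ L.+1) (2 ^ L)%N%:R^-1 <= 1).
  rewrite [leLHS]big_nat [leRHS]big_nat; apply: ler_sum => i /andP[Hi _].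
  by rewrite lef_pV2 ?posrE ?ltr0n ?ler_nat ?(leq_trans l1 Hi).
rewrite sumr_const_nat expnS mul2n -addnn addnK.
have -> : (2 ^ L)%N%:R^-1 *+ (2 ^ L)%N = (2 ^ L)%N%:R^-1 * (2 ^ L)%N%:R :> R.
  by rewrite mulr_natr.
by rewrite mulVf // pnatr_eq0 -lt0n.
Qed.

Lemma harmonic_seq (L : nat) (r : seq nat) : uniq r ->
  (forall l, l \in r -> (l < 2 ^ L)%N) -> \sum_(l <- r) (l%:R)^-1 <= L%:R :> R.
Proof.
move=> ur rL.
(* The list may contain zero, whose inverse is zero by convention. *)
apply: le_trans (_ : \sum_(l <- 0%N :: index_iota 1 (2 ^ L)) (l%:R)^-1 <= _); last first.
  by rewrite big_cons invr0 add0r harmonic_le.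
apply: sum_subset => // [i|l /rL]; first by rewrite invr_ge0 ler0n.
by rewrite inE mem_index_iota lt0n => ->; case: eqP.
Qed.

Lemma inv_sum_le (L : nat) (r : seq int) : uniq r ->
  (forall z, z \in r -> (`|z| < 2 ^ L)%N) ->
  \sum_(z <- r) `|z|%:~R^-1 <= 2 * L%:R :> R.
Proof.
move=> ur rL.
pose t := [seq i%:Z | i <- index_iota 0 (2 ^ L)] ++ [seq - i%:Z | i <- index_iota 0 (2 ^ L)].
apply: le_trans (_ : \sum_(z <- t) `|z|%:~R^-1 <= _).
  apply: sum_subset => // [i|z /rL zL]; first by rewrite invr_ge0 ler0z.
  rewrite mem_cat; have [z0|z0] := leP 0 z; apply/orP; [left|right].
    by apply/mapP; exists `|z|%N; rewrite ?mem_index_iota // gez0_abs.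
  by apply/mapP; exists `|z|%N; rewrite ?mem_index_iota // ltz0_abs // opprK.
have H : \sum_(i <- index_iota 0 (2 ^ L)) (i%:R)^-1 <= L%:R :> R.
  by apply: harmonic_seq => [|l]; rewrite ?iota_uniq // mem_index_iota.
have -> : 2 * L%:R = L%:R + L%:R :> R by ring.
rewrite big_cat /= !big_map; apply: lerD; apply: le_trans H; apply: ler_sum => i _.
  by rewrite -abszE absz_nat.
by rewrite normrN -abszE absz_nat.
Qed.

Lemma atmost_interval (lo hi : R) : lo <= hi ->
  atmost (fun z : int => lo <= z%:~R <= hi) (2 * (hi - lo) + 3).
Proof.
move=> lohi; rewrite -[2 * _]/(2 * (hi - lo)) -[hi - lo]divr1.
apply: (@atmost_spaced _ _ (fun z : int => z%:~R)); rewrite ?subr_ge0 //.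
  by move=> z z' /andP[z1 z2] /andP[z1' z2']; rewrite ler_norml; lra.
move=> z z' _ _ zz'; rewrite -intrB -intr_norm -[1]/(1%:~R) ler_int -gtz0_ge1.
by rewrite normr_gt0 subr_eq0.
Qed.

(** The condition makes p a multiple of w / gcd(u, w). Since zero is excluded, nothing remains when
    V is below this modulus, and otherwise the additive 3 is absorbed; the bound is thus
    proportional to V. *)
Lemma atmost_multiples (V : R) (u w : int) : 0 <= V -> 0 < w ->
  atmost (fun p : int => [&& p != 0, `|p|%:~R <= V & (w %| u * p)%Z])
    (7 * (V * (gcdz u w)%:~R / w%:~R)).
Proof.
move=> V0 w0; set g := gcdz u w.
have g0 : 0 < g by rewrite lt_def gcdz_eq0 negb_and (gt_eqF w0) orbT.
have /dvdzP[w' wE] : (g %| w)%Z := dvdz_gcdr u w.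
have /dvdzP[u' uE] : (g %| u)%Z := dvdz_gcdl u w.
have w'0 : 0 < w' by move: w0; rewrite wE pmulr_lgt0.
have cop : gcdz u' w' = 1.
  have : gcdz u w = gcdz u' w' * g.
    by rewrite {1}uE {1}wE -/g -mulz_gcdl gtz0_abs.
  by rewrite -/g -{1}[g]mul1r => /(mulIf (lt0r_neq0 g0)).
have dvd (p : int) : (w %| u * p)%Z -> (w' %| p)%Z.
  rewrite {1}uE {1}wE mulrAC dvdz_mul2r ?(lt0r_neq0 g0) // => H.
  by rewrite -(@Gauss_dvdzr _ u') // /coprimez gcdzC cop.
have w'R : 0 < w'%:~R :> R by rewrite ltr0z.
have gR : 0 < g%:~R :> R by rewrite ltr0z.
have sp (p : int) : p != 0 -> (w' %| p)%Z -> w'%:~R <= `|p|%:~R :> R.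
  move=> p0 /dvdzP[c E]; rewrite ler_int E normrM (gtr0_norm w'0) ler_peMl ?(ltW w'0) //.
  by rewrite -gtz0_ge1 normr_gt0; apply: contraNneq p0 => c0; rewrite E c0 mul0r.
have -> : V * g%:~R / w%:~R = V / w'%:~R by rewrite wE intrM; field; rewrite !gt_eqF.
have [Vw|Vw] := ltP V w'%:~R.
  apply: atmost_sup => [|p /and3P[p0 pV /dvd pd]]; first by rewrite mulr_ge0 // divr_ge0 // ltW.
  by have := sp _ p0 pd; lra.
have V1 : 1 <= V / w'%:~R by rewrite ler_pdivlMr // mul1r.
apply: (@atmost_le _ _ _ (2 * (2 * V / w'%:~R) + 3)); last first.
  apply: (@atmost_spaced _ _ (fun p : int => p%:~R)) => //; first by rewrite mulr_ge0.
    move=> p p' /= /and3P[_ pV _] /and3P[_ pV' _]; rewrite !intr_norm in pV pV'.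
    by apply: le_trans (ler_normB _ _) _; lra.
  move=> p p' /= /and3P[_ _ /dvd d1] /and3P[_ _ /dvd d2] pp'.
  by rewrite -intrB -intr_norm; apply: sp; rewrite ?subr_eq0 // rpredB.
have -> : 2 * V / w'%:~R = 2 * (V / w'%:~R) by rewrite mulrA.
by lra.
Qed.
End MoreCounting.

(** * Shifts for a fixed primitive (p, q, k) *)

Section HomogeneousTotal.
Variable R : archiRealFieldType.
Implicit Types (X V D : R).
Notation vec := (int * int * int)%type.

(** With a = p + k, b = k and c = q these are c, b, a, a - c and b - c: the modulus c of the
    congruence and the coefficients a (a - c) and b (b - c) of the approximate equation must not
    vanish. *)
Definition ndeg (n : vec) : bool :=
  let: (p, q, k) := n in
  [&& q != 0, k != 0, p + k != 0, p + k - q != 0 & k - q != 0].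

(* With [a = p + k], [b = k], [c = q], the linear relation turns the quadratic form
   into [(h1 + h4) * (h1 * a * (a - c) + h4 * b * (b - c))]. *)
Lemma quad_factor (h1 h2 h4 p q k : int) : lin (h1, h2, h4) (p, q, k) ->
  quad (h1, h2, h4) (p, q, k) =
  (h1 + h4) * (h1 * ((p + k) * (p + k - q)) + h4 * (k * (k - q))).
Proof.
move=> /eqP E /=.
have -> : h2 * (h1 + h4 - h2) * q ^+ 2 = (h2 * q) * ((h1 + h4) * q - h2 * q) by ring.
by rewrite -E; ring.
Qed.

(** A majorant of the smaller of 1 / |a (a - c)| and 1 / |b (b - c)|, divided by |c|. Either term
    alone is constant in one of a and b and would cost a factor V in the sum; for fixed c this one
    is a function of a times a function of b, and its sum over a, b, c costs three logarithms. *)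
Definition weight (n : vec) : R :=
  let: (p, q, k) := n in
  `|q|%:~R^-1 * (`|p + k|%:~R^-1 + `|p + k - q|%:~R^-1) * (`|k|%:~R^-1 + `|k - q|%:~R^-1).

(** The minimum is at most the geometric mean of the two products, and each product is at most a
    quarter of the squared sum of its factors. *)
Lemma min_le_harmonic (x x' y y' : R) : 0 < x -> 0 < x' -> 0 < y -> 0 < y' ->
  Num.min (x * x') (y * y') <= (x + x') * (y + y').
Proof.
move=> x0 x'0 y0 y'0; set m := Num.min _ _.
have m0 : 0 < m by rewrite lt_min !mulr_gt0.
have mx : m <= x * x' by rewrite ge_min lexx.
have my : m <= y * y' by rewrite ge_min lexx orbT.
have u2 : 4 * m <= (x + x') ^+ 2 by have := sqr_ge0 (x - x'); nra.
have v2 : 4 * m <= (y + y') ^+ 2 by have := sqr_ge0 (y - y'); nra.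
have w0 : 0 < (x + x') * (y + y') by rewrite mulr_gt0 // addr_gt0.
have : (4 * m) * (4 * m) <= ((x + x') * (y + y')) ^+ 2.
  by rewrite exprMn; apply: ler_pM => //; rewrite mulr_ge0 // ltW.
by rewrite leNgt => H; apply/negP => H'; nra.
Qed.

(** [ratio_count] applies modulo q to h4 / h1 and, with h1 and h4 exchanged, to h1 / h4. The first
    bound involves 1 / |B| and the second 1 / |A|; the better one is kept. *)
Lemma hsol_count X D n : 0 < X -> 0 <= D -> ndeg n -> nprim n ->
  atmost (fun h => [&& hbox X h, hprim h, lin h n & `|(quad h n)%:~R| <= D])
    (8 * D * weight n + 3).
Proof.
case: n => [[p q] k] X0 D0 /and5P[c0 b0 a0 ac bc] /coprime3P[u [v [w E]]].
set a := p + k in a0 ac *.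
have cop : coprime3 a k q.
  by apply: (@coprime3_bezout _ _ _ u (w - u) v); rewrite -E /a; ring.
have cop' : coprime3 k a q.
  by apply: (@coprime3_bezout _ _ _ (w - u) u v); rewrite -E /a; ring.
pose A : R := (a * (a - q))%:~R; pose B : R := (k * (k - q))%:~R.
have A0 : A != 0 by rewrite intr_eq0 mulf_neq0.
have B0 : B != 0 by rewrite intr_eq0 mulf_neq0.
have cprim h1 h2 h4 : hprim (h1, h2, h4) -> coprime3 h1 h4 h2 /\ coprime3 h4 h1 h2.
  move=> /coprime3P[u' [v' [w' E']]].
  by split; [apply: (@coprime3_bezout _ _ _ (u' + w') w' v')|
    apply: (@coprime3_bezout _ _ _ w' (u' + w') v')]; rewrite -E'; ring.
have small h1 h2 h4 : hbox X (h1, h2, h4) -> lin (h1, h2, h4) (p, q, k) ->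
    `|(quad (h1, h2, h4) (p, q, k))%:~R| <= D -> `|h1%:~R * A + h4%:~R * B| <= D / (2 * X).
  move=> /and4P[/andP[h1X _] _ /andP[h4X _] _] /quad_factor -> .
  rewrite -/a intrM normrM ler_pdivlMr; last by rewrite mulr_gt0.
  move=> H; apply: le_trans H; rewrite mulrC.
  apply: ler_pM; rewrite ?mulr_ge0 ?(ltW X0) //.
    by rewrite ger0_norm ?intrD; lra.
  by rewrite /A /B -!intrM -intrD.
have H1 := ratio_count X0 D0 c0 B0 cop.
have H2 := ratio_count X0 D0 c0 A0 cop'.
have g1 : atmost (fun h => [&& hbox X h, hprim h, lin h (p, q, k) & `|(quad h (p, q, k))%:~R| <= D])
    (8 * D * `|B|^-1 * `|q|%:~R^-1 + 3).
  apply: atmost_sub (lexx _) (H1 A) => -[[h1 h2] h4] /and4P[hb hp hl hq].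
  have [co _] := cprim _ _ _ hp; have S := small _ _ _ hb hl hq.
  case/and4P: hb => b1 b2 b4 b3; apply/and5P; split => //=.
  by move/eqP: hl => /=; rewrite /a => <-; apply/eqP; ring.
have g2 : atmost (fun h => [&& hbox X h, hprim h, lin h (p, q, k) & `|(quad h (p, q, k))%:~R| <= D])
    (8 * D * `|A|^-1 * `|q|%:~R^-1 + 3).
  apply: (@atmost_inj _ _ _ (fun h : vec => (h.2, h.1.2, h.1.1))) (H2 B); last first.
    by move=> [[h1 h2] h4] [[h1' h2'] h4'] _ _ [-> -> ->].
  move=> -[[h1 h2] h4] /and4P[hb hp hl hq].
  have [_ co] := cprim _ _ _ hp; have S := small _ _ _ hb hl hq.
  case/and4P: hb => b1 b2 b4 b3; apply/and5P; split => //=.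
    by move/eqP: hl => /=; rewrite /a => <-; apply/eqP; ring.
  by rewrite addrC.
have q1 : 0 <= 8 * D * `|q|%:~R^-1 :> R by rewrite !mulr_ge0 // invr_ge0 ler0z.
have pos (z : int) : z != 0 -> 0 < `|z|%:~R^-1 :> R.
  by move=> z0; rewrite invr_gt0 ltr0z normr_gt0.
have M := min_le_harmonic (pos _ a0) (pos _ ac) (pos _ b0) (pos _ bc).
have AE : `|A|^-1 = `|a|%:~R^-1 * `|a - q|%:~R^-1.
  by rewrite /A intrM normrM invfM !intr_norm.
have BE : `|B|^-1 = `|k|%:~R^-1 * `|k - q|%:~R^-1.
  by rewrite /B intrM normrM invfM !intr_norm.
rewrite -AE -BE in M.
have M' : 8 * D * `|q|%:~R^-1 * Num.min `|A|^-1 `|B|^-1 + 3 <= 8 * D * weight (p, q, k) + 3.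
  rewrite lerD2r /weight -/a; apply: le_trans (ler_wpM2l q1 M) _.
  by rewrite le_eqVlt; apply/orP; left; apply/eqP; ring.
apply: atmost_le M' _; rewrite minEle; case: ifP => _.
  by rewrite mulrAC.
by rewrite mulrAC.
Qed.

End HomogeneousTotal.

(** * Total number of primitive solutions *)

Section PrimitiveTotal.
Variable R : archiRealFieldType.
Implicit Types (X V D : R).
Notation vec := (int * int * int)%type.

Lemma atmost_prod (T U : eqType) (P : pred T) (Q : pred U) (x y : R) :
  atmost P x -> atmost Q y -> atmost (fun t : T * U => P t.1 && Q t.2) (x * y).
Proof.
move=> Px Qy; apply: (@atmost_fibA _ _ _ fst _ P) => //; first exact: atmost_ge0 Qy.
  by move=> t /andP[].
move=> u Pu; apply: (@atmost_inj _ _ _ snd _ Q) => //.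
  by move=> t /andP[/andP[]].
by move=> [t1 t2] [t1' t2'] /andP[_ /eqP /= ->] /andP[_ /eqP /= ->] ->.
Qed.

Lemma positive_count (lo hi : R) : 0 < lo -> lo <= hi ->
  atmost (fun z : int => lo <= z%:~R < hi) (5 * hi).
Proof.
move=> lo0 lohi; apply: atmost_sup => [|z /andP[zl zh]]; first by rewrite mulr_ge0 //; lra.
have : 1 <= z%:~R :> R by rewrite -[1]/(1%:~R) ler_int -gtz0_ge1 -(ltr0z R); lra.
move=> z1; apply: (@atmost_sub _ _ _ _ _ _ _ _ (atmost_interval lohi)); last by lra.
by move=> t /andP[-> /ltW ->].
Qed.

Lemma hbox_count X : 0 < X -> atmost (hbox X) (1000 * X ^+ 3).
Proof.
move=> X0; have XX : X <= 2 * X by lra.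
have C := positive_count X0 XX.
have := atmost_prod (atmost_prod C C) C.
have -> : 5 * (2 * X) * (5 * (2 * X)) * (5 * (2 * X)) = 1000 * X ^+ 3 by ring.
by apply: atmost_sub => // -[[h1 h2] h4] /and4P[/= -> -> -> _].
Qed.

Lemma sum_const (T : Type) (r : seq T) (e : R) : \sum_(a <- r) e = e * (size r)%:R.
Proof. by rewrite big_const_seq count_predT iter_addr_0 mulr_natr. Qed.

Lemma sum_product_const (T : Type) (r : seq T) (f : T -> R) (k g e : R) :
  \sum_(a <- r) \sum_(b <- r) (k * (g * f a * f b) + e) =
  k * g * (\sum_(a <- r) f a) ^+ 2 + e * (size r)%:R ^+ 2.
Proof.
transitivity (\sum_(a <- r) (k * g * (\sum_(b <- r) f b) * f a + e * (size r)%:R)).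
  apply: eq_bigr => a _; rewrite big_split /= sum_const; congr (_ + _).
  by rewrite mulr_sumr mulr_suml; apply: eq_bigr => b _; ring.
by rewrite big_split /= sum_const -mulr_sumr; ring.
Qed.

Definition psol X V D (t : vec * vec) :=
  [&& hbox X t.1, hprim t.1, nsol t.1 V D t.2 & ndeg t.2].

Lemma nbox_k X V h1 h2 h4 p q k : 0 < X -> hbox X (h1, h2, h4) -> nbox V (p, q, k) ->
  lin (h1, h2, h4) (p, q, k) -> `|k|%:~R <= 2 * V.
Proof.
move=> X0 /and4P[/andP[h1a h1b] /andP[h2a h2b] /andP[h4a _] _] /and3P[pV qV _] /eqP E.
rewrite !intr_norm in pV qV *.
have E' : (h1%:~R + h4%:~R) * k%:~R = h2%:~R * q%:~R - h1%:~R * p%:~R :> R.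
  by rewrite -!intrM -E -intrD -intrM -intrB; congr _%:~R; ring.
have V0 : 0 <= V := le_trans (normr_ge0 _) pV.
have : (2 * X) * `|k%:~R| <= (2 * X) * (2 * V) :> R.
  apply: le_trans (_ : `|(h1%:~R + h4%:~R) * k%:~R| <= _).
    by rewrite normrM; apply: ler_wpM2r => //; rewrite ger0_norm; lra.
  rewrite E'; apply: le_trans (ler_normB _ _) _; rewrite !normrM.
  have -> : 2 * X * (2 * V) = 2 * X * V + 2 * X * V by ring.
  by apply: lerD; apply: ler_pM => //; rewrite ger0_norm; lra.
by rewrite ler_pM2l // mulr_gt0.
Qed.

(** The sum of [hsol_count] over c = q, a = p + k and b = k, at most 7 V values each. The constant 3
    contributes 3 (7 V)^3, and the weights contribute 8 D (4 L)^2 (2 L). *)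
Lemma psol_count_n X V D (L : nat) : 0 < X -> 0 <= V -> 0 <= D -> 6 * V < 2 ^+ L ->
  atmost (psol X V D) (1029 * V ^+ 3 + 256 * L%:R ^+ 3 * D).
Proof.
move=> X0 V0 D0 VL.
apply: atmost_sup => [|[h0 [[p0 q0] k0]]].
  by rewrite addr_ge0 // ?mulr_ge0 ?exprn_ge0.
case/and4P=> _ _ /and4P[_ /= /and3P[p0V q0V n0] _ _] _.
(* A solution has p or q nonzero; from this the length 2 W + 1 <= 6 V + 1 of the range is at most 7
   V. *)
have V1 : 1 <= V.
  have [p0E|p0n] := eqVneq p0 0.
    rewrite p0E eqxx /= in n0; apply: le_trans q0V.
    by rewrite -[1]/(1%:~R) ler_int -gtz0_ge1 normr_gt0.
  by apply: le_trans p0V; rewrite -[1]/(1%:~R) ler_int -gtz0_ge1 normr_gt0.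
set W := `|Num.floor (3 * V)|%N.
have WE : W%:Z = Num.floor (3 * V) by rewrite /W gez0_abs // floor_ge0; lra.
have WV : W%:R <= 3 * V by rewrite -[W%:R]/(W%:Z%:~R) WE floor_le.
have WL : (2 * W < 2 ^ L)%N by rewrite -(ltr_nat R) natrM natrX; lra.
set r := zint (- W%:Z) (2 * W + 1).
have rE z : `|z|%:~R <= 3 * V -> z \in r.
  rewrite -floor_ge_int -WE mem_zint; clear; lia.
have rW z : z \in r -> (`|z| <= W)%N by rewrite mem_zint; clear; lia.
have ur : uniq r := uniq_zint _ _.
pose f (c a : int) : R := `|a|%:~R^-1 + `|a - c|%:~R^-1.
have f0 c a : 0 <= f c a by rewrite addr_ge0 // invr_ge0 ler0z.
apply: (@atmost_le _ _ _ (\sum_(c <- r) \sum_(a <- r) \sum_(b <- r)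
   (8 * D * (`|c|%:~R^-1 * f c a * f c b) + 3))); last first.
  apply: (@atmost_fib _ _ _ (fun t : vec * vec => t.2.1.2)).
    move=> [[[h1 h2] h4] [[p q] k]] /and4P[_ _ /and4P[_ /= /and3P[_ qV _] _ _] _].
    by apply: rE; lra.
  move=> c _.
  apply: (@atmost_fib _ _ _ (fun t : vec * vec => t.2.1.1 + t.2.2)).
    move=> [[[h1 h2] h4] [[p q] k]] /andP[/and4P[hb _ /and4P[_ nb ln _] _] _].
    have kV := nbox_k X0 hb nb ln; case/and3P: nb => pV qV _ /=; apply: rE.
    apply: le_trans (_ : (`|p| + `|k|)%:~R <= _); first by rewrite ler_int ler_normD.
    by rewrite intrD; lra.
  move=> a _.
  apply: (@atmost_fib _ _ _ (fun t : vec * vec => t.2.2)).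
    move=> [[[h1 h2] h4] [[p q] k]] /andP[/andP[/and4P[hb _ /and4P[_ nb ln _] _] _] _].
    have kV := nbox_k X0 hb nb ln; apply: rE => /=; lra.
  move=> b _.
  have [nd|nd] := boolP (ndeg (a - b, c, b) && nprim (a - b, c, b)); last first.
    apply: atmost_sup => [|[[[h1 h2] h4] [[p q] k]]].
      by rewrite addr_ge0 // !mulr_ge0 ?invr_ge0 ?ler0z.
    case/andP=> /andP[/andP[/and4P[_ _ /and4P[np _ _ _] ndg]]] /= /eqP E1 /eqP E2 /eqP E3.
    by move: nd; rewrite -E2 -E3 -E1 addrK np ndg.
  case/andP: nd => nd np.
  apply: atmost_le (atmost_inj (f := fst) _ _ (hsol_count X0 D0 nd np)).
  - by rewrite /weight /f subrK.
  - move=> [h [[p q] k]] /andP[/andP[/andP[/and4P[hb hp /and4P[_ _ ln qd] _]]]].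
    by move=> /= /eqP E1 /eqP E2 /eqP E3; rewrite -E2 -E3 -E1 addrK hb hp ln.
  - move=> [h [[p q] k]] [h' [[p' q'] k']] /andP[/andP[/andP[_ /eqP /= E1]] /eqP E2 /eqP E3].
    move=> /andP[/andP[/andP[_ /eqP /= E1']] /eqP E2' /eqP E3'] -> .
    by rewrite E1 E1' E3 E3' -[p](addrK k) E2 -[p'](addrK k') E2' E3 E3'.
have sumf c : c \in r -> \sum_(a <- r) f c a <= 4 * L%:R.
  move=> cr; rewrite big_split /=.
  have -> : 4 * L%:R = 2 * L%:R + 2 * L%:R :> R by ring.
  apply: lerD.
    by apply: inv_sum_le => // z /rW; move: WL; clear; lia.
  rewrite -(big_map (fun a => a - c) xpredT (fun z => `|z|%:~R^-1)).
  apply: inv_sum_le; first by rewrite map_inj_uniq // => x y /addIr.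
  by move=> _ /mapP[a /rW aW ->]; move: (rW _ cr) WL aW; clear; lia.
have sr : (size r)%:R <= 7 * V by rewrite size_zint natrD natrM; lra.
have E c : \sum_(a <- r) \sum_(b <- r) (8 * D * (`|c|%:~R^-1 * f c a * f c b) + 3) =
   8 * D * `|c|%:~R^-1 * (\sum_(a <- r) f c a) ^+ 2 + 3 * (size r)%:R ^+ 2.
  exact: sum_product_const.
under eq_bigr => c _ do rewrite E.
rewrite big_split /= sum_const addrC; apply: lerD.
  have -> : 3 * (size r)%:R ^+ 2 * (size r)%:R = 3 * (size r)%:R ^+ 3 :> R by ring.
  apply: le_trans (_ : 3 * (7 * V) ^+ 3 <= _); last by rewrite exprMn; lra.
  by rewrite ler_pM2l // lerXn2r ?nnegrE ?ler0n //; lra.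
apply: le_trans (_ : \sum_(c <- r) (128 * D * L%:R ^+ 2) * `|c|%:~R^-1 <= _).
  rewrite [leLHS]big_seq [leRHS]big_seq; apply: ler_sum => c cr.
  have -> : 128 * D * L%:R ^+ 2 * `|c|%:~R^-1 = 8 * D * `|c|%:~R^-1 * (4 * L%:R) ^+ 2 by ring.
  apply: ler_wpM2l; first by rewrite !mulr_ge0 // invr_ge0 ler0z.
  have s0 : 0 <= \sum_(a <- r) f c a by apply: sumr_ge0.
  by rewrite lerXn2r ?nnegrE ?sumf // mulr_ge0.
rewrite -mulr_sumr.
have -> : 256 * L%:R ^+ 3 * D = 128 * D * L%:R ^+ 2 * (2 * L%:R) by ring.
apply: ler_wpM2l; first by rewrite !mulr_ge0 // exprn_ge0.
by apply: inv_sum_le => // z /rW; move: WL; clear; lia.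
Qed.

Lemma psol_count_h X V D (L : nat) : 0 < X -> 0 <= D -> V < 2 ^+ L ->
  atmost (psol X V D) (256 * 1000 * L%:R * (X ^+ 3 + D)).
Proof.
move=> X0 D0 VL.
have := @atmost_fibA _ _ _ fst (psol X V D) (fun h => hbox X h && hprim h)
  (1000 * X ^+ 3) (8 * L%:R * (32 * (D / X ^+ 3) + 3)).
move=> H; apply: atmost_le (H _ _ _ _).
- have -> : 1000 * X ^+ 3 * (8 * L%:R * (32 * (D / X ^+ 3) + 3)) =
     256 * 1000 * L%:R * D + 24 * 1000 * (L%:R * X ^+ 3) by field; rewrite gt_eqF.
  have : 0 <= L%:R * X ^+ 3 :> R by rewrite mulr_ge0 // exprn_ge0 // ltW.
  by lra.
- by rewrite mulr_ge0 // ?mulr_ge0 // addr_ge0 // mulr_ge0 // divr_ge0 // exprn_ge0 // ltW.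
- by move=> [h n] /and4P[-> ->].
- by apply: atmost_sub (hbox_count X0) => // h /andP[].
move=> h /andP[hb hp]; apply: (atmost_inj (f := snd)) (nsol_count X0 D0 VL hb hp) => [t|].
  by move=> /andP[/and4P[_ _ + _] /eqP <-].
by move=> [h1 n1] [h2 n2] /andP[_ /eqP /= ->] /andP[_ /eqP /= ->] ->.
Qed.

(** Up to logarithms, fixing the shifts costs X^3 + D and fixing (p, q, k) costs V^3 + D; the
    smaller of X^3 and V^3 is at most X^2 V. *)
Lemma psol_count X V D (L : nat) : 0 < X -> 0 <= V -> 0 <= D -> 6 * V < 2 ^+ L ->
  atmost (psol X V D) (256 * 1000 * L.+1%:R ^+ 3 * (X ^+ 2 * V + D)).
Proof.
move=> X0 V0 D0 VL.
have L1 : 1 <= L.+1%:R :> R by rewrite ler1n.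
have LL : L%:R <= L.+1%:R :> R by rewrite ler_nat.
have L0 : 0 <= L%:R :> R by [].
have L3 : L.+1%:R <= L.+1%:R ^+ 3 :> R by rewrite exprSr ler_peMl ?exprn_ege1 //; lra.
have L3' : L%:R ^+ 3 <= L.+1%:R ^+ 3 :> R by rewrite lerXn2r ?nnegrE.
have [XV|VX] := leP X V.
  have VL' : V < 2 ^+ L by lra.
  apply: atmost_le (psol_count_h X0 D0 VL').
  apply: ler_pM; [by rewrite !mulr_ge0|by rewrite addr_ge0 // exprn_ge0 // ltW|lra|].
  by rewrite lerD2r exprSr ler_wpM2l // exprn_ge0 // ltW.
apply: atmost_le (psol_count_n X0 V0 D0 VL).
rewrite mulrDr; apply: lerD; last by apply: ler_wpM2r => //; lra.
apply: ler_pM; rewrite ?exprn_ge0 //; first by lra.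
by rewrite exprSr ler_wpM2r // lerXn2r ?nnegrE // ltW.
Qed.
End PrimitiveTotal.

(** * Removal of common divisors *)

Section HomogeneousBound.
Variable R : archiRealFieldType.
Implicit Types (X V D : R).
Notation vec := (int * int * int)%type.

Definition gcd3 (x y z : int) := gcdz (gcdz x y) z.
Definition hgcd (h : vec) := let: (h1, h2, h4) := h in gcd3 h1 h2 (h1 + h4).
Definition ngcd (n : vec) := let: (p, q, k) := n in gcd3 p q k.
Definition vdiv (l : int) (v : vec) : vec := ((v.1.1 %/ l)%Z, (v.1.2 %/ l)%Z, (v.2 %/ l)%Z).

Lemma gcd3_scale x y z l : gcd3 x y z = l -> 0 < l ->
  exists x' y' z', [/\ x = x' * l, y = y' * l, z = z' * l & coprime3 x' y' z'].
Proof.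
move=> E l0.
have /dvdzP[x' xE] : (l %| x)%Z by rewrite -E; apply: dvdz_trans (dvdz_gcdl _ _) (dvdz_gcdl _ _).
have /dvdzP[y' yE] : (l %| y)%Z by rewrite -E; apply: dvdz_trans (dvdz_gcdl _ _) (dvdz_gcdr _ _).
have /dvdzP[z' zE] : (l %| z)%Z by rewrite -E; apply: dvdz_gcdr.
exists x', y', z'; split=> //.
have G a b : gcdz (a * l) (b * l) = gcdz a b * l by rewrite -mulz_gcdl gtz0_abs.
move: E; rewrite /gcd3 xE yE zE !G => E.
by apply/eqP/(mulIf (lt0r_neq0 l0)); rewrite E mul1r.
Qed.

Lemma vdivK l h1 h2 h4 : 0 < l -> vdiv l (h1 * l, h2 * l, h4 * l) = (h1, h2, h4).
Proof. by move=> /lt0r_neq0 l0; rewrite /vdiv /= !mulzK. Qed.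

(** Division by the contents l' and l gives a primitive solution for X / l', V / l and D / (l l')^2.
    Both terms X^2 V and D decrease at least by the factor 1 / (l l'), whose sum over l and l' is a
    product of two harmonic sums. *)
Lemma hsol_scaled X V D (L l l' : nat) : 0 < X -> 0 <= V -> 0 <= D -> 6 * V < 2 ^+ L ->
  (0 < l)%N -> (0 < l')%N ->
  atmost (fun t : vec * vec => [&& hsol X V D t, ndeg t.2, hgcd t.1 == l'%:Z & ngcd t.2 == l%:Z])
   (256 * 1000 * L.+1%:R ^+ 3 * (X ^+ 2 * V + D) * (l'%:R^-1 * l%:R^-1)).
Proof.
move=> X0 V0 D0 VL l0 l'0.
have lR : 0 < l%:R :> R by rewrite ltr0n.
have l'R : 0 < l'%:R :> R by rewrite ltr0n.
have lR1 : 1 <= l%:R :> R by rewrite ler1n.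
have l'R1 : 1 <= l'%:R :> R by rewrite ler1n.
have Vl0 : 0 <= V / l%:R by rewrite divr_ge0 // ltW.
have VlV : V / l%:R <= V by rewrite ler_pdivrMr // ler_peMr.
have D'0 : 0 <= D / (l%:R ^+ 2 * l'%:R ^+ 2) by rewrite divr_ge0 // mulr_ge0 // exprn_ge0.
have VL' : 6 * (V / l%:R) < 2 ^+ L by lra.
apply: (@atmost_le _ _ _ (256 * 1000 * L.+1%:R ^+ 3 * ((X / l'%:R) ^+ 2 * (V / l%:R) + D / (l%:R ^+ 2 * l'%:R ^+ 2)))).
  rewrite -[leRHS]mulrA; apply: ler_wpM2l; first by rewrite !mulr_ge0 // exprn_ge0.
  rewrite mulrDl; apply: lerD.
    have -> : (X / l'%:R) ^+ 2 * (V / l%:R) = X ^+ 2 * V * (l'%:R^-1 * l%:R^-1) * l'%:R^-1.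
      by field; rewrite !gt_eqF.
    by apply: ler_piMr; rewrite ?invf_le1 // !mulr_ge0 ?exprn_ge0 ?invr_ge0 ?(ltW X0).
  have -> : D / (l%:R ^+ 2 * l'%:R ^+ 2) = D * (l'%:R^-1 * l%:R^-1) * (l'%:R^-1 * l%:R^-1).
    by field; rewrite !gt_eqF.
  by apply: ler_piMr; rewrite ?mulr_ile1 ?invr_ge0 ?invf_le1 // !mulr_ge0 ?invr_ge0.
have lz : 0 < l%:Z by [].
have l'z : 0 < l'%:Z by [].
have scale t : [&& hsol X V D t, ndeg t.2, hgcd t.1 == l'%:Z & ngcd t.2 == l%:Z] ->
    exists h1 h2 h4 p q k, t = ((h1 * l'%:Z, h2 * l'%:Z, h4 * l'%:Z), (p * l%:Z, q * l%:Z, k * l%:Z))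
     /\ psol (X / l'%:R) (V / l%:R) (D / (l%:R ^+ 2 * l'%:R ^+ 2)) ((h1, h2, h4), (p, q, k)).
  case: t => [[[h1 h2] h4] [[p q] k]] /and4P[/and4P[hb nb ln qd] nd /eqP /= Eh /eqP /= En].
  have [x [y [z [E1 E2 E3 co]]]] := gcd3_scale Eh l'z.
  have [p' [q' [k' [F1 F2 F3 co']]]] := gcd3_scale En lz.
  have E4 : h4 = (z - x) * l'%:Z by rewrite mulrBl -E3 -E1 addrC addKr.
  exists x, y, (z - x), p', q', k'; split; first by rewrite E1 E2 E4 F1 F2 F3.
  rewrite E1 E2 E4 F1 F2 F3 in hb nb ln qd nd.
  have sc (c : int) : (X <= (c * l'%:Z)%:~R < 2 * X) = (X / l'%:R <= c%:~R < 2 * (X / l'%:R)).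
    by rewrite intrM -pmulrn ler_pdivrMr // mulrA ltr_pdivlMr.
  have ne (c : int) : (c * l%:Z != 0) = (c != 0) by rewrite mulf_eq0 (gt_eqF lz) orbF.
  apply/and4P; split=> /=.
  - move: hb => /=; rewrite -mulrDl -mulrBl !sc; exact.
  - by rewrite addrC subrK.
  - apply/and4P; split => //=.
    + move: nb => /=; rewrite !ne !normrM !intrM (gtr0_norm lz) -pmulrn.
      by rewrite !ler_pdivlMr.
    + move: ln => /eqP /= ln; apply/eqP; apply: (mulIf (lt0r_neq0 (mulr_gt0 lz l'z))).
      transitivity (x * l'%:Z * (p' * l%:Z) + (x * l'%:Z + (z - x) * l'%:Z) * (k' * l%:Z)); first by ring.
      by rewrite ln; ring.
    + rewrite ler_pdivlMr; last by rewrite mulr_gt0 ?exprn_gt0.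
      apply: le_trans qd => /=.
      set Q := (x * (z - x) * p' ^+ 2 - y * (x + (z - x) - y) * q' ^+ 2).
      have -> : x * l'%:Z * ((z - x) * l'%:Z) * (p' * l%:Z) ^+ 2 -
         y * l'%:Z * (x * l'%:Z + (z - x) * l'%:Z - y * l'%:Z) * (q' * l%:Z) ^+ 2 =
         Q * (l%:Z ^+ 2 * l'%:Z ^+ 2) by rewrite /Q; ring.
      have N0 : 0 <= l%:R ^+ 2 * l'%:R ^+ 2 :> R by rewrite mulr_ge0 // exprn_ge0.
      by rewrite intrM normrM intrM !rmorphXn /= -!pmulrn (ger0_norm N0).
  - by move: nd => /=; rewrite -!mulrDl -!mulrBl !ne.
apply: (atmost_inj (f := fun t => (vdiv l'%:Z t.1, vdiv l%:Z t.2)))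
  (psol_count (divr_gt0 X0 l'R) Vl0 D'0 VL').
  by move=> t /scale[h1 [h2 [h4 [p [q [k [-> H]]]]]]]; rewrite /= !vdivK.
move=> t t' /scale[h1 [h2 [h4 [p [q [k [-> _]]]]]]] /scale[h1' [h2' [h4' [p' [q' [k' [-> _]]]]]]].
by rewrite /= !vdivK // => -[-> -> -> -> -> ->].
Qed.

Lemma hsol_ndeg X V D (L : nat) : 0 < X -> 0 <= V -> 0 <= D -> 6 * V < 2 ^+ L -> 4 * X < 2 ^+ L ->
  atmost (fun t : vec * vec => hsol X V D t && ndeg t.2)
   (256 * 1000 * L.+1%:R ^+ 5 * (X ^+ 2 * V + D)).
Proof.
move=> X0 V0 D0 VL XL.
set C := 256 * 1000 * L.+1%:R ^+ 3 * (X ^+ 2 * V + D).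
have C0 : 0 <= C by rewrite /C !mulr_ge0 ?exprn_ge0 // addr_ge0 // mulr_ge0 // exprn_ge0 // ltW.
set r := iota 1 (2 ^ L).-1.
have rE l : l \in r = (0 < l < 2 ^ L)%N.
  by rewrite mem_iota add1n prednK ?expn_gt0.
apply: (@atmost_le _ _ _ (\sum_(l' <- r) \sum_(l <- r) C * (l'%:R^-1 * l%:R^-1))).
  under eq_bigr => l' _ do rewrite -mulr_sumr -mulr_sumr.
  rewrite -mulr_sumr -mulr_suml.
  have H : \sum_(i <- r) i%:R^-1 <= L.+1%:R :> R.
    apply: le_trans (_ : L%:R <= _); last by rewrite ler_nat.
    by apply: harmonic_seq => [|l]; rewrite ?iota_uniq // rE => /andP[].
  have -> : 256 * 1000 * L.+1%:R ^+ 5 * (X ^+ 2 * V + D) = C * (L.+1%:R * L.+1%:R) by rewrite /C; ring.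
  apply: ler_wpM2l => //; apply: ler_pM => //; apply: sumr_ge0 => i _; by rewrite invr_ge0.
have dv (z g : int) (B : R) : 0 <= g -> (g %| z)%Z -> z != 0 -> `|z|%:~R <= B -> B < 2 ^+ L ->
    (0 < `|g| < 2 ^ L)%N.
  move=> g0 /dvdzP[c E] z0 zB BL; have c0 : c != 0 by apply: contraNneq z0 => c0; rewrite E c0 mul0r.
  have gn : g != 0 by apply: contraNneq z0 => gn; rewrite E gn mulr0.
  rewrite absz_gt0 gn -(ltr_nat R) natrX; apply: le_lt_trans BL; apply: le_trans zB.
  rewrite -[_%:R]/((`|g|%N%:Z)%:~R) ler_int E normrM abszE ler_peMl //.
  by rewrite -gtz0_ge1 normr_gt0.
apply: (@atmost_fib _ _ _ (fun t : vec * vec => `|hgcd t.1|%N)).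
  move=> [[[h1 h2] h4] n] /= /andP[/and4P[/and4P[/andP[h1a h1b] _ _ _] _ _ _] _]; rewrite rE.
  have hz : `|h1|%:~R <= 2 * X by rewrite intr_norm ger0_norm; lra.
  have h0 : h1 != 0 by rewrite -(intr_eq0 R) gt_eqF //; lra.
  apply: (@dv h1 (gcd3 h1 h2 (h1 + h4)) (2 * X)) => //; last by lra.
  by apply: dvdz_trans (dvdz_gcdl _ _) (dvdz_gcdl _ _).
move=> l'; rewrite rE => /andP[l'0 _].
apply: (@atmost_fib _ _ _ (fun t : vec * vec => `|ngcd t.2|%N)).
  move=> [h [[p q] k]] /= /andP[/andP[/and4P[_ /and3P[_ qV _] _ _] /and5P[q0 _ _ _ _]] _]; rewrite rE.
  apply: (@dv q (gcd3 p q k) V) => //; last by lra.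
  by apply: dvdz_trans (dvdz_gcdl _ _) (dvdz_gcdr _ _).
move=> l; rewrite rE => /andP[l0 _].
apply: atmost_sub (lexx _) (hsol_scaled X0 V0 D0 VL l0 l'0) => -[[[h1 h2] h4] [[p q] k]].
move=> /= /andP[/andP[/andP[-> ->] /eqP <-] /eqP <-].
by rewrite /= /gcd3 /gcdz /= !eqxx.
Qed.
End HomogeneousBound.

(** * Degenerate solutions of the homogeneous system *)

Section Degenerate.
Variable R : archiRealFieldType.
Implicit Types (X V D : R).
Notation vec := (int * int * int)%type.

Lemma gcd_pairs_count X (g : nat) : 0 < X -> (0 < g)%N ->
  atmost (fun c : int * int => [&& X <= c.1%:~R < 2 * X, X <= c.2%:~R < 4 * X
     & gcdz c.1 c.2 == g%:Z]) (200 * X ^+ 2 / g%:R ^+ 2).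
Proof.
move=> X0 g0; have gR : 0 < g%:R :> R by rewrite ltr0n.
have gz : 0 < g%:Z by [].
have Xg : 0 < X / g%:R by rewrite divr_gt0.
have l1 : X / g%:R <= 2 * (X / g%:R) by lra.
have l2 : X / g%:R <= 4 * (X / g%:R) by lra.
have := atmost_prod (positive_count Xg l1) (positive_count Xg l2).
have -> : 5 * (2 * (X / g%:R)) * (5 * (4 * (X / g%:R))) = 200 * X ^+ 2 / g%:R ^+ 2.
  by field; rewrite gt_eqF.
have sc (c : int) (k : R) : (X <= (c * g%:Z)%:~R < k * X) = (X / g%:R <= c%:~R < k * (X / g%:R)).
  by rewrite intrM -pmulrn ler_pdivrMr // mulrA ltr_pdivlMr.
have div c : [&& X <= c.1%:~R < 2 * X, X <= c.2%:~R < 4 * X & gcdz c.1 c.2 == g%:Z] ->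
    exists x y : int, c = (x * g%:Z, y * g%:Z).
  case: c => x y /and3P[_ _ /eqP /= E].
  have /dvdzP[x' xE] : (g%:Z %| x)%Z by rewrite -E dvdz_gcdl.
  have /dvdzP[y' yE] : (g%:Z %| y)%Z by rewrite -E dvdz_gcdr.
  by exists x', y'; rewrite xE yE.
have gn : g%:Z != 0 by rewrite gt_eqF.
apply: (@atmost_inj _ _ _ (fun c : int * int => ((c.1 %/ g%:Z)%Z, (c.2 %/ g%:Z)%Z))).
  move=> c Hc; have [x [y E]] := div _ Hc; move: Hc; rewrite E => /and3P[H1 H2 _] /=.
  by rewrite !mulzK // -!sc H1 H2.
by move=> c c' /div[x [y ->]] /div[x' [y' ->]]; rewrite /= !mulzK // => -[-> ->].
Qed.

(** For g = gcd(u, w) there are at most 200 X^2 / g^2 pairs (u, w), 10 X values of r and 7 V g / X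
    values of p. The product is 14000 X^2 V / g, and the sum over g is a logarithm. The range of w
    extends to 4 X to allow w = h1 + h4, which occurs for q = 0. *)
Lemma degenerate_count (T : eqType) (P : pred T) (u w r p : T -> int) X V (L : nat) :
  0 < X -> 0 <= V -> 4 * X < 2 ^+ L ->
  (forall t, P t -> [&& X <= (u t)%:~R < 2 * X, X <= (w t)%:~R < 4 * X, X <= (r t)%:~R < 2 * X &
     [&& p t != 0, `|p t|%:~R <= V & (w t %| u t * p t)%Z]]) ->
  (forall t t', P t -> P t' -> u t = u t' -> w t = w t' -> r t = r t' -> p t = p t' -> t = t') ->
  atmost P (14 * 1000 * X ^+ 2 * V * L%:R).
Proof.
move=> X0 V0 XL HP inj.
set rg := iota 1 (2 ^ L).-1.
have rE l : l \in rg = (0 < l < 2 ^ L)%N.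
  by rewrite mem_iota add1n prednK ?expn_gt0.
apply: (@atmost_le _ _ _ (\sum_(g <- rg) (14 * 1000 * X ^+ 2 * V) * g%:R^-1)).
  rewrite -mulr_sumr; apply: ler_wpM2l; first by rewrite !mulr_ge0 ?exprn_ge0 ?(ltW X0).
  by apply: harmonic_seq => [|l]; rewrite ?iota_uniq // rE => /andP[].
have wpos t : P t -> 0 < w t.
  by move/HP=> /and4P[_ /andP[wX _] _ _]; rewrite -(ltr0z R); lra.
apply: (@atmost_fib _ _ _ (fun t => `|gcdz (u t) (w t)|%N)).
  move=> t Pt; have w0 := wpos _ Pt.
  have /and4P[/andP[uX uX'] _ _ _] := HP _ Pt.
  have u0 : 0 < u t by rewrite -(ltr0z R); lra.
  have g0 : (0 < `|gcdz (u t) (w t)|)%N by rewrite absz_gt0 gcdz_eq0 negb_and (gt_eqF w0) orbT.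
  rewrite rE g0 /=; apply: leq_ltn_trans (_ : (`|u t| < 2 ^ L)%N).
    apply: dvdn_leq; first by rewrite absz_gt0 gt_eqF.
    exact: dvdz_gcdl.
  rewrite -(ltr_nat R) natrX -[_%:R]/(`|u t|%N%:Z%:~R) abszE gtr0_norm //; lra.
move=> g; rewrite rE => /andP[g0 _].
have gR : 0 < g%:R :> R by rewrite ltr0n.
have b0 : 0 <= 7 * (V * g%:R / X) by rewrite mulr_ge0 // divr_ge0 ?mulr_ge0 // ltW.
have -> : 14 * 1000 * X ^+ 2 * V * g%:R^-1 =
   200 * X ^+ 2 / g%:R ^+ 2 * (10 * X * (7 * (V * g%:R / X))).
  by field; rewrite !gt_eqF.
apply: (@atmost_fibA _ _ _ (fun t => (u t, w t)) _ _ _ _ _ _ (gcd_pairs_count X0 g0)).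
- by rewrite !mulr_ge0 // ?invr_ge0 // ltW.
- move=> t /andP[/HP /and4P[-> -> _ _] /eqP <-] /=.
  by rewrite /gcdz !eqxx.
move=> [u0 w0] /and3P[/= _ /andP[w0X _] /eqP ge].
apply: (@atmost_fibA _ _ _ r _ (fun z : int => X <= z%:~R < 2 * X)) => //.
- by move=> t /andP[/andP[/HP /and4P[_ _ -> _] _] _].
- have XX : X <= 2 * X by lra.
  by apply: atmost_le (positive_count X0 XX); lra.
move=> r0 _.
have w00 : 0 < w0 by rewrite -(ltr0z R); lra.
apply: (@atmost_le _ _ _ (7 * (V * (gcdz u0 w0)%:~R / w0%:~R))).
  rewrite ge -pmulrn; apply: ler_wpM2l => //; apply: ler_wpM2l; first by rewrite mulr_ge0.
  by rewrite lef_pV2 ?posrE ?ltr0z.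
apply: (@atmost_inj _ _ _ p _ _ _ _ _ (@atmost_multiples R V u0 w0 V0 w00)).
  move=> t /andP[/andP[/andP[/HP /and4P[_ _ _ H] _] /eqP[uE wE]] _].
  by rewrite -uE -wE.
move=> t t' /andP[/andP[/andP[Pt _] /eqP[uE wE]] /eqP rt] /andP[/andP[/andP[Pt' _] /eqP[uE' wE']] /eqP rt'].
by apply: inj => //; rewrite ?uE ?wE ?rt.
Qed.

Lemma lin_inj_k X h p q k k' : 0 < X -> hbox X h -> lin h (p, q, k) -> lin h (p, q, k') -> k = k'.
Proof.
case: h => [[h1 h2] h4] X0 /and4P[/andP[a1 _] _ /andP[d1 _] _] /eqP E /eqP E'.
have s0 : h1 + h4 != 0 by rewrite -(intr_eq0 R) intrD gt_eqF; lra.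
by apply: (mulfI s0); apply: (addrI (h1 * p)); rewrite E E'.
Qed.

(** The coincidence [z n = 0] turns the linear relation into u p = w e q, where e will be 1 or -1.
    So w divides u p, while p determines q and then the relation determines k. *)
Lemma hsol_deg_case (u w r : vec -> int) (e : int) (z : vec -> int) X V D (L : nat) :
  0 < X -> 0 <= V -> 4 * X < 2 ^+ L -> e != 0 ->
  (forall h, hbox X h -> [&& X <= (u h)%:~R < 2 * X, X <= (w h)%:~R < 2 * X
     & X <= (r h)%:~R < 2 * X]) ->
  (forall h h', u h = u h' -> w h = w h' -> r h = r h' -> h = h') ->
  (forall h n, lin h n -> z n = 0 -> u h * n.1.1 = w h * (e * n.1.2)) ->
  atmost (fun t : vec * vec => hsol X V D t && (z t.2 == 0))
    (14 * 1000 * X ^+ 2 * V * L%:R).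
Proof.
move=> X0 V0 XL e0 rng hinj rel.
have wn h : hbox X h -> w h != 0.
  by move/rng=> /and3P[_ /andP[wX _] _]; rewrite -(intr_eq0 R) gt_eqF //; lra.
apply: (@degenerate_count _ _ (u \o fst) (w \o fst) (r \o fst) (fun t => t.2.1.1) _ _ _ X0 V0 XL).
  move=> [h [[p q] k]] /andP[/and4P[hb /and3P[pV _ n0] ln _] /eqP z0] /=.
  have /and3P[-> /andP[w1 w2] ->] := rng _ hb; rewrite w1 pV /=.
  have E := rel _ _ ln z0; rewrite /= in E.
  apply/andP; split; first by lra.
  apply/andP; split; last by rewrite E dvdz_mulr.
  apply: contraTneq n0 => p0; rewrite p0 mulr0 in E.
  by move/esym/eqP: E; rewrite p0 eqxx !mulf_eq0 (negPf (wn _ hb)) (negPf e0) /= => ->.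
move=> [h [[p q] k]] [h' [[p' q'] k']] /andP[/and4P[hb _ ln _] /eqP z0] /andP[/and4P[_ _ ln' _] /eqP z0'].
move=> /= E1 E2 E3 E4; have hh := hinj _ _ E1 E2 E3.
have E := rel _ _ ln z0; have E' := rel _ _ ln' z0'; rewrite /= -hh -E4 E in E'.
have qq : q = q' by apply: (mulfI e0); apply: (mulfI (wn _ hb)).
by move: ln'; rewrite -hh -E4 -qq => /(lin_inj_k X0 hb ln) ->.
Qed.

(* Each coincidence reduces the linear relation to one between two products. *)
Lemma hsol_deg X V D (L : nat) : 0 < X -> 0 <= V -> 4 * X < 2 ^+ L ->
  atmost (fun t : vec * vec => hsol X V D t && ~~ ndeg t.2)
   (70 * 1000 * X ^+ 2 * V * L%:R).
Proof.
move=> X0 V0 XL.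
pose DEG (z : vec -> int) := fun t : vec * vec => hsol X V D t && (z t.2 == 0).
set B := 14 * 1000 * X ^+ 2 * V * L%:R.
have -> : 70 * 1000 * X ^+ 2 * V * L%:R = B + (B + (B + (B + B))) by rewrite /B; ring.
have c0 : atmost (DEG (fun n => n.1.2)) B.
  apply: (@degenerate_count _ _ (fun t => t.1.1.1) (fun t => t.1.1.1 + t.1.2)
    (fun t => t.1.1.2) (fun t => t.2.1.1)) => //.
    move=> [[[h1 h2] h4] [[p q] k]] /andP[/and4P[/and4P[/andP[a1 a2] /andP[b1 b2] /andP[d1 d2] /andP[e1 e2]]
      /and3P[pV _ n0] /eqP /= ln _] /eqP /= q0].
    rewrite q0 eqxx orbF mulr0 in n0 ln; rewrite a1 a2 b1 b2 n0 pV /= intrD.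
    apply/andP; split; first by apply/andP; split; lra.
    by apply/dvdzP; exists (- k); rewrite -[LHS]subr0 -ln; ring.
  move=> [[[h1 h2] h4] [[p q] k]] [[[h1' h2'] h4'] [[p' q'] k']].
  move=> /andP[/and4P[hb _ ln _] /eqP /= q0] /andP[/and4P[_ _ ln' _] /eqP /= q0'] /= E1 E2 E3 E4.
  have E5 : h4 = h4' by move: E2; rewrite E1 => /addrI.
  rewrite -E1 -E3 -E5 -E4 q0' q0 in ln ln' *.
  by rewrite (lin_inj_k X0 hb ln ln').
have k0 : atmost (DEG (fun n => n.2)) B.
  apply: (@hsol_deg_case (fun h => h.1.1) (fun h => h.1.2) (fun h => h.2) 1) => //.
  - by move=> [[h1 h2] h4] /and4P[-> -> -> _].
  - by move=> [[h1 h2] h4] [[h1' h2'] h4'] /= -> -> ->.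
  - by move=> [[h1 h2] h4] [[p q] k] /eqP /= E k0; rewrite mul1r -E k0 mulr0 addr0.
have a0 : atmost (DEG (fun n => n.1.1 + n.2)) B.
  apply: (@hsol_deg_case (fun h => h.2) (fun h => h.1.2) (fun h => h.1.1) (-1)) => //.
  - by move=> [[h1 h2] h4] /and4P[-> -> -> _].
  - by move=> [[h1 h2] h4] [[h1' h2'] h4'] /= -> -> ->.
  - move=> [[h1 h2] h4] [[p q] k] /eqP /= E /eqP; rewrite addrC addr_eq0 => /eqP kE.
    by rewrite mulN1r mulrN -E kE; ring.
have a1 : atmost (DEG (fun n => n.1.1 + n.2 - n.1.2)) B.
  apply: (@hsol_deg_case (fun h => h.2) (fun h => h.1.1 + h.2 - h.1.2) (fun h => h.1.1) 1) => //.
  - by move=> [[h1 h2] h4] /and4P[-> _ -> ->].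
  - move=> [[h1 h2] h4] [[h1' h2'] h4'] /= -> E E'; move: E; rewrite E'.
    by move=> /addrI /oppr_inj ->.
  - move=> [[h1 h2] h4] [[p q] k] /eqP /= E /eqP; rewrite subr_eq0 => /eqP qE.
    by rewrite mul1r mulrBl -E -qE; ring.
have a2 : atmost (DEG (fun n => n.2 - n.1.2)) B.
  apply: (@hsol_deg_case (fun h => h.1.1) (fun h => h.1.1 + h.2 - h.1.2) (fun h => h.2) (-1)) => //.
  - by move=> [[h1 h2] h4] /and4P[-> _ -> ->].
  - move=> [[h1 h2] h4] [[h1' h2'] h4'] /= -> E E'; move: E; rewrite E'.
    by move=> /addrI /oppr_inj ->.
  - move=> [[h1 h2] h4] [[p q] k] /eqP /= E /eqP; rewrite subr_eq0 => /eqP kE.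
    by rewrite mulN1r mulrN mulrBl -E kE; ring.
have cup (P Q : pred (vec * vec)) (x y : R) : atmost P x -> atmost Q y ->
    atmost (fun t => P t || Q t) (x + y) by move=> Px Qy; apply: atmost_or Px Qy.
apply: atmost_sub (lexx _) (cup _ _ _ _ c0 (cup _ _ _ _ k0 (cup _ _ _ _ a0 (cup _ _ _ _ a1 a2)))).
move=> [h [[p q] k]] /andP[hs]; rewrite /DEG hs /= !negb_and !negbK.
by case/or4P => [->|->|->|/orP[->|->]]; rewrite ?orbT.
Qed.

Lemma hsol_bound X V D (L : nat) : 0 < X -> 0 <= V -> 0 <= D ->
  6 * V < 2 ^+ L -> 4 * X < 2 ^+ L ->
  atmost (hsol X V D) (512 * 1000 * L.+1%:R ^+ 5 * (X ^+ 2 * V + D)).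
Proof.
move=> X0 V0 D0 VL XL.
set M := X ^+ 2 * V + D; set l := L.+1%:R ^+ 5 : R.
have M0 : X ^+ 2 * V <= M by rewrite lerDl.
have M1 : 0 <= X ^+ 2 * V by rewrite mulr_ge0 // exprn_ge0 // ltW.
have l1 : L%:R <= l.
  apply: le_trans (_ : L.+1%:R <= _); first by rewrite ler_nat.
  by rewrite /l exprSr ler_peMl // exprn_ege1 // ler1n.
have -> : 512 * 1000 * l * M = 256 * 1000 * l * M + 256 * 1000 * l * M by ring.
apply: (@atmost_or _ _ _ _ (fun t => hsol X V D t && ~~ ndeg t.2) _ _ _ (hsol_ndeg X0 V0 D0 VL XL)).
  by move=> t /= ->; apply: orbN.
apply: atmost_le (hsol_deg (D := D) X0 V0 XL).
have -> : 70 * 1000 * X ^+ 2 * V * L%:R = 70 * 1000 * (L%:R * (X ^+ 2 * V)) by ring.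
have q0 : 0 <= L%:R * (X ^+ 2 * V) by rewrite mulr_ge0.
have q1 : L%:R * (X ^+ 2 * V) <= l * M by apply: ler_pM.
by rewrite -[leRHS]mulrA; lra.
Qed.
End Degenerate.

(** * The inhomogeneous system *)

Section Inhomogeneous.
Variable R : archiRealFieldType.
Implicit Types (P X K Y U D : R).
Notation vec := (int * int * int)%type.

(** One member is set aside as a base point, at the cost of 1; the others will be counted through
    their differences from it. *)
Lemma atmost_diff (T : eqType) (P : pred T) (y : R) : 0 <= y ->
  (forall t0, P t0 -> atmost (fun t => P t && (t != t0)) y) -> atmost P (1 + y).
Proof.
move=> y0 H [|t s] us Ps; first by rewrite addr_ge0.
have /andP[Pt Ps'] := Ps; have /andP[ts us'] := us.
rewrite /= -natr1 addrC lerD2l; apply: (H t Pt) => //.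
apply/allP => t' t's; rewrite (allP Ps' _ t's) /=.
by apply: contraNneq ts => <-.
Qed.

(** The homogeneous solutions are counted only in total over the shifts, not for each h. The
    fibrewise inequality is therefore applied with the actual size of each fibre of Q, a number
    because [r] contains the fibre, and then summed. *)
Lemma atmost_transfer (T U V : eqType) (Q : pred (T * U)) (P : pred (T * V)) (A : pred T)
    (r : seq U) (x z c : R) : 0 <= c -> uniq r ->
  (forall t u, Q (t, u) -> u \in r) -> (forall t v, P (t, v) -> A t) ->
  atmost Q x -> atmost A z ->
  (forall t y, A t -> atmost (fun u => Q (t, u)) y -> atmost (fun v => P (t, v)) (c * (1 + y))) ->
  atmost P (c * (z + x)).
Proof.
move=> c0 ur Qr PA Qx Az H s us Ps.
pose N (t : T) : R := (size [seq u <- r | Q (t, u)])%:R.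
have QN t : atmost (fun u => Q (t, u)) (N t).
  by apply: atmost_seq => u Qtu; rewrite mem_filter Qtu (Qr _ _ Qtu).
set ts := undup (map fst s).
have tsA t : t \in ts -> A t.
  rewrite mem_undup => /mapP[[t' v] tv ->] /=.
  by apply: (PA _ v); apply: (allP Ps).
have : atmost (fun t => t \in s) (\sum_(t <- ts) c * (1 + N t)).
  apply: (@atmost_fib _ _ _ fst) => [t tins|t /tsA At]; first by rewrite mem_undup map_f.
  apply: (@atmost_inj _ _ _ snd _ _ _ _ _ (H t _ At (QN t))).
    by move=> [t' v] /andP[/(allP Ps) + /eqP /= <-].
  by move=> [t1 v1] [t2 v2] /andP[_ /eqP /= ->] /andP[_ /eqP /= ->] ->.
move=> /(_ s us) H1; apply: le_trans (H1 _) _; first exact/allP.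
rewrite -mulr_sumr ler_wpM2l // big_split /= lerD //.
  rewrite sum_const mul1r; apply: Az; first exact: undup_uniq.
  by apply/allP => t /tsA.
have -> : \sum_(t <- ts) N t =
    (size [seq (t, u) | t <- ts, u <- [seq u <- r | Q (t, u)]])%:R.
  by rewrite size_allpairs_dep sumnE big_map natr_sum.
apply: Qx.
  apply: allpairs_uniq_dep => [|t _|]; rewrite ?undup_uniq ?filter_uniq //.
  by move=> [t u] [t' u'] _ _ /= [-> ->].
apply/allP => _ /allpairsPdep[t [u [_ + ->]]].
by rewrite mem_filter => /andP[].
Qed.

Definition cquad (h n : vec) : int :=
  let: (h1, h2, h4) := h in let: (p, q, k) := n in
  let s := h1 + h4 in
  h1 * h4 * (p ^+ 2 - s ^+ 2) - h2 * (h1 + h4 - h2) * (q ^+ 2 - s ^+ 2).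

Definition esol (X N D : R) (t : vec * vec) : bool :=
  [&& hbox X t.1, `|t.2.1.1|%:~R <= N, `|t.2.1.2|%:~R <= N, lin t.1 t.2
    & `|(cquad t.1 t.2)%:~R| <= D].

(* [u = v - v'] and [sg = v + v'] are nearly conjugate for the form
   [al * p^2 - be * q^2], and [sg] is close to its isotropic line; hence so is [u]. *)
Lemma chord_bound X Y U (E al be p q p' q' c0 c c' : R) :
  0 < X -> X <= Y -> 0 <= U -> 2 * U <= Y -> 0 <= E ->
  X ^+ 2 <= al <= 4 * X ^+ 2 -> X ^+ 2 <= be <= 4 * X ^+ 2 ->
  al * p ^+ 2 - be * q ^+ 2 = c0 + c -> al * p' ^+ 2 - be * q' ^+ 2 = c0 + c' ->
  `|c0| <= 48 * X ^+ 4 -> `|c| <= E -> `|c'| <= E ->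
  `|p - p'| <= U -> `|q - q'| <= U -> `|p| <= 2 * Y -> `|p'| <= 2 * Y ->
  Y <= q <= 2 * Y -> Y <= q' <= 2 * Y ->
  `|al * (p - p') ^+ 2 - be * (q - q') ^+ 2| * (3 * Y ^+ 2) <=
    64 * E * U * Y + 16 * E * U ^+ 2 + 768 * X ^+ 4 * U ^+ 2.
Proof.
move=> X0 XY U0 UY E0 /andP[al1 al2] /andP[be1 be2] Hv Hv' Hc0 Hc Hc' Hp Hq p2 p2'.
move=> /andP[q1 q2] /andP[q1' q2'].
have X2 : 0 < X ^+ 2 by rewrite exprn_gt0.
have Y0 : 0 < Y by lra.
set Q := al * (p - p') ^+ 2 - be * (q - q') ^+ 2.
set up := p - p' in Q Hp *; set uq := q - q' in Q Hq *.
pose sp := p + p'; pose sq := q + q'.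
have Hsp : `|sp| <= 4 * Y by apply: le_trans (ler_normD _ _) _; lra.
have Hsq : `|sq| <= 4 * Y by rewrite ger0_norm /sq; lra.
(* Here [c - c'] is the polar form of u and sg, hence small, and the last factor is the form at sg,
   by the parallelogram law 2 f(v) + 2 f(v') = f(u) + f(sg). Eliminating between the two isolates
   the form at u. *)
have id : be * sq ^+ 2 * Q = (c - c') * (al * up * sp + be * uq * sq)
     - al * up ^+ 2 * (2 * (c + c') + 4 * c0 - Q).
  have -> : c - c' = al * up * sp - be * uq * sq.
    have -> : c - c' = (c0 + c) - (c0 + c') by ring.
    by rewrite -Hv -Hv' /up /uq /sp /sq; ring.
  have -> : 2 * (c + c') + 4 * c0 = 2 * (c0 + c) + 2 * (c0 + c') by ring.
  by rewrite -Hv -Hv' /Q /up /uq /sp /sq; ring.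
have N1 : `|(c - c') * (al * up * sp + be * uq * sq)| <= (2 * E) * (32 * X ^+ 2 * U * Y).
  rewrite normrM; apply: ler_pM => //.
    by apply: le_trans (ler_normB _ _) _; lra.
  apply: le_trans (ler_normD _ _) _; rewrite !normrM.
  have -> : 32 * X ^+ 2 * U * Y = (4 * X ^+ 2) * U * (4 * Y) + (4 * X ^+ 2) * U * (4 * Y) by ring.
  apply: lerD; (apply: ler_pM; rewrite ?mulr_ge0 // ; apply: ler_pM => //; rewrite ger0_norm; lra).
have N2 : `|2 * (c + c') + 4 * c0 - Q| <= 4 * E + 192 * X ^+ 4 + `|Q|.
  apply: le_trans (ler_normB _ _) _; rewrite lerD2r.
  apply: le_trans (ler_normD _ _) _; rewrite !normrM !normr_nat.
  by have := ler_normD c c'; lra.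
have A0 : 0 <= al * up ^+ 2 by rewrite mulr_ge0 ?sqr_ge0 //; lra.
have up2 : up ^+ 2 <= U ^+ 2 by rewrite -[up ^+ 2]ger0_norm ?sqr_ge0 // normrX lerXn2r ?nnegrE.
have A1 : al * up ^+ 2 <= 4 * X ^+ 2 * U ^+ 2 by apply: ler_pM; rewrite ?sqr_ge0 //; lra.
have N3 : `|al * up ^+ 2 * (2 * (c + c') + 4 * c0 - Q)| <=
    4 * X ^+ 2 * U ^+ 2 * (4 * E + 192 * X ^+ 4 + `|Q|).
  by rewrite normrM (ger0_norm A0); apply: ler_pM.
have LB : 4 * X ^+ 2 * Y ^+ 2 * `|Q| <= `|be * sq ^+ 2 * Q|.
  rewrite normrM; apply: ler_wpM2r => //; rewrite ger0_norm; last by rewrite mulr_ge0 ?sqr_ge0 //; lra.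
  have -> : 4 * X ^+ 2 * Y ^+ 2 = X ^+ 2 * (2 * Y) ^+ 2 by ring.
  apply: ler_pM; rewrite ?sqr_ge0 //.
  by rewrite lerXn2r ?nnegrE // /sq; lra.
have UB : `|be * sq ^+ 2 * Q| <= (2 * E) * (32 * X ^+ 2 * U * Y) +
    4 * X ^+ 2 * U ^+ 2 * (4 * E + 192 * X ^+ 4 + `|Q|).
  by rewrite id; apply: le_trans (ler_normB _ _) _; apply: lerD.
have UY2 : 4 * U ^+ 2 <= Y ^+ 2.
  have -> : 4 * U ^+ 2 = (2 * U) ^+ 2 by ring.
  by rewrite lerXn2r ?nnegrE //; lra.
have Z : X ^+ 2 * (4 * U ^+ 2 * `|Q|) <= X ^+ 2 * (Y ^+ 2 * `|Q|).
  by rewrite ler_pM2l // ler_wpM2r.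
rewrite -(ler_pM2l X2); move: (le_trans LB UB) Z.
set x2 := X ^+ 2; have -> : X ^+ 4 = x2 ^+ 2 by rewrite /x2 -exprM.
set qq := `|Q|; move=> H1 H2.
have -> : x2 * (qq * (3 * Y ^+ 2)) = 4 * x2 * Y ^+ 2 * qq - x2 * (Y ^+ 2 * qq) by ring.
have -> : x2 * (64 * E * U * Y + 16 * E * U ^+ 2 + 768 * x2 ^+ 2 * U ^+ 2) =
  2 * E * (32 * x2 * U * Y) + 4 * x2 * U ^+ 2 * (4 * E + 192 * x2 ^+ 2 + qq) - x2 * (4 * U ^+ 2 * qq) by ring.
lra.
Qed.
End Inhomogeneous.

(** * Blocks for the inhomogeneous system *)

Section Blocks.
Variable R : archiRealFieldType.
Notation vec := (int * int * int)%type.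
Implicit Types (P X K Y U : R).

(** Chosen so that X^4, the order of the terms in s^2, becomes at most the tolerance X P^5 after
    division by it; see [X4_le]. *)
Definition nblocks P X : R := 1 + X ^+ 3 / P ^+ 5.
(** Of the order of max(X, Y) over the number of blocks. For Y < X a block of this size already
    makes the form of a difference small, so a finer division would only waste blocks. *)
Definition blocksize P X Y : R := (Y + X) / (4 * nblocks P X).
Definition blocktol P X K : R := 76 * K * (X * P ^+ 5) / nblocks P X.

Definition qclass Y (sq : int) (n : vec) : bool :=
  (Y <= (sq * n.1.2)%:~R < 2 * Y) && (`|n.1.1| <= `|n.1.2|).

Lemma nblocks_ge1 P X : 0 < P -> 0 < X -> 1 <= nblocks P X.
Proof. by move=> P0 X0; rewrite /nblocks lerDl divr_ge0 ?ltW // exprn_gt0. Qed.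

Lemma nblocks_gt0 P X : 0 < P -> 0 < X -> 0 < nblocks P X.
Proof. by move=> P0 X0; apply: lt_le_trans ltr01 (nblocks_ge1 P0 X0). Qed.

Lemma X4_le P X : 0 < P -> 0 < X -> X ^+ 4 / nblocks P X <= X * P ^+ 5.
Proof.
move=> P0 X0; have P5 : 0 < P ^+ 5 by exact: exprn_gt0.
rewrite ler_pdivrMr ?nblocks_gt0 // /nblocks mulrDr mulr1.
have -> : X * P ^+ 5 * (X ^+ 3 / P ^+ 5) = X ^+ 4 by field; rewrite gt_eqF.
by rewrite lerDr mulr_ge0 // ltW.
Qed.

Lemma blocksize_gt0 P X Y : 0 < P -> 0 < X -> 0 < Y -> 0 < blocksize P X Y.
Proof. by move=> P0 X0 Y0; rewrite divr_gt0 ?mulr_gt0 ?nblocks_gt0 // addr_gt0. Qed.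

(** For Y <= X a block has length at most X / (2 n) with n = [nblocks P X], so each of the two terms
    of the form is at most X^4 / n^2, within the tolerance by [X4_le]. *)
Lemma quad_small P X K h p q Y : 1 <= P -> 0 < X -> 1 <= K -> 0 < Y -> Y <= X -> hbox X h ->
  `|p%:~R| <= blocksize P X Y -> `|q%:~R| <= blocksize P X Y ->
  forall k, `|(quad h (p, q, k))%:~R| <= blocktol P X K.
Proof.
move=> P1 X0 K1; have P0 : 0 < P := lt_le_trans ltr01 P1.
have P5 : 0 < P ^+ 5 := exprn_gt0 5 P0; have nb0 := nblocks_gt0 P0 X0.
case: h => [[h1 h2] h4] Y0 YX /and4P[/andP[a1 a2] /andP[b1 b2] /andP[d1 d2]].
rewrite intrB intrD => /andP[e1 e2] pU qU k /=.
rewrite !(intrB, intrD, intrM) -!expr2.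
set U := blocksize P X Y in pU qU; have U0 : 0 <= U := le_trans (normr_ge0 _) pU.
have XU : 2 * nblocks P X * U <= X.
  have -> : 2 * nblocks P X * U = (Y + X) / 2 by rewrite /U /blocksize; field; rewrite gt_eqF.
  lra.
have sq (x : R) : `|x| <= U -> x ^+ 2 <= U ^+ 2.
  by move=> xU; rewrite -[x ^+ 2]ger0_norm ?sqr_ge0 // normrX lerXn2r ?nnegrE.
have bd (a b x : R) : X <= a <= 2 * X -> X <= b <= 2 * X -> `|x| <= U ->
    0 <= a * b * x ^+ 2 <= 4 * X ^+ 2 * U ^+ 2.
  move=> /andP[? ?] /andP[? ?] /sq xU; apply/andP; split.
    by apply: mulr_ge0; [apply: mulr_ge0; lra|exact: sqr_ge0].
  have -> : 4 * X ^+ 2 * U ^+ 2 = (2 * X) * (2 * X) * U ^+ 2 by ring.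
  by apply: ler_pM; rewrite ?sqr_ge0 ?mulr_ge0 //; [lra|lra|apply: ler_pM => //; lra].
have H1 := bd h1%:~R h4%:~R _ _ _ pU; have H2 := bd h2%:~R (h1%:~R + h4%:~R - h2%:~R) _ _ _ qU.
have T : 4 * X ^+ 2 * U ^+ 2 <= blocktol P X K.
  have -> : blocktol P X K = 76 * K * (X * P ^+ 5 / nblocks P X) by rewrite /blocktol -[LHS]mulrA.
  apply: le_trans (_ : 1 * (X ^+ 4 / nblocks P X / nblocks P X) <= _).
    have -> : X ^+ 4 / nblocks P X / nblocks P X = X ^+ 2 * (X / nblocks P X) ^+ 2 by field; rewrite gt_eqF.
    have -> : 4 * X ^+ 2 * U ^+ 2 = X ^+ 2 * (2 * U) ^+ 2 by ring.
    rewrite mul1r; apply: ler_wpM2l; first by rewrite sqr_ge0.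
    have UX : 2 * U <= X / nblocks P X by rewrite ler_pdivlMr //; lra.
    by apply: lerXn2r => //; rewrite nnegrE; [exact: mulr_ge0|rewrite divr_ge0 // ltW].
  apply: ler_pM => //; [by rewrite !divr_ge0 ?exprn_ge0 ?ltW|by lra|].
  by apply: ler_wpM2r; [rewrite invr_ge0 ltW|exact: X4_le].
apply: le_trans T.
have /andP[u1 u2] : 0 <= (h1%:~R * h4%:~R * p%:~R ^+ 2 : R) <= 4 * X ^+ 2 * U ^+ 2 by apply: H1; apply/andP; split; lra.
have /andP[v1 v2] : 0 <= (h2%:~R * (h1%:~R + h4%:~R - h2%:~R) * q%:~R ^+ 2 : R) <= 4 * X ^+ 2 * U ^+ 2 by apply: H2; apply/andP; split; lra.
by rewrite ler_norml; apply/andP; split; lra.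
Qed.

(** The terms in s^2 amount to a constant c0 = (al - be) s^2 common to all solutions with the same
    h, to which [chord_bound] applies. The relative length w = U / Y is at most 1 / (2 n), so the
    errors of orders E w, E w^2 and X^4 w^2 are all O(K X P^5 / n). *)
Lemma quad_chord P X K h p q k p' q' k' Y sq : 1 <= P -> 0 < X -> 1 <= K -> 0 < Y -> X <= Y -> hbox X h -> `|sq| = 1 ->
  `|(cquad h (p, q, k))%:~R| <= K * X * P ^+ 5 ->
  `|(cquad h (p', q', k'))%:~R| <= K * X * P ^+ 5 ->
  qclass Y sq (p, q, k) -> qclass Y sq (p', q', k') ->
  `|p%:~R - p'%:~R| <= blocksize P X Y -> `|q%:~R - q'%:~R| <= blocksize P X Y ->
  forall l, `|(quad h (p - p', q - q', l))%:~R| <= blocktol P X K.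
Proof.
move=> P1 X0 K1; have P0 : 0 < P := lt_le_trans ltr01 P1.
have P5 : 0 < P ^+ 5 := exprn_gt0 5 P0; have nb0 := nblocks_gt0 P0 X0.
case: h => [[h1 h2] h4] Y0 XY /and4P[/andP[a1 a2] /andP[b1 b2] /andP[d1 d2]].
rewrite intrB intrD => /andP[e1 e2] sq1 Hc Hc' /andP[/andP[q1 q2] pq] /andP[/andP[q1' q2'] pq'] pU qU l.
rewrite /= in q1 q2 pq q1' q2' pq'.
have sq2 : sq%:~R ^+ 2 = 1 :> R.
  by rewrite -rmorphXn /= -(real_normK (num_real sq)) sq1 expr1n.
set al := h1%:~R * h4%:~R : R; set be := h2%:~R * (h1%:~R + h4%:~R - h2%:~R) : R.
set s := h1%:~R + h4%:~R : R.
set U := blocksize P X Y in pU qU; have U0 : 0 <= U := le_trans (normr_ge0 _) pU.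
have bd (a b : R) : X <= a <= 2 * X -> X <= b <= 2 * X -> X ^+ 2 <= a * b <= 4 * X ^+ 2.
  move=> /andP[? ?] /andP[? ?]; apply/andP; split.
    by rewrite expr2; apply: ler_pM => //; exact: ltW.
  have -> : 4 * X ^+ 2 = (2 * X) * (2 * X) by ring.
  by apply: ler_pM => //; lra.
have Hal : X ^+ 2 <= al <= 4 * X ^+ 2 by apply: bd; apply/andP; split; lra.
have Hbe : X ^+ 2 <= be <= 4 * X ^+ 2 by apply: bd; apply/andP; split; lra.
have UnY : 2 * nblocks P X * U <= Y.
  have -> : 2 * nblocks P X * U = (Y + X) / 2 by rewrite /U /blocksize; field; rewrite gt_eqF.
  lra.
have UY : 2 * U <= Y.
  by apply: le_trans UnY; rewrite -mulrA ler_pM2l // ler_peMl // nblocks_ge1.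
set E := K * X * P ^+ 5 in Hc Hc'.
have E0 : 0 <= E by rewrite /E; apply: mulr_ge0; [apply: mulr_ge0|]; apply: ltW => //; clear -K1; lra.
have sgn (x : int) : (sq * x)%:~R ^+ 2 = x%:~R ^+ 2 :> R by rewrite intrM exprMn sq2 mul1r.
have normq (x : int) : `|(sq * x)%:~R| = `|x%:~R| :> R.
  by rewrite intrM normrM -intr_norm sq1 mul1r.
have pY (x y : int) : `|x| <= `|y| -> (sq * y)%:~R < 2 * Y -> Y <= (sq * y)%:~R -> `|x%:~R| <= 2 * Y.
  move=> xy y2 y1; apply: le_trans (_ : `|y%:~R| <= _); first by rewrite -!intr_norm ler_int.
  by rewrite -normq ger0_norm; clear -y2 y1 Y0; lra.
have := @chord_bound R X Y U E al be p%:~R (sq * q)%:~R p'%:~R (sq * q')%:~R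
  ((al - be) * s ^+ 2) (cquad (h1, h2, h4) (p, q, k))%:~R (cquad (h1, h2, h4) (p', q', k'))%:~R
  X0 XY U0 UY E0 Hal Hbe.
have cq x y z : al * x%:~R ^+ 2 - be * (sq * y)%:~R ^+ 2 =
   (al - be) * s ^+ 2 + (cquad (h1, h2, h4) (x, y, z))%:~R.
  by rewrite sgn /= !(intrB, intrD, intrM) /s /al /be; ring.
move=> /(_ (cq _ _ _) (cq _ _ _)) H.
have C0 : `|(al - be) * s ^+ 2| <= 48 * X ^+ 4.
  have -> : 48 * X ^+ 4 = (3 * X ^+ 2) * (4 * X) ^+ 2 by ring.
  rewrite normrM; apply: ler_pM => //.
    by rewrite ler_norml; move: Hal Hbe; clear => /andP[? ?] /andP[? ?]; lra.
  rewrite ger0_norm ?sqr_ge0 //; apply: lerXn2r; rewrite ?nnegrE /s.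
  - by clear -X0 a1 d1; lra.
  - by clear -X0; lra.
  - by clear -a2 d2; lra.
have qd : `|(sq * q)%:~R - (sq * q')%:~R| <= U.
  by rewrite -intrB -mulrBr normq intrB.
have h := H C0 Hc Hc' pU qd (pY _ _ pq q2 q1) (pY _ _ pq' q2' q1').
have {H h} H : `|al * (p%:~R - p'%:~R) ^+ 2 - be * (q%:~R - q'%:~R) ^+ 2| * (3 * Y ^+ 2) <=
    64 * E * U * Y + 16 * E * U ^+ 2 + 768 * X ^+ 4 * U ^+ 2.
  have -> : (q%:~R - q'%:~R) ^+ 2 = ((sq * q)%:~R - (sq * q')%:~R) ^+ 2 :> R.
    by rewrite !intrM -mulrBr exprMn sq2 mul1r.
  by apply: h; apply/andP; split => //; exact: ltW.
have -> : (quad (h1, h2, h4) (p - p', q - q', l))%:~R =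
   al * (p%:~R - p'%:~R) ^+ 2 - be * (q%:~R - q'%:~R) ^+ 2 :> R.
  by rewrite /= !(intrB, intrD, intrM) /al /be; ring.
move: H; set Q := `|_| => H.
set w := U / Y.
have w0 : 0 <= w by rewrite divr_ge0 // ltW.
have UE : U = w * Y by rewrite /w divfK // gt_eqF.
have wn : 2 * nblocks P X * w <= 1 by rewrite /w mulrA ler_pdivrMr // mul1r.
have Y2 : 0 < Y ^+ 2 by rewrite exprn_gt0.
have {H} : Q * 3 <= 64 * E * w + 16 * E * w ^+ 2 + 768 * X ^+ 4 * w ^+ 2.
  rewrite -(ler_pM2r Y2) -[Q * 3 * _]mulrA; apply: le_trans H _; rewrite UE.
  by rewrite le_eqVlt; apply/orP; left; apply/eqP; ring.
have wi : w <= (nblocks P X)^-1 / 2.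
  by rewrite -[w]mul1r; rewrite ler_pdivlMr // -(ler_pM2l nb0) mulfV ?gt_eqF //; lra.
set v := (nblocks P X)^-1 in wi.
have v0 : 0 < v by rewrite invr_gt0.
have v1 : v <= 1 by rewrite invf_le1 // nblocks_ge1.
have w2 : w ^+ 2 <= v ^+ 2 / 4.
  have -> : v ^+ 2 / 4 = (v / 2) ^+ 2 by field.
  by rewrite lerXn2r ?nnegrE //; lra.
have X4 : 768 * X ^+ 4 * w ^+ 2 <= 192 * (X * P ^+ 5 * v).
  apply: le_trans (_ : 768 * X ^+ 4 * (v ^+ 2 / 4) <= _).
    by apply: ler_wpM2l => //; rewrite mulr_ge0 // exprn_ge0 // ltW.
  have -> : 768 * X ^+ 4 * (v ^+ 2 / 4) = 192 * (X ^+ 4 * v * v) by field.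
  by apply: ler_wpM2l => //; apply: ler_wpM2r; [exact: ltW|exact: X4_le].
have E1 : 64 * E * w <= 32 * (E * v).
  have -> : 32 * (E * v) = 64 * E * (v / 2) by field.
  by apply: ler_wpM2l => //; rewrite mulr_ge0.
have E2 : 16 * E * w ^+ 2 <= 4 * (E * v).
  apply: le_trans (_ : 16 * E * (v ^+ 2 / 4) <= _); first by apply: ler_wpM2l => //; rewrite mulr_ge0.
  have -> : 16 * E * (v ^+ 2 / 4) = 4 * (E * v * v) by field.
  by apply: ler_wpM2l => //; rewrite ler_piMr // mulr_ge0 // ltW.
have Z : X * P ^+ 5 * v <= E * v.
  apply: ler_wpM2r; first exact: ltW.
  by rewrite /E -mulrA ler_peMl // mulr_ge0 ?ltW.
(* The three error terms amount to 32 + 4 + 192 = 228 times E v, and 228 is 3 times 76. *)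
have -> : blocktol P X K = 76 * (E * v) by rewrite /blocktol /E /v; ring.
move=> H; have : 0 <= E * v by rewrite mulr_ge0 // ltW.
lra.
Qed.
End Blocks.

Section ClassCount.
Variable R : archiRealFieldType.
Notation vec := (int * int * int)%type.
Implicit Types (P X K Y U : R).

(** The first factor counts the cells for p, the second those for q once p lies in a given cell. A
    full grid would give a count quadratic in the number of blocks; since q is confined to an
    interval of length about U + P^5 / (X Y), the product stays linear. *)
Lemma cell_ineq P X K Y : 1 <= P -> 0 < X -> 1 <= K -> 0 < Y ->
  (2 * (4 * Y / blocksize P X Y) + 3) *
  (2 * (Num.min Y (8 * blocksize P X Y + K * P ^+ 5 / (X * Y)) / blocksize P X Y) + 3)
    <= 1300 * K * nblocks P X.
Proof.
move=> P1 X0 K1 Y0; set U := blocksize P X Y; have P0 : 0 < P := lt_le_trans ltr01 P1.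
have P5 : 0 < P ^+ 5 := exprn_gt0 5 P0; have n0 := nblocks_gt0 P0 X0.
have n1 := nblocks_ge1 P0 X0; have U0 : 0 < U := blocksize_gt0 P0 X0 Y0.
set n := nblocks P X in n0 n1 *; pose y := Y / (Y + X).
have YX : 0 < Y + X by rewrite addr_gt0.
have y1 : y <= 1 by rewrite ler_pdivrMr // mul1r lerDl ltW.
have y0 : 0 < y by rewrite divr_gt0.
have ny : 0 < n * y by rewrite mulr_gt0.
have UY : Y / U = 4 * (n * y) by rewrite /U /blocksize /y -/n; field; rewrite !gt_eqF.
have K0 : 0 <= K by lra.
set l := Num.min _ _.
have l0 : 0 <= l / U.
  rewrite divr_ge0 ?(ltW U0) // le_min (ltW Y0) /= addr_ge0 //; first by rewrite mulr_ge0 // ltW.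
  by apply: divr_ge0; apply: mulr_ge0 => //; exact: ltW.
have lY : l <= Y by rewrite ge_min lexx.
have l2 : l <= 8 * U + K * P ^+ 5 / (X * Y) by rewrite ge_min lexx orbT.
have -> : 2 * (4 * Y / U) + 3 = 32 * (n * y) + 3 by rewrite -(mulrA 4) UY; ring.
have Kn : n <= K * n by rewrite ler_peMl // ltW.
have [small|big] := leP (n * y) 2.
  have lU : l / U <= 4 * (n * y) by rewrite -UY ler_wpM2r // invr_ge0 ltW.
  apply: le_trans (_ : (32 * 2 + 3) * (2 * (4 * 2) + 3) <= _); last by lra.
  by apply: ler_pM; lra.
have n2 : 2 < n by apply: lt_le_trans big _; rewrite ler_piMr // ltW.
pose rho := X ^+ 3 / P ^+ 5; have nE : n = 1 + rho by [].
have rho0 : 0 < rho by lra.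
pose w := K * P ^+ 5 / (X * Y) / U.
have lU : l / U <= 8 + w.
  have -> : 8 + w = (8 * U + K * P ^+ 5 / (X * Y)) / U by rewrite /w; field; rewrite !gt_eqF.
  by rewrite ler_wpM2r // invr_ge0 ltW.
have w0 : 0 <= w by rewrite /w divr_ge0 ?(ltW U0) // divr_ge0 // mulr_ge0 // ltW.
have nyw : n * y * w <= 8 * (K * n).
  have -> : n * y * w = 4 * (K * n) * (n * (P ^+ 5 / (X * (Y + X) ^+ 2))).
    by rewrite /w /U /blocksize -/n /y; field; rewrite !gt_eqF.
  have Xr : P ^+ 5 / (X * (Y + X) ^+ 2) <= rho^-1.
    rewrite /rho invf_div; apply: ler_wpM2l; first exact: ltW.
    rewrite lef_pV2 ?posrE ?mulr_gt0 ?exprn_gt0 // exprS ler_pM2l //.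
    by apply: lerXn2r; rewrite ?nnegrE ?(ltW YX) ?(ltW X0) // lerDr ltW.
  have nr : n / rho <= 2 by rewrite ler_pdivrMr //; lra.
  have : n * (P ^+ 5 / (X * (Y + X) ^+ 2)) <= 2.
    by apply: le_trans nr; apply: ler_wpM2l => //; exact: ltW.
  have -> : 8 * (K * n) = 4 * (K * n) * 2 by ring.
  by apply: ler_wpM2l; rewrite !mulr_ge0 ?(ltW n0) //; lra.
apply: le_trans (_ : (34 * (n * y)) * (19 + 2 * w) <= _).
  by apply: ler_pM; lra.
have nyn : n * y <= n by rewrite ler_piMr // ltW.
have -> : 34 * (n * y) * (19 + 2 * w) = 646 * (n * y) + 68 * (n * y * w) by ring.
by rewrite -mulrA; lra.
Qed.

Lemma lin_sub h p q k p' q' k' : lin h (p, q, k) -> lin h (p', q', k') ->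
  lin h (p - p', q - q', k - k').
Proof.
case: h => [[h1 h2] h4] /eqP E /eqP E'; apply/eqP.
by rewrite !mulrBr -E -E'; ring.
Qed.

(** When p is known up to U, subtracting the two quadratic inequalities bounds q^2 - q'^2, and q +
    q' is at least 2 Y in absolute value, which bounds the spread of q. In a cell for both, the
    difference from a base solution solves the homogeneous system with range U, by [quad_chord] or
    [quad_small]. *)
Lemma class_count P X K h Y sq N y : 1 <= P -> 0 < X -> 1 <= K -> 0 < Y ->
  hbox X h -> `|sq| = 1 -> 0 <= y ->
  atmost (fun u => hsol X (blocksize P X Y) (blocktol P X K) (h, u)) y ->
  atmost (fun n => esol X N (K * X * P ^+ 5) (h, n) && qclass Y sq n)
    (1300 * K * nblocks P X * (1 + y)).
Proof.
move=> P1 X0 K1 Y0 hb sq1 y0 Hy.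
have P0 : 0 < P := lt_le_trans ltr01 P1; have P5 : 0 < P ^+ 5 := exprn_gt0 5 P0.
set U := blocksize P X Y in Hy *; have U0 : 0 < U := blocksize_gt0 P0 X0 Y0.
have CI := cell_ineq P1 X0 K1 Y0.
have y1 : 0 <= 1 + y by rewrite addr_ge0.
apply: atmost_le (ler_wpM2r y1 CI) _; rewrite -[X in atmost _ X]mulrA -/U.
set l := Num.min Y _.
have K0 : 0 <= K by lra.
have l0 : 0 <= l.
  rewrite le_min (ltW Y0) /= addr_ge0 //; first by rewrite mulr_ge0 // ltW.
  by apply: divr_ge0; apply: mulr_ge0 => //; exact: ltW.
have normq (x : int) : `|(sq * x)%:~R| = `|x%:~R| :> R.
  by rewrite intrM normrM -intr_norm sq1 mul1r.
have cls p q k : qclass Y sq (p, q, k) ->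
    [/\ Y <= (sq * q)%:~R, (sq * q)%:~R < 2 * Y & `|p%:~R| <= 2 * Y :> R].
  move=> /andP[/= /andP[q1 q2] pq]; split=> //.
  apply: le_trans (_ : `|q%:~R| <= _); first by rewrite -!intr_norm ler_int.
  by rewrite -normq ger0_norm; lra.
apply: (@atmost_cells _ _ (fun n : vec => n.1.1%:~R) _ (4 * Y) U) => //.
- by rewrite mulr_ge0 // ltW.
- move=> [[p q] k] [[p' q'] k'] /andP[_ /cls[_ _ H]] /andP[_ /cls[_ _ H']] /=.
  by apply: le_trans (ler_normB _ _) _; lra.
move=> z; apply: (@atmost_cells _ _ (fun n : vec => n.1.2%:~R) _ l U) => //.
- move=> [[p q] k] [[p' q'] k'] /andP[/andP[/and5P[_ _ _ _ C] c1] /eqP /= z1].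
  move=> /andP[/andP[/and5P[_ _ _ _ C'] c1'] /eqP /= z1'].
  have [a1 a2 a3] := cls _ _ _ c1; have [a1' a2' a3'] := cls _ _ _ c1'.
  have pU : `|p%:~R - p'%:~R| < U :> R by apply: floor_cell; rewrite // z1 z1'.
  have qE : `|q%:~R - q'%:~R| = `|(sq * q)%:~R - (sq * q')%:~R| :> R.
    by rewrite !intrM -mulrBr normrM -intr_norm sq1 mul1r.
  rewrite le_min; apply/andP; split.
    by rewrite qE ler_norml; apply/andP; split; lra.
  have qq : `|q%:~R - q'%:~R| * (2 * Y) <= `|q%:~R ^+ 2 - q'%:~R ^+ 2| :> R.
    rewrite subr_sqr normrM; apply: ler_wpM2l => //.
    have -> : `|q%:~R + q'%:~R| = `|(sq * q)%:~R + (sq * q')%:~R| :> R.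
      by rewrite !intrM -mulrDr normrM -intr_norm sq1 mul1r.
    by rewrite ger0_norm; lra.
  have pp : `|p%:~R ^+ 2 - p'%:~R ^+ 2| <= U * (4 * Y) :> R.
    rewrite subr_sqr normrM; apply: ler_pM => //; first exact: ltW.
    by apply: le_trans (ler_normD _ _) _; lra.
  move: h hb C C' {Hy} => [[h1 h2] h4] /and4P[/andP[b1 b2] /andP[b3 b4] /andP[b5 b6]].
  rewrite intrB intrD => /andP[b7 b8] C C'.
  have ident : h2%:~R * (h1%:~R + h4%:~R - h2%:~R) * (q%:~R ^+ 2 - q'%:~R ^+ 2) =
     h1%:~R * h4%:~R * (p%:~R ^+ 2 - p'%:~R ^+ 2) -
     ((cquad (h1, h2, h4) (p, q, k))%:~R - (cquad (h1, h2, h4) (p', q', k'))%:~R) :> R.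
    by rewrite /= !(intrB, intrD, intrM); ring.
  have A : X ^+ 2 * (`|q%:~R - q'%:~R| * (2 * Y)) <=
      4 * X ^+ 2 * (U * (4 * Y)) + 2 * (K * X * P ^+ 5).
    apply: le_trans (_ : `|h2%:~R * (h1%:~R + h4%:~R - h2%:~R) * (q%:~R ^+ 2 - q'%:~R ^+ 2)| <= _).
      rewrite normrM; apply: ler_pM => //; [exact: sqr_ge0|by rewrite !mulr_ge0 // ltW|].
      rewrite normrM expr2; apply: ler_pM; rewrite ?(ltW X0) // ger0_norm //; clear -b3 b7 X0; lra.
    rewrite ident; apply: le_trans (ler_normB _ _) _; apply: lerD.
      rewrite normrM; apply: ler_pM => //.
      have -> : 4 * X ^+ 2 = (2 * X) * (2 * X) by ring.
      rewrite normrM; apply: ler_pM => //; rewrite ger0_norm; clear -b1 b2 b5 b6 X0; lra.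
    apply: le_trans (ler_normB _ _) _.
    by move: C C'; rewrite /=; clear; lra.
  have XY : 0 < 2 * X ^+ 2 * Y by rewrite !mulr_gt0 ?exprn_gt0.
  rewrite -(ler_pM2r XY).
  have -> : (8 * U + K * P ^+ 5 / (X * Y)) * (2 * X ^+ 2 * Y) =
     4 * X ^+ 2 * (U * (4 * Y)) + 2 * (K * X * P ^+ 5) by field; rewrite !gt_eqF.
  by apply: le_trans A; rewrite le_eqVlt; apply/orP; left; apply/eqP; ring.
move=> z'; apply: atmost_diff => // -[[p0 q0] k0].
move=> /andP[/andP[/andP[/and5P[_ _ _ ln0 C0] c0] /eqP /= z0] /eqP /= z0'].
apply: (@atmost_inj _ _ _ (fun n : vec => (n.1.1 - p0, n.1.2 - q0, n.2 - k0)) _ _ _ _ _ Hy); last first.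
  move=> [[p q] k] [[p' q'] k'] _ _ /= [].
  by move=> /(addIr _) -> /(addIr _) -> /(addIr _) ->.
move=> [[p q] k] /andP[/andP[/andP[/andP[/and5P[_ _ _ ln C] c] /eqP /= z1] /eqP /= z1'] nn].
have pU : `|p%:~R - p0%:~R| <= U :> R by apply/ltW/floor_cell; rewrite // z1 z0.
have qU : `|q%:~R - q0%:~R| <= U :> R by apply/ltW/floor_cell; rewrite // z1' z0'.
apply/and4P; split => //.
- rewrite /= !intr_norm !intrB pU qU /= !subr_eq0; apply/negPn/negP.
  rewrite negb_or !negbK => /andP[/eqP pp /eqP qq].
  move/negP: nn; apply; move: ln; rewrite pp qq => /(lin_inj_k X0 hb ln0) ->.
  by rewrite eqxx.
- exact: lin_sub.
- have [XY|YX] := leP X Y.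
    exact: (quad_chord P1 X0 K1 Y0 XY hb sq1 C C0 c c0 pU qU).
  by apply: (quad_small P1 X0 K1 Y0 (ltW YX) hb); rewrite intrB.
Qed.
End ClassCount.

Section EsolBound.
Variable R : archiRealFieldType.
Notation vec := (int * int * int)%type.
Implicit Types (P X K Y U N D : R).

(** Both parts use X <= P^2: X^3 <= X P^4 and X^6 / P^5 <= X P^5. *)
Lemma blocks_X3 P X : 1 <= P -> 0 < X -> X <= P ^+ 2 ->
  nblocks P X * X ^+ 3 <= 2 * (X * P ^+ 5).
Proof.
move=> P1 X0 XP; have P0 : 0 < P := lt_le_trans ltr01 P1.
have P5 : 0 < P ^+ 5 := exprn_gt0 5 P0.
have XX : X ^+ 2 <= P ^+ 4.
  have -> : P ^+ 4 = (P ^+ 2) ^+ 2 by rewrite -exprM.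
  by apply: lerXn2r; rewrite ?nnegrE ?(ltW X0) ?exprn_ge0 ?(ltW P0).
have P45 : P ^+ 4 <= P ^+ 5 by apply: ler_weXn2l.
have X3 : X ^+ 3 <= X * P ^+ 5.
  by rewrite exprS ler_pM2l //; apply: le_trans XX P45.
have X6 : X ^+ 3 / P ^+ 5 * X ^+ 3 <= X * P ^+ 5.
  rewrite mulrAC ler_pdivrMr // (_ : X ^+ 3 * X ^+ 3 = X * (X ^+ 2) * (X ^+ 2) * X); last by ring.
  have -> : X * P ^+ 5 * P ^+ 5 = X * P ^+ 4 * P ^+ 4 * P ^+ 2 by ring.
  apply: ler_pM; rewrite ?mulr_ge0 ?sqr_ge0 ?(ltW X0) //.
  apply: ler_pM; rewrite ?mulr_ge0 ?sqr_ge0 ?(ltW X0) //.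
  by apply: ler_pM; rewrite ?sqr_ge0 ?(ltW X0).
by rewrite /nblocks mulrDl mul1r; lra.
Qed.

(** Summed over the blocks, X^2 U becomes X^2 (Y + X) / 4 and the tolerance becomes 76 K X P^5, so
    the division into blocks is free for the homogeneous count. The base points contribute
    [nblocks P X] times X^3, handled by [blocks_X3]. *)
Lemma esol_class P X K Y sq (L : nat) : 1 <= P -> 0 < X -> X <= P ^+ 2 -> 1 <= K ->
  8 * P ^+ 3 < 2 ^+ L -> 0 < Y -> Y <= 4 * P ^+ 3 -> `|sq| = 1 ->
  atmost (fun t => esol X (4 * P ^+ 3) (K * X * P ^+ 5) t && qclass Y sq t.2)
    (1300 * 512 * 1000 * 79 * K ^+ 2 * L.+1%:R ^+ 5 * (X * P ^+ 5)).
Proof.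
move=> P1 X0 XP K1 PL Y0 YP sq1.
have P0 : 0 < P := lt_le_trans ltr01 P1; have P5 : 0 < P ^+ 5 := exprn_gt0 5 P0.
have n0 := nblocks_gt0 P0 X0; have n1 := nblocks_ge1 P0 X0.
have K0 : 0 <= K by lra.
have P23 : P ^+ 2 <= P ^+ 3 by rewrite [leRHS]exprS ler_peMl ?sqr_ge0.
set U := blocksize P X Y; have U0 : 0 < U := blocksize_gt0 P0 X0 Y0.
set D := blocktol P X K.
have XP5 : 0 <= X * P ^+ 5 by rewrite mulr_ge0 // ltW.
have D0 : 0 <= D by rewrite divr_ge0 ?(ltW n0) // !mulr_ge0 // ltW.
have nU : nblocks P X * U = (Y + X) / 4 by rewrite /U /blocksize; field; rewrite gt_eqF.
have UU : U <= (Y + X) / 4 by rewrite -nU ler_peMl // ltW.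
have UL : 6 * U < 2 ^+ L by lra.
have XL : 4 * X < 2 ^+ L by lra.
set W := `|Num.floor (2 * U)|%N.
have WE : W%:Z = Num.floor (2 * U) by rewrite /W gez0_abs // floor_ge0 mulr_ge0 // ltW.
set z := zint (- W%:Z) (2 * W + 1).
have zE c : `|c|%:~R <= 2 * U -> c \in z.
  rewrite -floor_ge_int -WE mem_zint; clear; lia.
set r := [seq (ab, c) | ab <- [seq (a, b) | a <- z, b <- z], c <- z].
have ur : uniq r.
  apply: allpairs_uniq; rewrite ?uniq_zint //; last by move=> [? ?] [? ?] _ _ [-> ->].
  by apply: allpairs_uniq; rewrite ?uniq_zint //; move=> [? ?] [? ?] _ _ [-> ->].
set l5 := L.+1%:R ^+ 5 : R.
have l51 : 1 <= l5 by rewrite exprn_ege1 // ler1n.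
have H := hsol_bound X0 (ltW U0) D0 UL XL.
have c0 : 0 <= 1300 * K * nblocks P X by rewrite !mulr_ge0 // ltW.
apply: atmost_le (@atmost_transfer _ _ _ _ (hsol X U D) _ (hbox X) r _ _ _ c0 ur _ _ H
  (hbox_count X0) _).
- have X3 := blocks_X3 P1 X0 XP.
  have X2U : nblocks P X * (X ^+ 2 * U) <= 2 * (X * P ^+ 5).
    have -> : nblocks P X * (X ^+ 2 * U) = X * (X * (nblocks P X * U)) by ring.
    have -> : 2 * (X * P ^+ 5) = X * (P ^+ 2 * (2 * P ^+ 3)) by ring.
    rewrite nU ler_pM2l //; apply: ler_pM; rewrite ?(ltW X0) //; first by lra.
    lra.
  have nD : nblocks P X * D = 76 * K * (X * P ^+ 5) by rewrite /D /blocktol; field; rewrite gt_eqF.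
  have -> : 1300 * K * nblocks P X * (1000 * X ^+ 3 + 512 * 1000 * l5 * (X ^+ 2 * U + D)) =
    1300 * K * (1000 * (nblocks P X * X ^+ 3) +
      512 * 1000 * (l5 * (nblocks P X * (X ^+ 2 * U) + nblocks P X * D))) by ring.
  rewrite nD.
  have -> : 1300 * 512 * 1000 * 79 * K ^+ 2 * l5 * (X * P ^+ 5) =
     1300 * K * (512 * 1000 * (l5 * (79 * (K * (X * P ^+ 5))))) by ring.
  apply: ler_wpM2l; first by rewrite mulr_ge0.
  have KX : X * P ^+ 5 <= K * (X * P ^+ 5) by rewrite ler_peMl.
  have lK : K * (X * P ^+ 5) <= l5 * (K * (X * P ^+ 5)) by rewrite ler_peMl // mulr_ge0.
  have S : l5 * (nblocks P X * (X ^+ 2 * U) + 76 * K * (X * P ^+ 5)) <=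
     l5 * (78 * (K * (X * P ^+ 5))) by apply: ler_wpM2l; lra.
  have -> : l5 * (79 * (K * (X * P ^+ 5))) = l5 * (78 * (K * (X * P ^+ 5))) + l5 * (K * (X * P ^+ 5)) by ring.
  lra.
- move=> [[h1 h2] h4] [[a b] c] /and4P[hb nb ln _]; have kU := nbox_k X0 hb nb ln.
  case/and3P: nb => aU bU _.
  apply: allpairs_f; last exact: zE.
  by apply: allpairs_f; apply: zE; lra.
- by move=> h n /andP[/and5P[-> _ _ _ _] _].
move=> h y hb Hy; exact: class_count P1 X0 K1 Y0 hb sq1 (atmost_ge0 Hy) Hy.
Qed.

Lemma esol_half P X K (L : nat) : 1 <= P -> 0 < X -> X <= P ^+ 2 -> 1 <= K ->
  8 * P ^+ 3 < 2 ^+ L ->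
  atmost (fun t => esol X (4 * P ^+ 3) (K * X * P ^+ 5) t && (`|t.2.1.1| <= `|t.2.1.2|))
    (2 * 1300 * 512 * 1000 * 80 * K ^+ 2 * L.+1%:R ^+ 6 * (X * P ^+ 5)).
Proof.
move=> P1 X0 XP K1 PL.
have P0 : 0 < P := lt_le_trans ltr01 P1; have P5 : 0 < P ^+ 5 := exprn_gt0 5 P0.
have XP5 : 0 <= X * P ^+ 5 by rewrite mulr_ge0 // ltW.
set E := fun t : vec * vec => esol X (4 * P ^+ 3) (K * X * P ^+ 5) t && (`|t.2.1.1| <= `|t.2.1.2|).
set C := 1300 * 512 * 1000 * 79 * K ^+ 2 * L.+1%:R ^+ 5 * (X * P ^+ 5).
have C0 : 0 <= C by rewrite /C !mulr_ge0 // ?exprn_ge0 //; lra.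
have cnt : 2 * L%:R = (size [seq (b, i) | b <- enum {: bool}, i <- iota 0 L])%:R :> R.
  by rewrite size_allpairs -cardE card_bool size_iota natrM.
apply: (@atmost_le _ _ _ (2000 * (X * P ^+ 5) + 2 * L%:R * C)).
  have LL : L%:R <= L.+1%:R :> R by rewrite ler_nat.
  have L1 : 1 <= L.+1%:R :> R by rewrite ler1n.
  set M := K ^+ 2 * L.+1%:R ^+ 6 * (X * P ^+ 5).
  have M1 : X * P ^+ 5 <= M by rewrite /M ler_peMl // mulr_ege1 // exprn_ege1.
  have LC : L%:R * C <= 1300 * 512 * 1000 * 79 * M.
    have -> : 1300 * 512 * 1000 * 79 * M = L.+1%:R * C by rewrite /M /C; ring.
    exact: ler_wpM2r.
  have -> : 2 * 1300 * 512 * 1000 * 80 * K ^+ 2 * L.+1%:R ^+ 6 * (X * P ^+ 5) =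
    2 * 1300 * 512 * 1000 * 80 * M by rewrite /M; ring.
  lra.
apply: (@atmost_or _ _ _ (fun t => E t && (t.2.1.2 == 0)) (fun t => E t && (t.2.1.2 != 0))).
- by move=> t /= ->; apply: orbN.
(* For q = 0 also p = 0, and k is determined by the linear relation, so only the shifts are
   counted. *)
- have X3 : 1000 * X ^+ 3 <= 2000 * (X * P ^+ 5).
    have := blocks_X3 P1 X0 XP; have := nblocks_ge1 P0 X0.
    have : 0 <= X ^+ 3 by rewrite exprn_ge0 // ltW.
    move=> x3 n1; have : X ^+ 3 <= nblocks P X * X ^+ 3 by rewrite ler_peMl.
    lra.
  apply: atmost_le X3 _.
  apply: (@atmost_inj _ _ _ fst _ _ _ _ _ (hbox_count X0)).
    by move=> t /andP[/andP[/and5P[-> _ _ _ _] _] _].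
  have pz p q k h : E (h, (p, q, k)) && (q == 0) -> [/\ hbox X h, lin h (p, q, k), p = 0 & q = 0].
    move=> /andP[/andP[/and5P[hb _ _ ln _] /= pq] /eqP q0]; split=> //.
    by move: pq; rewrite q0 normr0 normr_le0 => /eqP.
  move=> [h [[p q] k]] [h' [[p' q'] k']] /pz[hb ln p0 q0] /pz[_ ln' p0' q0'] /= hh.
  rewrite -hh p0' q0' in ln' *; rewrite p0 q0 in ln *.
  by rewrite (lin_inj_k X0 hb ln ln').
rewrite cnt.
apply: (@atmost_fibc _ _ _ (fun t : vec * vec => (0 < t.2.1.2, trunc_log 2 `|t.2.1.2|%N))).
  move=> [h [[p q] k]] /andP[/andP[/and5P[_ _ qN _ _] _] /= q0].
  apply/allpairsP; exists (0 < q, trunc_log 2 `|q|%N); split=> //=; first by rewrite mem_enum.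
  rewrite mem_iota /= add0n -(@ltn_exp2l 2) // -(ltr_nat R) !natrX.
  have /andP[H1 _] := trunc_log_bounds R q0.
  have P3 : 0 < P ^+ 3 := exprn_gt0 3 P0.
  by apply: le_lt_trans PL; apply: le_trans H1 _; apply: le_trans qN _; lra.
move=> [b i] _; pose sq : int := if b then 1 else -1.
have sq1 : `|sq| = 1 by rewrite /sq; case: (b); rewrite ?normrN normr1.
have inc t : E t && (t.2.1.2 != 0) && ((0 < t.2.1.2, trunc_log 2 `|t.2.1.2|%N) == (b, i)) ->
    [/\ esol X (4 * P ^+ 3) (K * X * P ^+ 5) t, qclass (2 ^+ i : R) sq t.2 & 2 ^+ i <= 4 * P ^+ 3 :> R].
  case: t => [h [[p q] k]] /andP[/andP[/andP[es pq] /= q0] /eqP[bE iE]].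
  have qq : sq * q = `|q|.
    rewrite /sq -bE; case: (ltP 0 q) => H; first by rewrite mul1r gtr0_norm.
    by rewrite mulN1r ler0_norm.
  have H := trunc_log_bounds R q0; rewrite iE in H.
  split=> //; first by rewrite /qclass /= qq H pq.
  by case/and5P: es => _ _ qN _ _; case/andP: H => H _; apply: le_trans H qN.
have [iP|iP] := leP (2 ^+ i) (4 * P ^+ 3).
  have Y0 : 0 < 2 ^+ i :> R by rewrite exprn_gt0.
  apply: atmost_sub (lexx _) (esol_class P1 X0 XP K1 PL Y0 iP sq1).
  by move=> t /inc[-> ->].
by apply: atmost_sup => // t /inc[_ _]; rewrite leNgt iP.
Qed.

Lemma cquad_swap h n : cquad (hswap h) (nswap n) = - cquad h n.
Proof.
case: h n => [[h1 h2] h4] [[p q] k] /=.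
have -> : h2 + (h1 + h4 - h2) = h1 + h4 by ring.
have -> : h1 + h4 - h1 = h4 by ring.
by ring.
Qed.

Lemma hswapK h : hswap (hswap h) = h.
Proof. by case: h => [[h1 h2] h4] /=; congr (_, _, _); ring. Qed.

Lemma esol_bound P X K (L : nat) : 1 <= P -> 0 < X -> X <= P ^+ 2 -> 1 <= K ->
  8 * P ^+ 3 < 2 ^+ L ->
  atmost (esol X (4 * P ^+ 3) (K * X * P ^+ 5))
    (4 * 1300 * 512 * 1000 * 80 * K ^+ 2 * L.+1%:R ^+ 6 * (X * P ^+ 5)).
Proof.
move=> P1 X0 XP K1 PL; have H := esol_half P1 X0 XP K1 PL.
set C := 2 * 1300 * 512 * 1000 * 80 * K ^+ 2 * L.+1%:R ^+ 6 * (X * P ^+ 5) in H.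
have -> : 4 * 1300 * 512 * 1000 * 80 * K ^+ 2 * L.+1%:R ^+ 6 * (X * P ^+ 5) = C + C by rewrite /C; ring.
apply: (@atmost_or _ _ _ _ (fun t => esol X (4 * P ^+ 3) (K * X * P ^+ 5) t &&
  (`|t.2.1.2| <= `|t.2.1.1|)) _ _ _ H).
  by move=> t /= ->; apply: le_total.
apply: (@atmost_inj _ _ _ (fun t => (hswap t.1, nswap t.2)) _ _ _ _ _ H).
  move=> [h n] /andP[/and5P[hb pN qN ln cq] pq].
  apply/andP; split; last by case: (n) pq => [[]].
  apply/and5P; split=> /=; rewrite ?hswap_box ?lin_swap ?cquad_swap ?intrN ?normrN //.
    by case: (n) qN => [[]].
  by case: (n) pN => [[]].
move=> [h n] [h' n'] _ _ /= [] /(can_inj hswapK) -> /nswap_inj -> //.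
Qed.
End EsolBound.

(** * Quadruples of frequencies *)

Section Quadruples.
Variable R : archiRealFieldType.
(* A point is a pair [(h, nu)]. *)
Notation point := (int * int)%type.
Implicit Types (P X : R).

Definition moment (t : point) : int := t.1 * t.2.
Definition cubic (t : point) : int := 3 * t.1 * t.2 ^+ 2 + t.1 ^+ 3.

Definition pbox X P (t : point) : bool :=
  (X <= t.1%:~R < 2 * X) && (0 <= (t.2%:~R : R) <= 4 * P ^+ 3).

Definition quadruple X P (t : (point * point) * (point * point)) : bool :=
  let: ((t1, t2), (t3, t4)) := t in
  [&& [&& pbox X P t1, pbox X P t2, pbox X P t3 & pbox X P t4],
    t1.1 - t2.1 == t3.1 - t4.1, moment t1 - moment t2 == moment t3 - moment t4
    & `|(cubic t1 - cubic t2 - (cubic t3 - cubic t4))%:~R| <= P ^+ 5].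

(** The system for (p, q, k) involves only differences of the nu. Fixing nu3, with at most 2 (4 P^3)
    + 3 <= 11 P^3 values, makes the passage to these differences injective. *)
Lemma quadruple_bound P X (L : nat) : 1 <= P -> 0 < X -> X <= P ^+ 2 -> 8 * P ^+ 3 < 2 ^+ L ->
  atmost (quadruple X P)
    (11 * 16 * 1300 * 512 * 1000 * 80 * L.+1%:R ^+ 6 * (X * P ^+ 8)).
Proof.
move=> P1 X0 XP PL; have P0 : 0 < P := lt_le_trans ltr01 P1.
have P3 : 0 < P ^+ 3 := exprn_gt0 3 P0; have P31 : 1 <= P ^+ 3 := exprn_ege1 3 P1.
have P5 : 0 < P ^+ 5 := exprn_gt0 5 P0.
have K2 : 1 <= 2 :> R by lra.
have := esol_bound P1 X0 XP K2 PL.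
set E := 4 * 1300 * 512 * 1000 * 80 * 2 ^+ 2 * L.+1%:R ^+ 6 * (X * P ^+ 5) => H.
have E0 := atmost_ge0 H.
have -> : 11 * 16 * 1300 * 512 * 1000 * 80 * L.+1%:R ^+ 6 * (X * P ^+ 8) = 11 * P ^+ 3 * E.
  by rewrite /E; ring.
have lo : 0 <= 4 * P ^+ 3 :> R by rewrite mulr_ge0 // ltW.
apply: atmost_le (atmost_fibA E0 (g := fun t => t.2.1.2) _ (atmost_interval lo) _).
- by apply: ler_wpM2r => //; lra.
- by move=> [[t1 t2] [t3 t4]] /and4P[/and4P[_ _ /andP[_ H3] _] _ _ _].
move=> z _.
pose g (t : (point * point) * (point * point)) := let: ((t1, t2), (t3, t4)) := t in
  ((t1.1, t2.1, t4.1), (t1.2 - t4.2, t2.2 - t3.2, t4.2 - t3.2)).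
apply: (@atmost_inj _ _ _ g _ _ _ _ _ H); last first.
  move=> [[[h1 v1] [h2 v2]] [[h3 v3] [h4 v4]]] [[[h1' v1'] [h2' v2']] [[h3' v3'] [h4' v4']]].
  move=> /andP[/and4P[_ /eqP /= h3E _ _] /eqP /= v3E] /andP[/and4P[_ /eqP /= h3E' _ _] /eqP /= v3E'].
  rewrite v3E v3E' => -[E1 E2 E4 e1 e2 e3].
  have f4 : v4 = v4' := addIr _ e3; have f2 : v2 = v2' := addIr _ e2.
  have f1 : v1 = v1' by move: e1; rewrite f4 => /addIr.
  have f3 : h3 = h3'.
    have -> : h3 = h1 - h2 + h4 by rewrite h3E; ring.
    have -> : h3' = h1' - h2' + h4' by rewrite h3E'; ring.
    by rewrite E1 E2 E4.
  by rewrite E1 E2 E4 f1 f2 f3 f4.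
move=> [[[h1 v1] [h2 v2]] [[h3 v3] [h4 v4]]] /andP[/and4P[/and4P[]] ].
move=> /andP[/= /andP[a1 a1'] /andP[n1 n1']] /andP[/= /andP[a2 a2'] /andP[n2 n2']].
move=> /andP[/= /andP[a3 a3'] /andP[n3 n3']] /andP[/= /andP[a4 a4'] /andP[n4 n4']] /eqP /= hE /eqP /= mE /= cE _.
rewrite /moment /= in mE.
have h3E : h3 = h1 + h4 - h2.
  have -> : h3 = h1 - h2 + h4 by rewrite hE; ring.
  by ring.
have dif (v w : int) : 0 <= v%:~R :> R -> v%:~R <= 4 * P ^+ 3 -> 0 <= w%:~R :> R -> w%:~R <= 4 * P ^+ 3 ->
   `|v - w|%:~R <= 4 * P ^+ 3.
  clear; move=> *; rewrite intr_norm intrB ler_norml; apply/andP; split; lra.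
have ln : h1 * (v1 - v4) + (h1 + h4) * (v4 - v3) = h2 * (v2 - v3).
  have -> : h2 * (v2 - v3) = h2 * v2 + h3 * v3 - (h2 + h3) * v3 by ring.
  have -> : h2 * v2 + h3 * v3 = h1 * v1 + h4 * v4.
    have -> : h1 * v1 + h4 * v4 = (h1 * v1 - h2 * v2) + h2 * v2 + h4 * v4 by ring.
    by rewrite mE; ring.
  by rewrite h3E; ring.
have cqle : `|(cquad (h1, h2, h4) (v1 - v4, v2 - v3, v4 - v3))%:~R| <= 2 * X * P ^+ 5.
  (* Multiplied by s = h1 + h4 the cubic difference is three times the form, up to a multiple of the
     moment relation. Since s < 4 X the form is at most (4/3) X P^5, and K = 2 suffices. *)
  have cq : (h1 + h4) * (cubic (h1, v1) - cubic (h2, v2) - (cubic (h3, v3) - cubic (h4, v4))) =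
     3 * cquad (h1, h2, h4) (v1 - v4, v2 - v3, v4 - v3).
    transitivity (3 * cquad (h1, h2, h4) (v1 - v4, v2 - v3, v4 - v3) +
       3 * (h1 * v1 - h2 * v2 - (h3 * v3 - h4 * v4)) * (h1 * v1 + h4 * v4 + h2 * v2 + h3 * v3)).
      by rewrite /cubic /= h3E; ring.
    by rewrite mE subrr mulr0 mul0r addr0.
  move/(congr1 (fun c : int => c%:~R : R)): cq; rewrite !intrM => /(congr1 Num.norm).
  rewrite !normrM intrD [X in X * _]ger0_norm; last by lra.
  rewrite [X in _ = X * _]ger0_norm // => cq.
  have c3 : 0 < 3%:~R :> R by rewrite ltr0z.
  rewrite -(ler_pM2l c3) -cq.
  have -> : 3%:~R * (2 * X * P ^+ 5) = (4 * X) * P ^+ 5 + 2 * X * P ^+ 5 by ring.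
  apply: le_trans (_ : 4 * X * P ^+ 5 <= _); last by rewrite lerDl !mulr_ge0 // ltW.
  by apply: ler_pM => //; lra.
apply/and5P; split; last exact: cqle; [rewrite /=|exact: dif|exact: dif|exact/eqP].
  by rewrite -h3E a1 a1' a2 a2' a4 a4' a3 a3'.
Qed.
End Quadruples.

(** * Additive characters and the double large sieve *)

Section Modulus.
Variable R : rcfType.
Implicit Types (z w : R[i]).

(** The norm of [R[i]] takes its values in [R[i]]; its real part gives a modulus in the ordered
    field. *)
Definition modc z : R := complex.Re `|z|.

Lemma modcE z : ((modc z)%:C)%C = `|z|.
Proof. by rewrite /modc RRe_real ?normr_real. Qed.

Lemma modc_ge0 z : 0 <= modc z.
Proof. by rewrite -ler0c modcE. Qed.

Lemma modc0 : modc 0 = 0.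
Proof. by apply: complexI; rewrite modcE normr0. Qed.

Lemma modcM z w : modc (z * w) = modc z * modc w.
Proof. by apply: complexI; rewrite rmorphM !modcE normrM. Qed.

Lemma modcV z : modc z^-1 = (modc z)^-1.
Proof. by apply: complexI; rewrite fmorphV !modcE normfV. Qed.

Lemma modcD z w : modc (z + w) <= modc z + modc w.
Proof. by rewrite -lecR rmorphD /= !modcE ler_normD. Qed.

Lemma modcN z : modc (- z) = modc z.
Proof. by rewrite /modc normrN. Qed.

Lemma modcB z w : modc (z - w) = modc (w - z).
Proof. by rewrite -modcN opprB. Qed.

Lemma modc_conj z : modc (z^*)%C = modc z.
Proof. by rewrite /modc normcJ. Qed.

Lemma modc_real (x : R) : 0 <= x -> modc (x%:C)%C = x.
Proof. by move=> x0; rewrite /modc ger0_norm // ler0c. Qed.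

Lemma modc_nat n : modc n%:R = n%:R.
Proof. by rewrite -[in RHS](@modc_real n%:R) // rmorph_nat. Qed.

Lemma modc_eq1 z : `|z| = 1 -> modc z = 1.
Proof. by rewrite /modc => ->. Qed.

Lemma modc_sqr z : ((modc z ^+ 2)%:C)%C = z * (z^*)%C.
Proof. by rewrite rmorphXn /= modcE sqr_normc. Qed.

Lemma modc_sum (I : Type) (r : seq I) (P : pred I) (F : I -> R[i]) :
  modc (\sum_(i <- r | P i) F i) <= \sum_(i <- r | P i) modc (F i).
Proof.
apply: (big_ind2 (fun z x => modc z <= x)) => [|z x w y zx wy|//]; first by rewrite modc0.
by apply: le_trans (modcD _ _) _; apply: lerD.
Qed.

Lemma CauchySchwarz_real (I : finType) (P : pred I) (x y : I -> R) :
  (\sum_(i | P i) x i * y i) ^+ 2 <= (\sum_(i | P i) x i ^+ 2) * (\sum_(i | P i) y i ^+ 2).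
Proof.
have H : 0 <= \sum_(i | P i) \sum_(j | P j) (x i * y j - x j * y i) ^+ 2.
  by apply: sumr_ge0 => i _; apply: sumr_ge0 => j _; apply: sqr_ge0.
set A := \sum_(i | P i) x i ^+ 2; set B := \sum_(i | P i) y i ^+ 2.
set S := \sum_(i | P i) x i * y i.
suff E : \sum_(i | P i) \sum_(j | P j) (x i * y j - x j * y i) ^+ 2 = 2 * (A * B - S ^+ 2).
  by move: H; rewrite E pmulr_rge0 // subr_ge0.
transitivity (\sum_(i | P i) (x i ^+ 2 * B + y i ^+ 2 * A - 2 * (x i * y i) * S)).
  apply: eq_bigr => i _; rewrite /A /B /S !mulr_sumr -big_split /= -sumrB.
  by apply: eq_bigr => j _; ring.
rewrite sumrB big_split /= -!mulr_suml -/A -/B -mulr_sumr -/S; ring.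
Qed.

Lemma CauchySchwarz (I : finType) (P : pred I) (a b : I -> R[i]) :
  modc (\sum_(i | P i) a i * b i) ^+ 2 <=
  (\sum_(i | P i) modc (a i) ^+ 2) * (\sum_(i | P i) modc (b i) ^+ 2).
Proof.
apply: le_trans (CauchySchwarz_real P (modc \o a) (modc \o b)).
apply: lerXn2r; rewrite ?nnegrE ?modc_ge0 //.
  by apply: sumr_ge0 => i _; rewrite mulr_ge0 ?modc_ge0.
by apply: le_trans (modc_sum _ _ _) _; apply: ler_sum => i _; rewrite modcM.
Qed.

Lemma sqr_sum_le (I : finType) (P : pred I) (x : I -> R) :
  (\sum_(i | P i) x i) ^+ 2 <= #|P|%:R * \sum_(i | P i) x i ^+ 2.
Proof.
have E1 : \sum_(i | P i) 1 * x i = \sum_(i | P i) x i by apply: eq_bigr => i _; rewrite mul1r.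
have E2 : \sum_(i | P i) (1 : R) ^+ 2 = #|P|%:R.
  by rewrite -sumr_const; apply: eq_bigr => i _; rewrite expr1n.
by have := CauchySchwarz_real P (fun=> 1) x; rewrite E1 E2.
Qed.
End Modulus.

(** The properties of e(x) that the argument uses, isolated so that it can run over an abstract
    field. The constant 7 replaces 2 pi, and [char_neq1] is what makes geometric sums modulo Q
    vanish. *)
Record unit_character (R : archiRcfType) (e : R -> R[i]) : Prop := UnitCharacter {
  charD : forall x y, e (x + y) = e x * e y;
  char_norm : forall x, `|e x| = 1;
  char_lip : forall x, modc (e x - 1) <= 7 * `|x|;
  char1 : e 1 = 1;
  char_neq1 : forall x, 0 < x < 1 -> e x != 1
}.

Section Character.
Variables (R : archiRcfType) (e : R -> R[i]).
Implicit Types (x y : R).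

Lemma charX : unit_character e -> forall x n, e x ^+ n = e (n%:R * x).
Proof.
move=> he x; elim=> [|n IH].
  rewrite expr0 mul0r.
  have /mulfI : e 1 != 0 by rewrite (char1 he) oner_eq0.
  by apply; rewrite -(charD he) addr0 mulr1.
by rewrite exprS IH -natr1 mulrDl mul1r addrC (charD he).
Qed.

Lemma char0 : unit_character e -> e 0 = 1.
Proof. by move=> he; have := charX he 0 0; rewrite expr0 mul0r. Qed.

Lemma charN : unit_character e -> forall x, e (- x) = ((e x)^*)%C.
Proof.
move=> he x; have n0 : e x != 0 by rewrite -normr_eq0 (char_norm he) oner_eq0.
apply: (mulfI n0); rewrite -(charD he) subrr char0 //.
by rewrite -sqr_normc (char_norm he) expr1n.
Qed.

Lemma char_nat : unit_character e -> forall n, e n%:R = 1.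
Proof. by move=> he n; rewrite -[n%:R]mulr1 -charX // (char1 he) expr1n. Qed.

Lemma char_int : unit_character e -> forall n : int, e n%:~R = 1.
Proof.
move=> he [n|n]; first exact: char_nat.
by rewrite NegzE intrN charN // char_nat // conjc1.
Qed.

Lemma modc_char : unit_character e -> forall x, modc (e x) = 1.
Proof. by move=> he x; apply/modc_eq1/char_norm. Qed.

Lemma char_dist : unit_character e -> forall x y, modc (e x - e y) <= 7 * `|x - y|.
Proof.
move=> he x y; have -> : e x - e y = e y * (e (x - y) - 1).
  by rewrite mulrBr mulr1 -(charD he) (_ : y + (x - y) = x) //; ring.
by rewrite modcM modc_char // mul1r; apply: char_lip.
Qed.

Lemma char_eq1 : unit_character e -> forall (m : int) (Q : nat), (0 < Q)%N ->
  (e (m%:~R / Q%:R) == 1) = (Q%:Z %| m)%Z.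
Proof.
move=> he m Q Q0; have QR : 0 < Q%:R :> R by rewrite ltr0n.
have Qz : Q%:Z != 0 by rewrite eqz_nat -lt0n.
have E : m%:~R / Q%:R = (m %/ Q%:Z)%Z%:~R + (m %% Q%:Z)%Z%:~R / Q%:R :> R.
  rewrite {1}(divz_eq m Q%:Z) intrD intrM -pmulrn; field.
  by rewrite gt_eqF.
rewrite E (charD he) char_int // mul1r.
apply/eqP/dvdz_mod0P => [E1|->]; last by rewrite mul0r char0.
have ge := modz_ge0 m Qz; have lt := ltz_pmod m (Q0 : 0 < Q%:Z).
apply/eqP; apply: contraT => n0.
have : e ((m %% Q%:Z)%Z%:~R / Q%:R) != 1; last by rewrite E1 eqxx.
apply: (char_neq1 he); apply/andP; split.
  by rewrite divr_gt0 // ltr0z lt0r n0.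
by rewrite ltr_pdivrMr // mul1r pmulrn ltr_int.
Qed.

Lemma char_geometric : unit_character e -> forall (m : int) (Q n : nat), (0 < Q)%N ->
  \sum_(t < n * Q) e (t%:R * m%:~R / Q%:R) = if (Q%:Z %| m)%Z then (n * Q)%:R else 0.
Proof.
move=> he m Q n Q0; have QR : 0 < Q%:R :> R by rewrite ltr0n.
have -> : \sum_(t < n * Q) e (t%:R * m%:~R / Q%:R) = \sum_(t < n * Q) e (m%:~R / Q%:R) ^+ t.
  by apply: eq_bigr => t _; rewrite charX // mulrA.
have := char_eq1 he m Q0; case: ifP => _ E.
  by rewrite (eqP E); under eq_bigr => t _ do rewrite expr1n; rewrite sumr_const card_ord.
have z1 : e (m%:~R / Q%:R) - 1 != 0 by rewrite subr_eq0 E.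
apply: (mulfI z1); rewrite mulr0 -subrX1 charX // natrM.
have -> : n%:R * Q%:R * (m%:~R / Q%:R) = (n%:Z * m)%:~R :> R.
  by rewrite intrM -pmulrn; field; rewrite gt_eqF.
by rewrite char_int // subrr.
Qed.

(** Every term is within 7 W |y| / Q <= 1/2 of 1. *)
Lemma char_smooth : unit_character e -> forall (y : int) (Q W : nat), (0 < Q)%N ->
  (14 * W%:Z * `|y| <= Q%:Z)%R -> W%:R / 2 <= modc (\sum_(r < W) e (r%:R * y%:~R / Q%:R)).
Proof.
move=> he y Q W Q0 WQ; have QR : 0 < Q%:R :> R by rewrite ltr0n.
set G := \sum_(r < W) _.
have : modc (G - W%:R) <= W%:R / 2.
  have -> : G - W%:R = \sum_(r < W) (e (r%:R * y%:~R / Q%:R) - 1).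
    by rewrite sumrB sumr_const card_ord.
  apply: le_trans (modc_sum _ _ _) _.
  apply: le_trans (_ : \sum_(r < W) (1 / 2 : R) <= _); last first.
    by rewrite sumr_const card_ord -[leLHS]mulr_natr mul1r mulrC.
  apply: ler_sum => r _; apply: le_trans (char_lip he _) _.
  rewrite !normrM normfV !normr_nat mulrA ler_pdivrMr //.
  have : 14 * W%:R * `|y%:~R| <= Q%:R :> R.
    by rewrite -(ler_int R) !intrM intr_norm -!pmulrn in WQ.
  have : r%:R * `|y%:~R| <= W%:R * `|y%:~R| :> R by apply: ler_wpM2r => //; rewrite ler_nat ltnW.
  lra.
have : W%:R <= modc G + modc (G - W%:R).
  rewrite -{1}(modc_nat R W) [modc (G - _)]modcB.
  by apply: le_trans (modcD _ _); rewrite addrC subrK.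
lra.
Qed.
End Character.

Lemma big_window (V : nmodType) (F : nat -> V) (h M T : nat) : (h + M <= T)%N ->
  \sum_(t < T | (h <= t < h + M)%N) F t = \sum_(k < M) F (k + h)%N.
Proof.
move=> hT; rewrite -(big_mkord (fun t => (h <= t < h + M)%N) F).
transitivity (\sum_(0 + h <= t < M + h) F t).
  rewrite add0n (addnC M) (big_nat_widen _ _ _ _ _ hT) (@big_nat_widenl _ _ _ h 0) //=.
  by apply: eq_bigl => t; rewrite andbC.
by rewrite big_addn addnK big_mkord.
Qed.

(** * The double large sieve on a grid *)

Section Sieve.
Variables (R : archiRcfType) (e : R -> R[i]).
Hypothesis he : unit_character e.

Lemma exchange_big3 (A B J : finType) (F : A -> B -> J -> R[i]) :
  \sum_a \sum_b \sum_j F a b j = \sum_j \sum_a \sum_b F a b j.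
Proof.
transitivity (\sum_a \sum_j \sum_b F a b j); last exact: exchange_big.
by apply: eq_bigr => a _; apply: exchange_big.
Qed.

(** Orthogonality modulo Q, where frequencies less than Q apart are congruent only if equal. The
    first variable runs over two periods, because windows that start in the first period may end in
    the second. *)
Lemma parseval2 (J : finType) (c : J -> R[i]) (y v : J -> int) (Q : nat) : (0 < Q)%N ->
  (forall j j', `|y j - y j'| < Q%:Z) -> (forall j j', `|v j - v j'| < Q%:Z) ->
  \sum_(t2 < 2 * Q) \sum_(t3 < Q)
    modc (\sum_j c j * e (t2%:R * (y j)%:~R / Q%:R + t3%:R * (v j)%:~R / Q%:R)) ^+ 2 <=
  2 * Q%:R ^+ 2 * \sum_j \sum_j' modc (c j) * modc (c j') * ((y j == y j') && (v j == v j'))%:R.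
Proof.
move=> Q0 yQ vQ; set S := \sum_(t2 < _) _.
have S0 : 0 <= S by apply: sumr_ge0 => t2 _; apply: sumr_ge0 => t3 _; rewrite sqr_ge0.
have dv (m : int) : `|m| < Q%:Z -> (Q%:Z %| m)%Z = (m == 0).
  move=> mQ; apply/idP/eqP => [|->]; last by rewrite dvdz0.
  rewrite dvdzE /=; move: mQ; rewrite -abszE ltz_nat => mQ Qm; apply/eqP.
  by rewrite -absz_eq0; apply: contraTT Qm; rewrite -lt0n => m0; rewrite gtnNdvd.
have E : (S%:C)%C = \sum_j \sum_j' (2 * Q%:R ^+ 2) * (c j * ((c j')^*)%C * ((y j == y j') && (v j == v j'))%:R).
  rewrite /S rmorph_sum /=.
  transitivity (\sum_(t2 < 2 * Q) \sum_(t3 < Q) \sum_j \sum_j' c j * ((c j')^*)%C *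
    (e (t2%:R * (y j - y j')%:~R / Q%:R) * e (t3%:R * (v j - v j')%:~R / Q%:R))).
    apply: eq_bigr => t2 _; rewrite rmorph_sum /=; apply: eq_bigr => t3 _.
    rewrite modc_sqr rmorph_sum /= big_distrlr /=; apply: eq_bigr => j _; apply: eq_bigr => j' _.
    rewrite rmorphM /= -charN // mulrACA -(charD he) -(charD he).
    by congr (_ * e _); rewrite !intrB; ring.
  rewrite exchange_big3; apply: eq_bigr => j _.
  rewrite exchange_big3; apply: eq_bigr => j' _.
  under eq_bigr => t2 _ do rewrite -mulr_sumr -mulr_sumr.
  rewrite -mulr_sumr -mulr_suml char_geometric //.
  have := char_geometric he (v j - v j') 1 Q0; rewrite mul1n => ->.
  rewrite !dv // !subr_eq0; case: (y j == y j'); case: (v j == v j');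
    rewrite ?mulr0 ?mul0r ?mulr0 //= natrM mulr1; ring.
rewrite -(modc_real S0) E; apply: le_trans (modc_sum _ _ _) _.
rewrite mulr_sumr; apply: ler_sum => j _.
apply: le_trans (modc_sum _ _ _) _; rewrite mulr_sumr; apply: ler_sum => j' _.
rewrite !modcM modc_conj -[2]/(2%:R) -natrX -natrM !modc_nat natrM natrX.
by [].
Qed.
Lemma window_sum (X W T Q : nat) (y : int) : (X + W <= T)%N ->
  \sum_(t < T | (X <= t < X + W)%N) e (t%:R * y%:~R / Q%:R) =
  e (X%:R * y%:~R / Q%:R) * \sum_(r < W) e (r%:R * y%:~R / Q%:R).
Proof.
move=> XT; rewrite (big_window (fun t => e (t%:R * y%:~R / Q%:R)) XT) mulr_sumr.
by apply: eq_bigr => r _; rewrite -(charD he); congr e; rewrite natrD; ring.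
Qed.

Lemma window_card (X W T : nat) : \sum_(t < T) ((X <= t < X + W)%N)%:R <= W%:R :> R.
Proof.
rewrite -natr_sum ler_nat -big_mkcond sum1_card cardE -(size_map val).
rewrite -[leqRHS](size_iota X); apply: uniq_leq_size.
  by rewrite (map_inj_uniq val_inj) enum_uniq.
by move=> _ /mapP[t + ->]; rewrite mem_enum mem_iota.
Qed.

(** The method of Bombieri and Iwaniec: the phase at a point is a sum over a window of grid points,
    divided by a geometric sum of size at least half the window. Cauchy-Schwarz over the grid
    separates the points, counted by overlapping windows, from the frequencies, handled by
    [parseval2]. *)
Theorem double_sieve (I J : finType) (a : I -> R[i]) (b : J -> R[i]) (X2 X3 : I -> nat)
    (y w : J -> int) (Q W2 W3 tau R0 : nat) :
  (0 < Q)%N -> (0 < W2)%N -> (0 < W3)%N -> (0 < tau)%N -> (W2 <= Q)%N ->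
  (forall i, modc (a i) <= 1) -> (forall i, X2 i < Q)%N -> (forall i, X3 i <= R0)%N ->
  (forall j, 14 * W2%:Z * `|y j| <= Q%:Z) -> (forall j, 14 * W3%:Z * `|w j| <= Q%:Z) ->
  (14 * (tau * (R0 + W3)) <= Q)%N ->
  modc (\sum_i \sum_j a i * b j * e ((X2 i)%:R * (y j)%:~R / Q%:R + (X3 i)%:R * (w j)%:~R / Q%:R)) ^+ 2
  <= 128 * Q%:R ^+ 2 / (W2%:R * W3%:R * tau%:R) *
    (\sum_i \sum_i' ((`|(X2 i)%:Z - (X2 i')%:Z| < W2%:Z) && (`|(X3 i)%:Z - (X3 i')%:Z| < W3%:Z))%:R) *
    (\sum_j \sum_j' modc (b j) * modc (b j') * ((y j == y j') && (`|w j - w j'| < tau%:Z))%:R).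
Proof.
move=> Q0 W20 W30 tau0 W2Q a1 X2Q X3R yQ wQ tQ.
have Qr : 0 < Q%:R :> R by rewrite ltr0n.
have W2r : 0 < W2%:R :> R by rewrite ltr0n.
have W3r : 0 < W3%:R :> R by rewrite ltr0n.
have tr : 0 < tau%:R :> R by rewrite ltr0n.
set T3 := (R0 + W3)%N in tQ.
have T3Q : (T3 <= Q)%N by move: tQ tau0; clear; nia.
pose G (W : nat) (z : int) := \sum_(r < W) e (r%:R * z%:~R / Q%:R).
have G2 j : W2%:R / 2 <= modc (G W2 (y j)) by apply: char_smooth.
have G3 j : W3%:R / 2 <= modc (G W3 (w j)) by apply: char_smooth.
have nz z (W : R) : 0 < W -> W / 2 <= modc z -> z != 0.
  move=> W0 Wz; apply: contraTneq Wz => ->; rewrite modc0 -ltNge; lra.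
pose b' j := b j / (G W2 (y j) * G W3 (w j)).
pose chi i (t : 'I_(2 * Q) * 'I_T3) :=
  ((X2 i <= t.1 < X2 i + W2) && (X3 i <= t.2 < X3 i + W3))%N.
pose Ut t := \sum_i a i * (chi i t)%:R.
pose Vt (t : 'I_(2 * Q) * 'I_T3) :=
  \sum_j b' j * e (t.1%:R * (y j)%:~R / Q%:R + t.2%:R * (w j)%:~R / Q%:R).
set A := (X in _ <= _ * X * _); set B := (X in _ <= _ * X).
have -> : \sum_i \sum_j a i * b j * e ((X2 i)%:R * (y j)%:~R / Q%:R + (X3 i)%:R * (w j)%:~R / Q%:R) =
   \sum_t Ut t * Vt t.
  transitivity (\sum_i \sum_j a i * b' j * \sum_t ((chi i t)%:R *
     e (t.1%:R * (y j)%:~R / Q%:R + t.2%:R * (w j)%:~R / Q%:R))).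
    apply: eq_bigr => i _; apply: eq_bigr => j _.
    have -> : \sum_t ((chi i t)%:R * e (t.1%:R * (y j)%:~R / Q%:R + t.2%:R * (w j)%:~R / Q%:R)) =
       (e ((X2 i)%:R * (y j)%:~R / Q%:R) * G W2 (y j)) * (e ((X3 i)%:R * (w j)%:~R / Q%:R) * G W3 (w j)).
      rewrite -(@window_sum _ _ (2 * Q)) -?(@window_sum _ _ T3); last 2 first.
      - by rewrite leq_add2r.
      - by have := X2Q i; move: W2Q; clear; lia.
      rewrite big_distrlr /= pair_big /= [RHS]big_mkcond /=.
      apply: eq_bigr => t _; rewrite /chi (charD he).
      by case: ifP => _; rewrite ?mul1r ?mul0r.
    rewrite (charD he) /b'; field.
    by rewrite (nz _ _ W2r (G2 j)) (nz _ _ W3r (G3 j)).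
  rewrite /Ut /Vt; under [RHS]eq_bigr => t _ do rewrite big_distrlr /=.
  rewrite [RHS]exchange_big /=; apply: eq_bigr => i _.
  rewrite [RHS]exchange_big /=; apply: eq_bigr => j _.
  by rewrite mulr_sumr; apply: eq_bigr => t _; ring.
apply: le_trans (CauchySchwarz _ _ _) _.
have B0 : 0 <= B.
  by apply: sumr_ge0 => j _; apply: sumr_ge0 => j' _; rewrite !mulr_ge0 ?modc_ge0.
have A0 : 0 <= A by apply: sumr_ge0 => i _; apply: sumr_ge0 => i' _.
have HA : \sum_t modc (Ut t) ^+ 2 <= W2%:R * W3%:R * A.
  apply: le_trans (_ : \sum_t (\sum_i (chi i t)%:R) ^+ 2 <= _).
    apply: ler_sum => t _; apply: lerXn2r; rewrite ?nnegrE ?modc_ge0 ?sumr_ge0 //.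
    apply: le_trans (modc_sum _ _ _) _; apply: ler_sum => i _.
    by rewrite modcM modc_nat ler_piMl.
  under eq_bigr => t _ do rewrite expr2 big_distrlr /=.
  rewrite exchange_big /= /A mulr_sumr; apply: ler_sum => i _.
  rewrite exchange_big /= mulr_sumr; apply: ler_sum => i' _.
  have [close|far] := boolP ((`|(X2 i)%:Z - (X2 i')%:Z| < W2%:Z) && (`|(X3 i)%:Z - (X3 i')%:Z| < W3%:Z)).
    rewrite mulr1; apply: le_trans (_ : \sum_t (chi i t)%:R <= _).
      by apply: ler_sum => t _; rewrite ler_piMr // lern1 leq_b1.
    have := ler_pM _ _ (window_card (X2 i) W2 (2 * Q)) (window_card (X3 i) W3 T3).
    rewrite big_distrlr /= pair_bigA /= => H.
    apply: le_trans (H _ _); rewrite ?sumr_ge0 //.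
    by apply: ler_sum => t _; rewrite /chi -natrM mulnb.
  rewrite mulr0 big1 // => -[t2 t3] _; rewrite -natrM mulnb; apply/eqP.
  rewrite pnatr_eq0 eqb0; apply: contra far; rewrite /chi /=.
  by case/andP=> /andP[/andP[? ?] /andP[? ?]] /andP[/andP[? ?] /andP[? ?]]; lia.
have HV : \sum_t modc (Vt t) ^+ 2 <= 128 * Q%:R ^+ 2 / (W2%:R ^+ 2 * W3%:R ^+ 2 * tau%:R) * B.
  (* Multiplication by a geometric sum of length tau spreads each frequency w over tau consecutive
     integers, so that the orthogonality relation detects |w - w'| < tau. It costs a factor 2,
     because the grid variable stays below T3 <= Q / (14 tau). *)
  have tau2 (z : R[i]) (t : 'I_T3) : modc z <= 2 / tau%:R * modc (z * G tau t%:Z).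
    have H : tau%:R / 2 <= modc (G tau t%:Z).
      by apply: char_smooth => //; have := ltn_ord t; move: tQ; rewrite -/T3; clear; nia.
    rewrite modcM mulrA [_ * modc z]mulrC -mulrA ler_peMr ?modc_ge0 //.
    by rewrite mulrC mulrA ler_pdivlMr // mul1r; lra.
  pose c (k : J * 'I_tau) := b' k.1.
  pose y' (k : J * 'I_tau) := y k.1; pose w' (k : J * 'I_tau) := w k.1 + (k.2 : nat)%:Z.
  have VG t : Vt t * G tau t.2%:Z = \sum_k c k * e (t.1%:R * (y' k)%:~R / Q%:R + t.2%:R * (w' k)%:~R / Q%:R).
    rewrite /Vt /G big_distrlr /= pair_bigA /=; apply: eq_bigr => -[j r] _.
    rewrite /c /y' /w' /= -mulrA -(charD he); congr (_ * e _).
    by rewrite intrD -!pmulrn; ring.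
  have yy j j' : `|y j - y j'| < Q%:Z.
    by have := yQ j; have := yQ j'; move: W20 Q0; clear; nia.
  have ww k k' : `|w' k - w' k'| < Q%:Z.
    have := wQ k.1; have := wQ k'.1; have := ltn_ord k.2; have := ltn_ord k'.2.
    by rewrite /w'; move: W30 Q0 tQ; rewrite -/T3 /T3; clear; nia.
  have PV := parseval2 c Q0 (fun k k' => yy k.1 k'.1) ww.
  apply: le_trans (_ : (2 / tau%:R) ^+ 2 * \sum_(t2 < 2 * Q) \sum_(t3 < Q)
     modc (\sum_k c k * e (t2%:R * (y' k)%:~R / Q%:R + t3%:R * (w' k)%:~R / Q%:R)) ^+ 2 <= _).
    rewrite -(pair_bigA _ (fun t2 t3 => modc (Vt (t2, t3)) ^+ 2)) mulr_sumr /=.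
    apply: ler_sum => t2 _.
    pose F (t3 : nat) := modc (\sum_k c k * e (t2%:R * (y' k)%:~R / Q%:R + t3%:R * (w' k)%:~R / Q%:R)) ^+ 2.
    apply: le_trans (_ : (2 / tau%:R) ^+ 2 * \sum_(t3 < T3) F t3 <= _).
      rewrite mulr_sumr; apply: ler_sum => t3 _; rewrite /F -(VG (t2, t3)) -exprMn.
      apply: lerXn2r; rewrite ?nnegrE ?mulr_ge0 ?modc_ge0 ?invr_ge0 //.
    apply: ler_wpM2l; first by rewrite sqr_ge0.
    rewrite (big_ord_widen _ F T3Q) big_mkcond; apply: ler_sum => t3 _.
    by case: ifP => // _; rewrite sqr_ge0.
  apply: le_trans (ler_wpM2l _ PV) _; first by rewrite sqr_ge0.
  have Bk : \sum_k \sum_k' modc (c k) * modc (c k') * ((y' k == y' k') && (w' k == w' k'))%:R <=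
      tau%:R * (4 / (W2%:R * W3%:R)) ^+ 2 * B.
    pose n (k k' : J * 'I_tau) : R := ((y' k == y' k') && (w' k == w' k'))%:R.
    rewrite -(pair_bigA _ (fun j r => \sum_k' modc (c (j, r)) * modc (c k') * n (j, r) k')) /=.
    rewrite /B mulr_sumr; apply: ler_sum => j _.
    rewrite exchange_big /= -(pair_bigA _ (fun j' r' => \sum_(r < tau) modc (c (j, r)) * modc (c (j', r')) * n (j, r) (j', r'))) /=.
    rewrite mulr_sumr; apply: ler_sum => j' _.
    rewrite /c /=; under eq_bigr => r' _ do rewrite -mulr_sumr.
    rewrite -mulr_sumr.
    have b'le i : modc (b' i) <= 4 / (W2%:R * W3%:R) * modc (b i).
      rewrite /b' modcM modcV modcM mulrC; apply: ler_wpM2r; first exact: modc_ge0.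
      have -> : 4 / (W2%:R * W3%:R) = (W2%:R / 2 * (W3%:R / 2))^-1 :> R by field; rewrite !gt_eqF.
      have W2h : 0 < W2%:R / 2 :> R by rewrite divr_gt0.
      have W3h : 0 < W3%:R / 2 :> R by rewrite divr_gt0.
      have g2 := lt_le_trans W2h (G2 i); have g3 := lt_le_trans W3h (G3 i).
      by rewrite lef_pV2 ?posrE; [apply: ler_pM => //; exact: ltW|exact: mulr_gt0|exact: mulr_gt0].
    set z := (X in _ <= _ * (_ * X)).
    have -> : tau%:R * (4 / (W2%:R * W3%:R)) ^+ 2 * (modc (b j) * modc (b j') * z) =
       (4 / (W2%:R * W3%:R) * modc (b j)) * (4 / (W2%:R * W3%:R) * modc (b j')) * (tau%:R * z) by ring.
    apply: ler_pM; rewrite ?mulr_ge0 ?modc_ge0 //.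
    - by apply: sumr_ge0 => r' _; apply: sumr_ge0.
    - by apply: ler_pM; rewrite ?modc_ge0.
    rewrite /z; have [close|far] := boolP ((y j == y j') && (`|w j - w j'| < tau%:Z)); last first.
      rewrite mulr0 big1 // => r' _; rewrite big1 // => r _; apply/eqP.
      rewrite /n /y' /w' /= pnatr_eq0 eqb0; apply: contra far => /andP[-> /eqP]; rewrite /=.
      by have := ltn_ord r; have := ltn_ord r'; clear; lia.
    rewrite mulr1; apply: le_trans (_ : \sum_(r' < tau) (1 : R) <= _); last by rewrite sumr_const card_ord.
    apply: ler_sum => r' _; rewrite -natr_sum lern1 -big_mkcond sum1_card.
    apply/card_le1_eqP => r1 r2; rewrite !unfold_in /w' /= => /andP[_ /eqP E1] /andP[_ /eqP E2].
    by apply: val_inj; move: E1; rewrite -E2 => /addrI [].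
  rewrite mulrA; apply: le_trans (ler_wpM2l _ Bk) _.
    by apply: mulr_ge0; [exact: sqr_ge0|apply: mulr_ge0 => //; exact: sqr_ge0].
  by rewrite le_eqVlt; apply/orP; left; apply/eqP; field; rewrite !gt_eqF.
have -> : 128 * Q%:R ^+ 2 / (W2%:R * W3%:R * tau%:R) * A * B =
   (W2%:R * W3%:R * A) * (128 * Q%:R ^+ 2 / (W2%:R ^+ 2 * W3%:R ^+ 2 * tau%:R) * B).
  by field; rewrite !gt_eqF.
by apply: ler_pM => //; apply: sumr_ge0 => t _; rewrite sqr_ge0.
Qed.
End Sieve.

(** * Spacing of the second and third derivatives *)

Section Spacing.
Variable R : archiRealFieldType.
Implicit Types (P X C : R) (g : nat -> R).

Definition steep2 (lam C : R) (M : nat) g := forall m m' d : nat, (m <= m')%N -> (m' + d < M)%N ->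
  lam * d%:R * (m' - m)%:R <= (g (m' + d)%N - g m') - (g (m + d)%N - g m) <= C * lam * d%:R * (m' - m)%:R.

Definition steep1 (lam : R) (M : nat) g := forall m m' : nat, (m <= m')%N -> (m' < M)%N ->
  lam * (m' - m)%:R <= g m' - g m.

(** Closeness of the points (g2 / 2 mod 1, g3). The integer part is an arbitrary function, so one
    lemma serves both orders of a pair, with [nu] replaced by its opposite. *)
Definition close P X g2 g3 (nu : nat -> nat -> int) (t : nat * nat) : bool :=
  (`|g3 t.1 - g3 t.2| <= (X * P ^+ 6)^-1) &&
  (`|(g2 t.1 - g2 t.2) / 2 - (nu t.1 t.2)%:~R| <= (4 * X * P ^+ 3)^-1).

(** For a fixed difference d, half of g2(m + d) - g2(m) increases by at least P^(-13) d / 2 at each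
    step and by at most C d / (2 P^5) in all. The second fact limits the integers it can be close
    to, the first the number of m for each of them. *)
Lemma close_diff P X C (M d : nat) g2 g3 nu : 1 <= P -> 1 <= X -> 1 <= C ->
  M%:R <= P ^+ 8 -> (0 < d)%N -> steep2 (P ^- 13) C M g2 ->
  atmost (fun m : nat => (m + d < M)%N && close P X g2 g3 nu ((m + d)%N, m))
    (C * d%:R / P ^+ 5 * (8 * P ^+ 10 / (X * d%:R) + 3) + 4 * (8 * P ^+ 10 / (X * d%:R) + 3)).
Proof.
move=> P1 X1 C1 MP d0 S2.
have P0 : 0 < P := lt_le_trans ltr01 P1; have X0 : 0 < X := lt_le_trans ltr01 X1.
have Pn n : 0 < P ^+ n := exprn_gt0 n P0.
have P31 : 1 <= P ^+ 3 := exprn_ege1 3 P1.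
have dR : 0 < d%:R :> R by rewrite ltr0n.
set dl := (4 * X * P ^+ 3)^-1.
have dl0 : 0 < dl by rewrite invr_gt0 !mulr_gt0.
have dl1 : dl <= 1 / 4.
  rewrite /dl div1r lef_pV2 ?posrE ?mulr_gt0 // -mulrA ler_pMr //.
  by rewrite mulr_ege1.
rewrite -mulrDl; set b := 8 * P ^+ 10 / (X * d%:R) + 3.
have b0 : 0 <= b by rewrite addr_ge0 // divr_ge0 ?mulr_ge0 ?ltW.
pose h (m : nat) := (g2 (m + d)%N - g2 m) / 2.
set l := C * d%:R / P ^+ 5 / 2 + 2 * dl.
have l0 : 0 <= l.
  have : 0 <= C * d%:R / P ^+ 5 by rewrite divr_ge0 ?mulr_ge0 ?ltW //; lra.
  by rewrite /l; lra.
apply: (@atmost_le _ _ _ ((2 * (l / 1) + 3) * b)).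
  by apply: ler_wpM2r => //; rewrite divr1 /l; lra.
have hstep m m' : (m <= m')%N -> (m' + d < M)%N ->
   P ^- 13 * d%:R * (m' - m)%:R / 2 <= h m' - h m <= C * (d%:R / P ^+ 5) / 2.
  move=> mm' m'M; have /andP[H1 H2] := S2 _ _ _ mm' m'M.
  have -> : h m' - h m = (g2 (m' + d)%N - g2 m' - (g2 (m + d)%N - g2 m)) / 2 by rewrite /h; field.
  rewrite !ler_pM2r ?invr_gt0 // H1 /=; apply: le_trans H2 _.
  have -> : C * (d%:R / P ^+ 5) = C * P ^- 13 * d%:R * P ^+ 8 by field; rewrite gt_eqF.
  apply: ler_wpM2l; first by rewrite !mulr_ge0 ?invr_ge0 ?(ltW (Pn 13)) //; lra.
  by apply: le_trans MP; rewrite ler_nat; move: m'M; clear; lia.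
apply: (@atmost_cells _ _ (fun m => (nu (m + d)%N m)%:~R)) => //.
  have key m m' : (m <= m')%N -> (m + d < M)%N && close P X g2 g3 nu ((m + d)%N, m) ->
     (m' + d < M)%N && close P X g2 g3 nu ((m' + d)%N, m') ->
     `|(nu (m + d)%N m)%:~R - (nu (m' + d)%N m')%:~R| <= l :> R.
    move=> mm' /andP[_ /andP[_ /= H]] /andP[m'M /andP[_ /= H']].
    have /andP[h1 h2] := hstep _ _ mm' m'M.
    have hp : 0 <= h m' - h m.
      by apply: le_trans h1; rewrite !mulr_ge0 ?invr_ge0 // ltW.
    move: H H'; rewrite -/(h m) -/(h m') -/dl !ler_norml => /andP[? ?] /andP[? ?].
    have E : C * (d%:R / P ^+ 5) / 2 = C * d%:R / P ^+ 5 / 2 by rewrite mulrA.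
    by apply/andP; split; rewrite /l -E; lra.
  move=> m m' Hm Hm'; have /orP[mm'|mm'] := leq_total m m'; first exact: key.
  by rewrite distrC; apply: key.
move=> z.
apply: (@atmost_le _ _ _ (2 * (2 * dl / (P ^- 13 * d%:R / 2)) + 3)).
  have -> : 2 * (2 * dl / (P ^- 13 * d%:R / 2)) = 2 * (P ^+ 10 / (X * d%:R)).
    by rewrite /dl; field; rewrite !gt_eqF.
  have : 0 <= P ^+ 10 / (X * d%:R) by rewrite divr_ge0 ?mulr_ge0 ?ltW.
  by rewrite /b -mulrA; clear; lra.
apply: (@atmost_spaced _ _ h).
- by rewrite !mulr_gt0 ?invr_gt0.
- by rewrite mulr_ge0 // ltW.
- move=> m m' /andP[/andP[_ /andP[_ /= H]] /eqP zE] /andP[/andP[_ /andP[_ /= H']] /eqP zE'].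
  have E : (nu (m + d)%N m)%:~R = (nu (m' + d)%N m')%:~R :> R.
    by rewrite !divr1 !intrKfloor in zE zE'; rewrite zE zE'.
  move: H H'; rewrite E -/(h m) -/(h m') -/dl !ler_norml => /andP[? ?] /andP[? ?].
  by apply/andP; split; lra.
have key m m' : (m < m')%N -> (m' + d < M)%N -> P ^- 13 * d%:R / 2 <= `|h m - h m'|.
  move=> mm' m'M; have /andP[h1 _] := hstep _ _ (ltnW mm') m'M.
  rewrite distrC; apply: le_trans (ler_norm _); apply: le_trans h1.
  have E : P ^- 13 * d%:R * (m' - m)%:R / 2 = (P ^- 13 * d%:R / 2) * (m' - m)%:R by field; rewrite gt_eqF.
  rewrite E ler_peMr ?ler1n ?subn_gt0 //.
  by rewrite !mulr_ge0 ?invr_ge0 // ltW.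
move=> m m' /andP[/andP[mM _] _] /andP[/andP[m'M _] _].
rewrite neq_ltn => /orP[mm'|mm']; first exact: key.
by rewrite distrC; apply: key.
Qed.

(** As g3 increases by at least P^(-13) per step, its closeness forces a difference of at most P^7 /
    X. In the sum of [close_diff] over these differences the largest terms are (P^5 / X) (P^7 / X)
    and P^10 / X times a logarithm, both within P^12 / X^2 up to the logarithm since X <= P^2. *)
Lemma close_pairs P X C (M L : nat) g2 g3 nu : 1 <= P -> 1 <= X -> X <= P ^+ 2 -> 1 <= C ->
  M%:R <= P ^+ 8 -> P ^+ 7 < 2 ^+ L -> (0 < L)%N -> steep2 (P ^- 13) C M g2 -> steep1 (P ^- 13) M g3 ->
  atmost (fun t : nat * nat => [&& (t.2 < t.1)%N, (t.1 < M)%N & close P X g2 g3 nu t])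
   (55 * C * L%:R * (P ^+ 12 / X ^+ 2)).
Proof.
move=> P1 X1 XP C1 MP PL L0 S2 S1.
have P0 : 0 < P := lt_le_trans ltr01 P1; have X0 : 0 < X := lt_le_trans ltr01 X1.
have Pn n : 0 < P ^+ n := exprn_gt0 n P0.
have LR : 1 <= L%:R :> R by rewrite ler1n.
set D := `|Num.floor (P ^+ 7 / X)|%N.
have PX0 : 0 <= P ^+ 7 / X by rewrite divr_ge0 // ltW.
have DE : D%:Z = Num.floor (P ^+ 7 / X) by rewrite /D gez0_abs // floor_ge0.
have DP : D%:R <= P ^+ 7 / X by rewrite -[D%:R]/(D%:Z%:~R) DE floor_le.
have DP7 : D%:R <= P ^+ 7.
  by apply: le_trans DP _; rewrite ler_pdivrMr // ler_peMr // ltW.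
pose bd (d : nat) : R := C * d%:R / P ^+ 5 * (8 * P ^+ 10 / (X * d%:R) + 3) + 4 * (8 * P ^+ 10 / (X * d%:R) + 3).
apply: (@atmost_le _ _ _ (\sum_(d <- iota 1 D) bd d)); last first.
  apply: (@atmost_fib _ _ _ (fun t : nat * nat => (t.1 - t.2)%N)).
    move=> [m m'] /= /and3P[mm' mM /andP[/= g3c _]].
    have H := S1 _ _ (ltnW mm') mM.
    have : (m - m')%:R <= P ^+ 7 / X.
      have : P ^- 13 * (m - m')%:R <= (X * P ^+ 6)^-1.
        by apply: le_trans H _; apply: le_trans g3c; apply: ler_norm.
      rewrite -(ler_pM2l (Pn 13)) mulrA mulfV ?gt_eqF // mul1r.
      have -> : P ^+ 13 * (X * P ^+ 6)^-1 = P ^+ 7 / X by field; rewrite !gt_eqF.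
      by [].
    rewrite -[(m - m')%:R]/((m - m')%N%:Z%:~R) -floor_ge_int -DE lez_nat => mD.
    by rewrite mem_iota subn_gt0 mm' /= add1n ltnS.
  move=> d; rewrite mem_iota => /andP[d0 _].
  apply: (@atmost_inj _ _ _ snd _ _ _ _ _ (@close_diff P X C M d g2 g3 nu P1 X1 C1 MP d0 S2)).
    move=> [m m'] /= /andP[/and3P[mm' mM cl] /eqP dE].
    have -> : (m' + d)%N = m by rewrite -dE subnKC // ltnW.
    by rewrite mM cl.
  move=> [m m'] [k k'] /= /andP[/and3P[mm' _ _] /eqP dE] /andP[/and3P[kk' _ _] /eqP dE'] mk.
  by rewrite -mk in kk' dE' *; congr (_, _); rewrite -(subnK (ltnW mm')) dE -dE' subnK // ltnW.
have bdE d : d \in iota 1 D -> bd d <= 8 * C * (P ^+ 5 / X) + 3 * C * (P ^+ 7 / X / P ^+ 5) + 12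
     + 32 * (P ^+ 10 / X) * d%:R^-1.
  rewrite mem_iota => /andP[d0 dD].
  have dR : 0 < d%:R :> R by rewrite ltr0n.
  have dP : d%:R <= P ^+ 7 / X by apply: le_trans DP; rewrite ler_nat -ltnS -add1n.
  have -> : bd d = 8 * C * (P ^+ 5 / X) + 3 * C * (d%:R / P ^+ 5) + 12 + 32 * (P ^+ 10 / X) * d%:R^-1.
    by rewrite /bd; field; rewrite !gt_eqF.
  rewrite lerD2r lerD2r lerD2l; apply: ler_wpM2l; first by lra.
  by apply: ler_wpM2r => //; rewrite invr_ge0 ltW.
apply: le_trans (_ : \sum_(d <- iota 1 D) (8 * C * (P ^+ 5 / X) + 3 * C * (P ^+ 7 / X / P ^+ 5) + 12
     + 32 * (P ^+ 10 / X) * d%:R^-1) <= _).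
  by rewrite [leLHS]big_seq [leRHS]big_seq; apply: ler_sum.
rewrite big_split /= sum_const size_iota -mulr_sumr.
have hs : \sum_(d <- iota 1 D) d%:R^-1 <= L%:R :> R.
  apply: harmonic_seq => [|d]; first exact: iota_uniq.
  rewrite mem_iota => /andP[_ dD]; rewrite -(ltr_nat R) natrX.
  by apply: le_lt_trans PL; apply: le_trans DP7; rewrite ler_nat -ltnS -add1n.
set Z := P ^+ 12 / X ^+ 2.
have Z0 : 0 <= Z by rewrite divr_ge0 ?exprn_ge0 // ltW.
have X2P n m : (n + 2 <= m)%N -> P ^+ n / X <= P ^+ m / X ^+ 2.
  move=> nm; rewrite ler_pdivrMr //.
  have -> : P ^+ m / X ^+ 2 * X = P ^+ m / X by field; rewrite gt_eqF.
  rewrite ler_pdivlMr //; apply: le_trans (_ : P ^+ n * P ^+ 2 <= _).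
    by apply: ler_wpM2l => //; exact: ltW.
  by rewrite -exprD; apply: ler_weXn2l.
have z1 : P ^+ 10 / X <= Z by apply: X2P.
have z2 : P ^+ 7 / X <= Z by apply: X2P.
have w1 : P ^+ 5 / X * D%:R <= Z.
  apply: le_trans (_ : P ^+ 5 / X * (P ^+ 7 / X) <= _).
    by apply: ler_wpM2l => //; rewrite divr_ge0 // ltW.
  by rewrite le_eqVlt; apply/orP; left; apply/eqP; rewrite /Z; field; rewrite gt_eqF.
have w2 : P ^+ 7 / X / P ^+ 5 * D%:R <= Z.
  apply: le_trans w1; apply: ler_wpM2r => //.
  have -> : P ^+ 7 / X / P ^+ 5 = P ^+ 2 / X by field; rewrite !gt_eqF.
  by apply: ler_wpM2r; [rewrite invr_ge0 ltW|apply: ler_weXn2l].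
have CZ : C * Z <= C * L%:R * Z by rewrite mulrAC ler_peMr // mulr_ge0 //; lra.
have ZC : L%:R * Z <= C * L%:R * Z by rewrite -mulrA ler_peMl // mulr_ge0.
have ZZ : Z <= L%:R * Z by rewrite ler_peMl.
have C0 : 0 <= C by lra.
have W1 : C * (P ^+ 5 / X * D%:R) <= C * Z by apply: ler_wpM2l.
have W2 : C * (P ^+ 7 / X / P ^+ 5 * D%:R) <= C * Z by apply: ler_wpM2l.
have W3 : (P ^+ 10 / X) * \sum_(d <- iota 1 D) d%:R^-1 <= Z * L%:R.
  by apply: ler_pM => //; [rewrite divr_ge0 // ltW|apply: sumr_ge0 => d _; rewrite invr_ge0].
have W4 : D%:R <= Z by apply: le_trans z2.
set s := \sum_(d <- iota 1 D) _ in W3 *; set aa := P ^+ 5 / X in W1 *.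
set bb := P ^+ 7 / X / P ^+ 5 in W2 *; set cc := P ^+ 10 / X in W3 *.
have -> : (8 * C * aa + 3 * C * bb + 12) * D%:R + 32 * cc * s =
  8 * (C * (aa * D%:R)) + 3 * (C * (bb * D%:R)) + 12 * D%:R + 32 * (cc * s) by ring.
have -> : 55 * C * L%:R * Z = 55 * (C * L%:R * Z) by ring.
rewrite [Z * _]mulrC in W3.
lra.
Qed.

Lemma close_count P X C (M L : nat) g2 g3 nu : 1 <= P -> 1 <= X -> X <= P ^+ 2 -> 1 <= C ->
  M%:R <= P ^+ 8 -> P ^+ 7 < 2 ^+ L -> (0 < L)%N -> steep2 (P ^- 13) C M g2 -> steep1 (P ^- 13) M g3 ->
  atmost (fun t : nat * nat => [&& (t.1 < M)%N, (t.2 < M)%N & close P X g2 g3 nu t])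
   (111 * C * L%:R * (P ^+ 12 / X ^+ 2)).
Proof.
move=> P1 X1 XP C1 MP PL L0 S2 S1.
have P0 : 0 < P := lt_le_trans ltr01 P1; have X0 : 0 < X := lt_le_trans ltr01 X1.
set B := 55 * C * L%:R * (P ^+ 12 / X ^+ 2).
set Z := P ^+ 12 / X ^+ 2 in B *.
have LR : 1 <= L%:R :> R by rewrite ler1n.
have MZ : M%:R <= Z.
  apply: le_trans MP _; rewrite /Z ler_pdivlMr ?exprn_gt0 //.
  have -> : P ^+ 12 = P ^+ 8 * (P ^+ 2) ^+ 2 by ring.
  apply: ler_wpM2l; first by rewrite exprn_ge0 // ltW.
  by apply: lerXn2r; rewrite ?nnegrE ?exprn_ge0 ?(ltW X0) ?(ltW P0).
have Z0 : 0 <= Z := le_trans (ler0n _ _) MZ.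
have CL : Z <= C * L%:R * Z by rewrite ler_peMl // mulr_ege1.
apply: (@atmost_le _ _ _ (B + (B + M%:R))).
  by rewrite /B; lra.
apply: (@atmost_or _ _ _ (fun t => [&& (t.2 < t.1)%N, (t.1 < M)%N & close P X g2 g3 nu t])
  (fun t => [&& (t.1 <= t.2)%N, (t.2 < M)%N & close P X g2 g3 nu t])).
- by move=> [m m'] /and3P[/= -> -> ->]; rewrite !andbT; case: ltnP.
- exact: close_pairs.
apply: (@atmost_or _ _ _ (fun t => [&& (t.1 < t.2)%N, (t.2 < M)%N & close P X g2 g3 nu t])
  (fun t => (t.1 == t.2) && (t.2 < M)%N)).
- move=> [m m'] /and3P[/=]; rewrite leq_eqVlt => /orP[-> -> _|-> -> ->]; by rewrite ?orbT.
- apply: (@atmost_inj _ _ _ (fun t : nat * nat => (t.2, t.1)) _ _ _ _ _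
   (close_pairs (nu := fun m m' => - nu m' m) P1 X1 XP C1 MP PL L0 S2 S1)).
    move=> [m m'] /= /and3P[-> -> /andP[/= H1 H2]]; rewrite /= /close /= distrC H1 /=.
    rewrite -normrN; apply: le_trans H2; rewrite le_eqVlt; apply/orP; left; apply/eqP.
    by congr `|_|; rewrite intrN; field.
  by move=> [m m'] [k k'] _ _ /= [-> ->].
apply: (@atmost_inj _ _ _ snd _ (fun m => (m < M)%N)).
- by move=> [m m'] /andP[].
- by move=> [m m'] [k k'] /andP[/eqP /= -> _] /andP[/eqP /= -> _] ->.
rewrite -{2}(size_iota 0 M); apply: atmost_seq => m mM; by rewrite mem_iota.
Qed.
End Spacing.

Section RealSieve.
Variables (R : archiRcfType) (e : R -> R[i]).
Hypothesis he : unit_character e.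

Lemma archi_le (x y E : R) : (forall q : nat, (0 < q)%N -> x <= y + E / q%:R) -> x <= y.
Proof.
move=> H; rewrite leNgt; apply/negP => yx.
have d0 : 0 < x - y by rewrite subr_gt0.
have := H (Num.truncn (`|E| / (x - y))).+1 (ltn0Sn _).
apply/negP; rewrite -ltNge -ltrBrDl.
apply: le_lt_trans (_ : `|E| / (Num.truncn (`|E| / (x - y))).+1%:R < _).
  by apply: ler_wpM2r; rewrite ?invr_ge0 ?ler0n ?ler_norm.
rewrite ltr_pdivrMr ?ltr0n // mulrC -ltr_pdivrMr //.
have : 0 <= `|E| / (x - y) by rewrite divr_ge0 // ltW.
by move/truncn_itv/andP => [].
Qed.

(* Points are rounded to multiples of [1 / Q]; the bound of [double_sieve] does not depend on [Q],
   so the rounding error disappears as [Q] grows. *)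
Theorem real_sieve (I J : finType) (a : I -> R[i]) (b : J -> R[i]) (x2 x3 : I -> R)
    (y w : J -> int) (Y2 Y3 tau : nat) :
  (0 < Y2)%N -> (0 < tau)%N -> (2 * tau <= Y3)%N ->
  (forall i, modc (a i) <= 1) -> (forall i, 0 <= x3 i <= (28 * tau%:R)^-1) ->
  (forall j, `|y j| <= Y2%:Z) -> (forall j, `|w j| <= Y3%:Z) ->
  modc (\sum_i \sum_j a i * b j * e (x2 i * (y j)%:~R + x3 i * (w j)%:~R)) ^+ 2
  <= 128 * 196 * Y2%:R * Y3%:R / tau%:R *
    (\sum_i \sum_i' ((`|x2 i - x2 i' - (Num.floor (x2 i) - Num.floor (x2 i'))%:~R| <= (7 * Y2%:R)^-1)
        && (`|x3 i - x3 i'| <= (7 * Y3%:R)^-1))%:R) *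
    (\sum_j \sum_j' modc (b j) * modc (b j') * ((y j == y j') && (`|w j - w j'| < tau%:Z))%:R).
Proof.
move=> Y20 tau0 tauY a1 x3b yY wY.
have Y30 : (0 < Y3)%N by move: tau0 tauY; clear; lia.
have Y2r : 0 < Y2%:R :> R by rewrite ltr0n.
have Y3r : 0 < Y3%:R :> R by rewrite ltr0n.
have tr : 0 < tau%:R :> R by rewrite ltr0n.
set S := \sum_i _; set A := \sum_i _; set B := \sum_j _; set Bd := _ * A * B.
have A0 : 0 <= A by apply: sumr_ge0 => i _; apply: sumr_ge0 => i' _.
have B0 : 0 <= B.
  by apply: sumr_ge0 => j _; apply: sumr_ge0 => j' _; rewrite !mulr_ge0 ?modc_ge0.
have Bd0 : 0 <= Bd by rewrite !mulr_ge0 ?invr_ge0.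
suff : modc S <= Num.sqrt Bd.
  move=> H; rewrite -(sqr_sqrtr Bd0).
  by apply: lerXn2r; rewrite ?nnegrE ?modc_ge0 ?sqrtr_ge0.
pose E := \sum_(i : I) \sum_j modc (b j) * (7 * (Y2%:R + Y3%:R)).
apply: (@archi_le _ _ E) => q q0.
pose Q := (14 * Y2 * Y3 * q)%N.
have Q0 : (0 < Q)%N by rewrite /Q !muln_gt0 Y20 Y30 q0.
have Qr : 0 < Q%:R :> R by rewrite ltr0n.
pose fr i := x2 i - (Num.floor (x2 i))%:~R.
have fr01 i : 0 <= fr i < 1.
  have /andP[h1 h2] := floor_itv (x2 i).
  clear -h1 h2; by rewrite intrD in h2; rewrite /fr; apply/andP; split; lra.
pose X2 i := Num.truncn (Q%:R * fr i); pose X3 i := Num.truncn (Q%:R * x3 i).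
have X2b i : (X2 i)%:R <= Q%:R * fr i < (X2 i)%:R + 1.
  have := @truncn_itv _ (Q%:R * fr i); rewrite -/(X2 i) -natr1; apply.
  by rewrite mulr_ge0 //; case/andP: (fr01 i).
have X3b i : (X3 i)%:R <= Q%:R * x3 i < (X3 i)%:R + 1.
  have := @truncn_itv _ (Q%:R * x3 i); rewrite -/(X3 i) -natr1; apply.
  by rewrite mulr_ge0 //; case/andP: (x3b i).
have X2Q i : (X2 i < Q)%N.
  rewrite -(ltr_nat R); have /andP[h _] := X2b i; apply: le_lt_trans h _.
  by rewrite gtr_pMr //; case/andP: (fr01 i).
have X3Q i : (X3 i <= Q %/ (28 * tau))%N.
  rewrite leq_divRL ?muln_gt0 // -(ler_nat R) natrM.
  have /andP[h _] := X3b i; have /andP[_ h'] := x3b i.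
  rewrite natrM -ler_pdivlMr ?mulr_gt0 //; apply: le_trans h _.
  by apply: ler_wpM2l.
pose W2 := (Y3 * q)%N; pose W3 := (Y2 * q)%N.
have W20 : (0 < W2)%N by rewrite muln_gt0 Y30.
have W30 : (0 < W3)%N by rewrite muln_gt0 Y20.
have W2Q : (W2 <= Q)%N by move: Y20; rewrite /W2 /Q; clear; nia.
have yQ j : 14 * W2%:Z * `|y j| <= Q%:Z.
  have -> : Q%:Z = 14 * W2%:Z * Y2%:Z by rewrite /Q /W2; clear; lia.
  by apply: ler_wpM2l.
have wQ j : 14 * W3%:Z * `|w j| <= Q%:Z.
  have -> : Q%:Z = 14 * W3%:Z * Y3%:Z by rewrite /Q /W3; clear; lia.
  by apply: ler_wpM2l.
(* Half of the room is taken by the points, as x3 <= 1 / (28 tau), and half by the window, as 2 tau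
   <= Y3. *)
have tQ : (14 * (tau * (Q %/ (28 * tau) + W3)) <= Q)%N.
  have h1 : (2 * (14 * (tau * (Q %/ (28 * tau)))) <= Q)%N.
    by have := leq_trunc_div Q (28 * tau); move: (Q %/ _)%N; clear; lia.
  have h2 : (2 * (14 * (tau * W3)) <= Q)%N.
    have := leq_mul (leqnn (14 * W3)%N) tauY; rewrite /Q /W3; clear; lia.
  by move: h1 h2; clear; lia.
have := double_sieve he b Q0 W20 W30 tau0 W2Q a1 X2Q X3Q yQ wQ tQ.
set S' := \sum_i _; set A' := \sum_i _; rewrite -/B => H.
have AA : A' <= A.
  apply: ler_sum => i _; apply: ler_sum => i' _; rewrite ler_nat.
  have gen (x x' : R) (k k' : nat) (Y W : nat) : (0 < Y)%N -> (0 < W)%N -> (14 * Y * W)%N = Q ->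
      k%:R <= Q%:R * x < k%:R + 1 -> k'%:R <= Q%:R * x' < k'%:R + 1 ->
      `|k%:Z - k'%:Z| < W%:Z -> `|x - x'| <= (7 * Y%:R)^-1.
    move=> Yp Wp QE /andP[h1 h2] /andP[h3 h4] kk.
    have Yr : 0 < Y%:R :> R by rewrite ltr0n.
    have Wr : 1 <= W%:R :> R by rewrite ler1n.
    have kk' : `|k%:R - k'%:R| <= W%:R :> R.
      have : `|k%:Z - k'%:Z|%:~R <= W%:Z%:~R :> R by rewrite ler_int ltW.
      by rewrite intr_norm intrB.
    have QR : Q%:R = 14 * Y%:R * W%:R :> R by rewrite -QE !natrM.
    rewrite -(ler_pM2l Qr) -{1}(gtr0_norm Qr) -normrM mulrBr.
    have -> : Q%:R * (7 * Y%:R)^-1 = 2 * W%:R :> R by rewrite QR; field; rewrite gt_eqF.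
    move: kk'; rewrite !ler_norml => /andP[h5 h6]; clear - h1 h2 h3 h4 h5 h6 Wr.
    by apply/andP; split; lra.
  case: andP => // -[k2 k3]; rewrite lt0b; apply/andP; split.
    have -> : x2 i - x2 i' - (Num.floor (x2 i) - Num.floor (x2 i'))%:~R = fr i - fr i'.
      by rewrite /fr intrB; ring.
    by apply: gen k2 => //; rewrite /Q /W2; clear; lia.
  by apply: gen k3 => //; rewrite /Q /W3; clear; lia.
have S'B : modc S' <= Num.sqrt Bd.
  rewrite -[leLHS]ger0_norm ?modc_ge0 // -sqrtr_sqr ler_sqrt //.
  apply: le_trans H _.
  have -> : 128 * Q%:R ^+ 2 / (W2%:R * W3%:R * tau%:R) = 128 * 196 * Y2%:R * Y3%:R / tau%:R :> R.
    rewrite /Q /W2 /W3 !natrM; field.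
    by rewrite !gt_eqF // ltr0n.
  rewrite /Bd; apply: ler_wpM2r => //; apply: ler_wpM2l => //.
  by rewrite !mulr_ge0 ?invr_ge0.
have -> : S = S' + (S - S') by rewrite addrC subrK.
apply: le_trans (modcD _ _) _; apply: lerD => //.
rewrite /S /S' -sumrB /E mulr_suml; apply: le_trans (modc_sum _ _ _) _.
apply: ler_sum => i _; rewrite -sumrB mulr_suml; apply: le_trans (modc_sum _ _ _) _.
apply: ler_sum => j _; rewrite -mulrBr !modcM -[leLHS]mulrA.
apply: le_trans (_ : 1 * (modc (b j) * (7 * (Y2%:R + Y3%:R) / q%:R)) <= _); last by rewrite mul1r [leLHS]mulrA.
apply: ler_pM; rewrite ?modc_ge0 ?mulr_ge0 ?modc_ge0 //.
apply: ler_wpM2l; first exact: modc_ge0.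
have -> : e (x2 i * (y j)%:~R + x3 i * (w j)%:~R) = e (fr i * (y j)%:~R + x3 i * (w j)%:~R).
  have -> : x2 i * (y j)%:~R + x3 i * (w j)%:~R = (fr i * (y j)%:~R + x3 i * (w j)%:~R) +
     (Num.floor (x2 i) * y j)%:~R by rewrite intrM /fr; move: (x2 i) (x3 i) ((y j)%:~R) => u v z; ring.
  by rewrite (charD he) (char_int he) mulr1.
apply: le_trans (char_dist he _ _) _; rewrite -[leRHS]mulrA; apply: ler_wpM2l => //.
have -> : fr i * (y j)%:~R + x3 i * (w j)%:~R - ((X2 i)%:R * (y j)%:~R / Q%:R + (X3 i)%:R * (w j)%:~R / Q%:R) =
   ((Q%:R * fr i - (X2 i)%:R) * (y j)%:~R + (Q%:R * x3 i - (X3 i)%:R) * (w j)%:~R) / Q%:R.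
  by field; rewrite gt_eqF.
rewrite normrM normfV [`|Q%:R|]gtr0_norm //.
have qQ : q%:R <= Q%:R :> R by rewrite ler_nat /Q leq_pmull // !muln_gt0 Y20 Y30.
apply: ler_pM; rewrite ?invr_ge0 ?normr_ge0 ?(ltW Qr) //; last by rewrite lef_pV2 // posrE ltr0n.
apply: le_trans (ler_normD _ _) _; rewrite !normrM.
have nint (z : int) (Y : nat) : `|z| <= Y%:Z -> `|z%:~R| <= Y%:R :> R.
  by rewrite -(ler_int R) intr_norm.
have n2 : `|Q%:R * fr i - (X2 i)%:R| <= 1.
  by have /andP[? ?] := X2b i; rewrite ger0_norm; lra.
have n3 : `|Q%:R * x3 i - (X3 i)%:R| <= 1.
  by have /andP[? ?] := X3b i; rewrite ger0_norm; lra.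
apply: lerD.
  by rewrite -[leRHS]mul1r; apply: ler_pM => //; apply: nint.
by rewrite -[leRHS]mul1r; apply: ler_pM => //; apply: nint.
Qed.
End RealSieve.

(** * Mean square of the differenced sums *)

Section SecondMoment.
Variables (R : archiRcfType) (e : R -> R[i]).
Hypothesis he : unit_character e.

Lemma sum_atmost (T : finType) (U : eqType) (g : T -> U) (Q : pred T) (P : pred U) (x : R) :
  injective g -> (forall t, Q t -> P (g t)) -> atmost P x -> \sum_t (Q t)%:R <= x.
Proof.
move=> gi QP Px; rewrite -natr_sum -big_mkcond sum1_card cardE -(size_map g).
apply: Px; first by rewrite map_inj_uniq ?enum_uniq.
by apply/allP => _ /mapP[t + ->]; rewrite mem_enum => /QP.
Qed.

(* Taylor polynomial at [m] of [f (m + n + h) - f (m + n)], in terms of [nu = 2 n + h]. *)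
Definition phase (g1 g2 g3 : nat -> R) (h n m : nat) : R :=
  h%:R * g1 m + (h * (2 * n + h))%:R / 2 * g2 m + (3 * h * (2 * n + h) ^ 2 + h ^ 3)%:R / 24 * g3 m.

Definition moment_const : R :=
  2 * (128 * 196 * 8 * 208 * 111) * (11 * 16 * 1300 * 512 * 1000 * 80).

(* The square is expanded and the terms are grouped by the difference [j] of the two shifts, so that
   the first derivative only enters through the coefficients of the large sieve. *)
Theorem second_moment (P X C M L : nat) (g1 g2 g3 : nat -> R) (c : nat -> R[i]) :
  (0 < P)%N -> (0 < X)%N -> (X <= P ^ 2)%N -> (0 < C)%N -> (M <= P ^ 8)%N -> (8 * P ^ 7 < 2 ^ L)%N ->
  steep2 (P%:R ^- 13) C%:R M g2 -> steep1 (P%:R ^- 13) M g3 ->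
  (forall m, (m < M)%N -> g3 m - g3 0%N <= C%:R / P%:R ^+ 5) -> (forall i, modc (c i) <= 1) ->
  (\sum_(m < M) modc (\sum_(i < X) \sum_(n < P ^ 3) c i * e (phase g1 g2 g3 (X + i) n m)) ^+ 2) ^+ 2
  <= moment_const * C%:R ^+ 2 * L.+1%:R ^+ 7 * (X%:R * P%:R ^+ 12) ^+ 2.
Proof.
move=> P0 X0 XP C0 MP PL S2 S1 g3C c1.
have Pr : 0 < P%:R :> R by rewrite ltr0n.
have P1 : 1 <= P%:R :> R by rewrite ler1n.
have Xr : 0 < X%:R :> R by rewrite ltr0n.
have Cr : 0 < C%:R :> R by rewrite ltr0n.
have PnP n : P%:R ^+ n = (P ^ n)%:R :> R by rewrite natrX.
set N := (P ^ 3)%N.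
pose K := ('I_X * 'I_N)%type.
pose pt (k : K) : int * int := ((X + k.1)%:Z, (2 * k.2 + (X + k.1))%:Z).
have pt_inj : injective pt.
  by move=> [i n] [i' n'] [E1 E2]; congr (_, _); apply: val_inj => /=; move: E1 E2 => /=; clear; lia.
pose J := (K * K)%type.
pose y (j : J) : int := moment (pt j.1) - moment (pt j.2).
pose w (j : J) : int := cubic (pt j.1) - cubic (pt j.2).
have ub (j : J) : (j.1.1 + X - j.2.1 < 2 * X)%N.
  by have := ltn_ord j.1.1; clear; lia.
(* The difference of the two shifts, translated by X to make it a natural number. *)
pose u (j : J) : 'I_(2 * X) := Ordinal (ub j).
(* The product of w / 24 and g3 is split at g3 0: the constant part goes into [b], and the rest is 2
   C w times [x3]. Dividing by 48 C brings the range, at most C / P^5 before, below the limit 1 /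
   (28 P^5) that the sieve imposes for tau = P^5. *)
pose x2 (m : 'I_M) := g2 m / 2; pose x3 (m : 'I_M) := (g3 m - g3 0%N) / (48 * C%:R).
pose a (v : 'I_(2 * X)) (m : 'I_M) := e (((v : nat)%:Z - X%:Z)%:~R * g1 m).
pose b (v : 'I_(2 * X)) (j : J) :=
  (u j == v)%:R * (c j.1.1 * ((c j.2.1)^*)%C * e ((w j)%:~R / 24 * g3 0%N)).
pose V v := \sum_m \sum_j a v m * b v j * e (x2 m * (y j)%:~R + x3 m * ((2 * C)%:Z * w j)%:~R).
set S := \sum_(m < M) _.
have SE : (S%:C)%C = \sum_v V v.
  rewrite /S rmorph_sum /= [RHS]exchange_big /=; apply: eq_bigr => m _.
  rewrite [RHS]exchange_big /= pair_bigA /= modc_sqr rmorph_sum /= big_distrlr /= [LHS]pair_bigA /=.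
  apply: eq_bigr => -[k k'] _ /=.
  rewrite (bigD1 (u (k, k'))) //= [X in _ = _ + X]big1 ?addr0; last first.
    by move=> v vu; rewrite /b eq_sym (negbTE vu) mul0r mulr0 mul0r.
  rewrite /b eqxx mul1r rmorphM /= -(charN he) mulrACA -(charD he).
  set cc := c _ * _; set e1 := e (x2 _ * _ + _); set e2 := e (_ * g3 0%N).
  have -> : a (u (k, k')) m * (cc * e2) * e1 = cc * (a (u (k, k')) m * e1 * e2) by ring.
  congr (_ * _); rewrite /a /e1 /e2 -!(charD he); congr e.
  have uX : ((u (k, k') : nat)%:Z - X%:Z)%:~R = (X + k.1)%:R - (X + k'.1)%:R :> R.
    rewrite -[(X + k.1)%:R]/((X + k.1)%:Z%:~R) -[(X + k'.1)%:R]/((X + k'.1)%:Z%:~R) -intrB.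
    by congr (_%:~R); rewrite /u /=; have := ltn_ord k'.1; clear; lia.
  rewrite uX /phase /x2 /x3 /y /w /moment /cubic /pt /=.
  rewrite !(intrB, intrD, intrM, natrD, natrM, natrX, rmorphXn) /=.
  by field; rewrite gt_eqF.
have B0 v : 0 <= \sum_j \sum_j' modc (b v j) * modc (b v j') *
    ((y j == y j') && (`|(2 * C)%:Z * w j - (2 * C)%:Z * w j'| < (P ^ 5)%:Z))%:R.
  by apply: sumr_ge0 => j _; apply: sumr_ge0 => j' _; rewrite !mulr_ge0 ?modc_ge0.
have XPr : X%:R <= P%:R ^+ 2 :> R by rewrite -natrX ler_nat.
have hb (k : K) : (X <= X + k.1 < 2 * X)%N by have := ltn_ord k.1; clear; lia.
have nb (k : K) : (2 * k.2 + (X + k.1) <= 4 * N)%N.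
  have aux (p q x i n : nat) : (p <= q -> x <= p -> i < x -> n < q -> 2 * n + (x + i) <= 4 * q)%N by clear; lia.
  by apply: (aux (P ^ 2)%N) => //; rewrite ?leq_pexp2l.
have ptb k : pbox (X%:R : R) P%:R (pt k).
  have h1 : X%:R <= ((X + k.1)%:R : R) < 2 * X%:R by rewrite -natrM ler_nat ltr_nat.
  have h2 : 0 <= ((2 * k.2 + (X + k.1))%:R : R) <= 4 * P%:R ^+ 3 by rewrite PnP -natrM ler0n ler_nat nb.
  by apply/andP; split; [exact: h1|exact: h2].
have dist (s t : int) (x : nat) : 0 <= s <= x%:Z -> 0 <= t <= x%:Z -> `|s - t| <= x%:Z by clear; lia.
have momb k : 0 <= moment (pt k) <= (8 * X * N)%:Z.
  rewrite /moment /pt /= -PoszM lez_nat.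
  have /andP[_ /ltnW h1] := hb k.
  by have := leq_mul h1 (nb k); rewrite (_ : 2 * X * (4 * N) = 8 * X * N)%N //; clear; lia.
have cubb k : 0 <= cubic (pt k) <= (104 * X * P ^ 6)%:Z.
  have -> : cubic (pt k) = (3 * (X + k.1) * (2 * k.2 + (X + k.1)) ^ 2 + (X + k.1) ^ 3)%N%:Z.
    by rewrite /cubic /pt /=; clear; lia.
  rewrite lez_nat; apply/andP; split=> //.
  have /andP[_ /ltnW h1] := hb k.
  have h2 : (3 * (X + k.1) * (2 * k.2 + (X + k.1)) ^ 2 <= 3 * (2 * X) * (4 * N) ^ 2)%N.
    by rewrite leq_mul // ?leq_mul // leq_exp2r.
  have h3 : ((X + k.1) ^ 3 <= 8 * (X * P ^ 6))%N.
    apply: leq_trans (_ : (2 * X) ^ 3 <= _)%N; first by rewrite leq_exp2r.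
    rewrite (_ : (2 * X) ^ 3 = 8 * (X * (X * X)))%N; last by clear; lia.
    rewrite leq_mul2l leq_mul2l; apply/orP; right; apply/orP; right.
    apply: leq_trans (leq_mul XP XP) _; rewrite -expnD leq_pexp2l //.
  have NE : (N ^ 2 = P ^ 6)%N by rewrite /N -expnM.
  have h4 : (3 * (2 * X) * (4 * N) ^ 2 = 96 * (X * P ^ 6))%N by rewrite -NE; clear; lia.
  by rewrite h4 in h2; move: h2 h3; clear; lia.
set Y2 := (8 * X * N)%N in momb *.
set Y3 := (104 * X * P ^ 6)%N in cubb *.
have yY j : `|y j| <= Y2%:Z by apply: dist.
have wY j : `|(2 * C)%:Z * w j| <= (2 * C * Y3)%:Z.
  by rewrite normrM [leRHS]PoszM; apply: ler_wpM2l => //; apply: dist.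
have N0 : (0 < N)%N by rewrite expn_gt0 P0.
have Y20 : (0 < Y2)%N by rewrite /Y2 muln_gt0 N0 muln_gt0 X0.
have tau0 : (0 < P ^ 5)%N by rewrite expn_gt0 P0.
have tauY : (2 * P ^ 5 <= 2 * C * Y3)%N.
  apply: leq_mul; first by rewrite leq_pmulr.
  rewrite /Y3; apply: leq_trans (_ : P ^ 6 <= _)%N.
    by rewrite leq_pexp2l.
  by rewrite leq_pmull // muln_gt0 X0.
have f3b i : 0 <= g3 (i : 'I_M) - g3 0%N.
  by have := S1 0%N i (leq0n i) (ltn_ord i); apply: le_trans; rewrite mulr_ge0 ?invr_ge0 ?exprn_ge0.
have x3b i : 0 <= x3 i <= (28 * (P ^ 5)%:R)^-1.
  rewrite divr_ge0 ?mulr_ge0 //= /x3 ler_pdivrMr ?mulr_gt0 //.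
  apply: le_trans (g3C i (ltn_ord i)) _; rewrite natrX.
  have -> : (28 * P%:R ^+ 5)^-1 * (48 * C%:R) = 48 / 28 * (C%:R / P%:R ^+ 5) :> R by field; rewrite gt_eqF.
  have : 0 <= C%:R / P%:R ^+ 5 :> R by rewrite divr_ge0 ?exprn_ge0.
  by clear; lra.
have a1 v i : modc (a v i) <= 1 by rewrite modc_char.
set A := \sum_(i : 'I_M) \sum_(i' : 'I_M) ((`|x2 i - x2 i' - (Num.floor (x2 i) - Num.floor (x2 i'))%:~R|
   <= (7 * Y2%:R)^-1) && (`|x3 i - x3 i'| <= (7 * (2 * C * Y3)%:R)^-1))%:R : R.
have sieve v := real_sieve he (b v) x2 Y20 tau0 tauY (a1 v) x3b yY wY.
pose nu (m m' : nat) : int := Num.floor (g2 m / 2) - Num.floor (g2 m' / 2).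
have PL7 : P%:R ^+ 7 < 2 ^+ L :> R.
  rewrite -!natrX ltr_nat; apply: leq_ltn_trans PL; by rewrite leq_pmull.
have PL3 : 8 * P%:R ^+ 3 < 2 ^+ L :> R.
  rewrite -!natrX -natrM ltr_nat; apply: leq_ltn_trans PL; by rewrite leq_mul2l leq_pexp2l.
have L0 : (0 < L)%N.
  by rewrite lt0n; apply: contraTneq PL => ->; rewrite -leqNgt expn0 muln_gt0 expn_gt0 P0.
have X1 : 1 <= X%:R :> R by rewrite ler1n.
have C1 : 1 <= C%:R :> R by rewrite ler1n.
have MPr : M%:R <= P%:R ^+ 8 :> R by rewrite -natrX ler_nat.
have Y2r : Y2%:R = 8 * X%:R * P%:R ^+ 3 :> R by rewrite /Y2 natrM natrM natrX.
have Y3r : Y3%:R = 104 * X%:R * P%:R ^+ 6 :> R by rewrite /Y3 natrM natrM natrX.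
have AB : A <= 111 * C%:R * L%:R * (P%:R ^+ 12 / X%:R ^+ 2).
  pose Q (p : 'I_M * 'I_M) := (`|x2 p.1 - x2 p.2 - (Num.floor (x2 p.1) - Num.floor (x2 p.2))%:~R|
   <= (7 * Y2%:R)^-1) && (`|x3 p.1 - x3 p.2| <= (7 * (2 * C * Y3)%:R)^-1).
  have gi : injective (fun p : 'I_M * 'I_M => (p.1 : nat, p.2 : nat)).
    by move=> [i i'] [k k'] [/val_inj -> /val_inj ->].
  rewrite /A pair_bigA /=.
  apply: (sum_atmost (Q := Q) gi _ (close_count (nu := nu) P1 X1 XPr C1 MPr PL7 L0 S2 S1)).
  move=> [i i'] /= /andP[H2 H3]; rewrite !ltn_ord /=; apply/andP; split => /=; last first.
    have -> : (g2 i - g2 i') / 2 = g2 i / 2 - g2 i' / 2 by ring.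
    apply: le_trans H2 _; rewrite Y2r lef_pV2 ?posrE ?mulr_gt0 ?exprn_gt0 //.
    have : 0 <= X%:R * P%:R ^+ 3 :> R by rewrite mulr_ge0 ?exprn_ge0.
    by rewrite -!mulrA; clear; lra.
  have -> : g3 i - g3 i' = (x3 i - x3 i') * (48 * C%:R) by rewrite /x3; field; rewrite gt_eqF.
  rewrite normrM (gtr0_norm (mulr_gt0 _ Cr)) // -ler_pdivlMr ?mulr_gt0 //.
  apply: le_trans H3 _; rewrite -invfM lef_pV2 ?posrE ?mulr_gt0 ?exprn_gt0 ?ltr0n ?muln_gt0 ?C0 ?X0 ?expn_gt0 ?P0 //.
  rewrite [(2 * C * Y3)%:R]natrM [(2 * C)%:R]natrM Y3r.
  have : 0 <= X%:R * P%:R ^+ 6 * C%:R :> R by rewrite !mulr_ge0 ?exprn_ge0.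
  set z := _ * C%:R; have -> : X%:R * P%:R ^+ 6 * (48 * C%:R) = 48 * z :> R by rewrite /z; ring.
  have -> : 7 * (2 * C%:R * (104 * X%:R * P%:R ^+ 6)) = 1456 * z :> R by rewrite /z; ring.
  by clear; lra.
have bb v j : modc (b v j) <= (u j == v)%:R.
  rewrite /b modcM modc_nat ler_piMr // !modcM modc_conj modc_char // mulr1.
  by rewrite -[leRHS]mul1r ler_pM ?modc_ge0.
pose BS v := \sum_j \sum_j' modc (b v j) * modc (b v j') *
    ((y j == y j') && (`|(2 * C)%:Z * w j - (2 * C)%:Z * w j'| < (P ^ 5)%:Z))%:R.
pose Qd (p : J * J) := [&& u p.1 == u p.2, y p.1 == y p.2 &
   `|(2 * C)%:Z * w p.1 - (2 * C)%:Z * w p.2| < (P ^ 5)%:Z].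
(* A pair (j, j') contributes only for v = u j = u j', so the counts for the separate values of v
   add up to one count of quadruples. This makes up for the factor 2 X lost by Cauchy-Schwarz over
   v. *)
have BB : \sum_v BS v <= 11 * 16 * 1300 * 512 * 1000 * 80 * L.+1%:R ^+ 6 * (X%:R * P%:R ^+ 8).
  apply: le_trans (_ : \sum_j \sum_j' (Qd (j, j'))%:R <= _).
    rewrite /BS exchange_big /=; apply: ler_sum => j _.
    rewrite exchange_big /=; apply: ler_sum => j' _.
    rewrite (bigD1 (u j)) //= big1 ?addr0 => [|v vu]; last first.
      by rewrite /b eq_sym (negbTE vu) mul0r modc0 !mul0r.
    rewrite /Qd /= [u j == _]eq_sym; set t := (y j == _) && _; rewrite -mulnb natrM; apply: ler_wpM2r => //.
    apply: le_trans (bb (u j) j'); rewrite ler_piMl ?modc_ge0 //.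
    by apply: le_trans (bb _ _) _; rewrite eqxx.
  pose g (p : J * J) := ((pt p.1.1, pt p.1.2), (pt p.2.1, pt p.2.2)).
  have gi : injective g.
    move=> [[k1 k2] [k3 k4]] [[l1 l2] [l3 l4]] E.
    have E1 : pt k1 = pt l1 := congr1 (fun t => t.1.1) E.
    have E2 : pt k2 = pt l2 := congr1 (fun t => t.1.2) E.
    have E3 : pt k3 = pt l3 := congr1 (fun t => t.2.1) E.
    have E4 : pt k4 = pt l4 := congr1 (fun t => t.2.2) E.
    by rewrite (pt_inj _ _ E1) (pt_inj _ _ E2) (pt_inj _ _ E3) (pt_inj _ _ E4).
  rewrite pair_bigA /=.
  apply: (sum_atmost (Q := Qd) gi _ (quadruple_bound P1 Xr XPr PL3)).
  move=> [[k1 k2] [k3 k4]] /and3P[/eqP /(congr1 val) /= uE yE wE].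
  rewrite /quadruple /g /= !ptb /=; apply/and3P; split.
  - apply/eqP; rewrite /pt /=; have := ltn_ord k2.1; have := ltn_ord k4.1; move: uE; clear.
    by move: (nat_of_ord k1.1) (nat_of_ord k2.1) (nat_of_ord k3.1) (nat_of_ord k4.1) => a b c d; lia.
  - exact: yE.
  have wP : `|w (k1, k2) - w (k3, k4)| <= (P ^ 5)%:Z.
    have aux (z : int) (k t : nat) : (0 < k)%N -> `|(2 * k)%:Z * z| < t%:Z -> `|z| <= t%:Z.
      move=> k0; rewrite normrM => H; apply: le_trans (ltW H).
      by rewrite ler_peMl //; move: k0; clear; lia.
    by apply: (aux _ C) => //; rewrite mulrBr.
  have : `|w (k1, k2) - w (k3, k4)|%:~R <= ((P ^ 5)%:Z%:~R : R) by rewrite ler_int.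
  by rewrite intr_norm -pmulrn natrX.
have S0 : 0 <= S by apply: sumr_ge0 => m _; apply: sqr_ge0.
have SV : S <= \sum_v modc (V v).
  by rewrite -(modc_real S0) SE; apply: modc_sum.
have K0 : 0 <= \sum_v modc (V v) by apply: sumr_ge0 => v _; apply: modc_ge0.
apply: le_trans (_ : (\sum_v modc (V v)) ^+ 2 <= _); first by apply: lerXn2r.
apply: le_trans (sqr_sum_le _ _) _; rewrite card_ord.
set KK := 128 * 196 * Y2%:R * (2 * C * Y3)%:R / (P ^ 5)%:R : R.
have KK0 : 0 <= KK by rewrite !mulr_ge0 ?invr_ge0.
have A0 : 0 <= A by apply: sumr_ge0 => i _; apply: sumr_ge0 => i' _.
apply: le_trans (_ : (2 * X)%:R * (KK * A * \sum_v BS v) <= _).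
  by apply: ler_wpM2l => //; rewrite mulr_sumr; apply: ler_sum => v _; apply: sieve.
have KE : KK = 128 * 196 * 8 * 208 * C%:R * X%:R ^+ 2 * P%:R ^+ 4.
  rewrite /KK [(2 * C * Y3)%:R]natrM [(2 * C)%:R]natrM Y3r Y2r natrX; field.
  by rewrite gt_eqF.
apply: le_trans (_ : (2 * X)%:R * (KK * (111 * C%:R * L%:R * (P%:R ^+ 12 / X%:R ^+ 2)) *
  (11 * 16 * 1300 * 512 * 1000 * 80 * L.+1%:R ^+ 6 * (X%:R * P%:R ^+ 8))) <= _).
  apply: ler_wpM2l => //; apply: ler_pM => //; first by rewrite mulr_ge0.
    by apply: sumr_ge0 => v _; apply: B0.
  by apply: ler_wpM2l.
have -> : (2 * X)%:R * (KK * (111 * C%:R * L%:R * (P%:R ^+ 12 / X%:R ^+ 2)) *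
  (11 * 16 * 1300 * 512 * 1000 * 80 * L.+1%:R ^+ 6 * (X%:R * P%:R ^+ 8))) =
  moment_const * C%:R ^+ 2 * L.+1%:R ^+ 6 * (X%:R * P%:R ^+ 12) ^+ 2 * L%:R.
  by rewrite KE natrM /moment_const; field; rewrite gt_eqF.
rewrite [_ ^+ 7]exprSr [leRHS](_ : _ = moment_const * C%:R ^+ 2 * L.+1%:R ^+ 6 *
   (X%:R * P%:R ^+ 12) ^+ 2 * L.+1%:R); last by ring.
apply: ler_wpM2l; last by rewrite ler_nat.
by rewrite /moment_const !mulr_ge0 ?exprn_ge0 ?mulr_ge0 ?exprn_ge0.
Qed.
End SecondMoment.

(** * Weyl differencing and shifts *)

Section Weyl.
Variable R : archiRcfType.
Implicit Types (z g F : nat -> R[i]).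

Lemma sum_inj_le (H : nat) (F : nat -> R) (P : pred nat) (k : nat -> nat) : (forall d, 0 <= F d) ->
  (forall i, (i < H)%N -> P i -> (k i < H)%N) -> {in P &, injective k} ->
  \sum_(i < H | P i) F (k i) <= \sum_(d < H) F d.
Proof.
move=> F0 kH ki; rewrite -(big_mkord P (F \o k)) -(big_mkord predT F) -big_filter /=.
rewrite -(big_map k predT F); apply: (@sum_subset R nat) => //.
  rewrite map_inj_in_uniq ?filter_uniq ?iota_uniq // => i j; rewrite !mem_filter.
  by move=> /andP[Pi _] /andP[Pj _]; apply: ki.
move=> d Hd; have [i + ->] : exists2 i, i \in [seq i <- index_iota 0 H | P i] & d = k i by apply/mapP.
by rewrite mem_filter !mem_index_iota => /andP[Pi iH]; apply: kH.
Qed.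

Definition corr z (M d : nat) := \sum_(k < M - d) z (k + d)%N * ((z k)^*)%C.

(** Van der Corput's inequality: H shifted copies of z are superposed, so that H S is a sum over M +
    H positions, to which Cauchy-Schwarz applies. In the expanded square each difference d occurs at
    most 2 H times. *)
Lemma weyl z (M H : nat) : (forall k, modc (z k) <= 1) -> (0 < H)%N ->
  H%:R * modc (\sum_(k < M) z k) ^+ 2 <=
  2 * (M + H)%:R * (M%:R + \sum_(1 <= d < H) modc (corr z M d)).
Proof.
move=> z1 H0; have Hr : 0 < H%:R :> R by rewrite ltr0n.
set S := \sum_(k < M) z k.
pose a (h : nat) (t : 'I_(M + H)) := if (h <= t < h + M)%N then z (t - h)%N else 0.
have aS (h : 'I_H) : \sum_t a h t = S.
  rewrite /a -big_mkcond (big_window (fun t => z (t - h)%N)); last first.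
    by rewrite addnC leq_add2l ltnW.
  by apply: eq_bigr => k _; rewrite addnK.
have corr0 : modc (corr z M 0) <= M%:R.
  rewrite /corr subn0; apply: le_trans (modc_sum _ _ _) _.
  rewrite -[M in leRHS]card_ord -[leRHS]sumr_const; apply: ler_sum => k _.
  by rewrite modcM modc_conj -[leRHS]mulr1 ler_pM ?modc_ge0.
have aC (h h' : nat) : (h' <= h)%N -> (h <= H)%N -> \sum_t a h' t * ((a h t)^*)%C = corr z M (h - h').
  move=> hh hH; have [dM|Md] := leqP (h - h') M; last first.
    rewrite /corr (_ : (M - (h - h'))%N = 0%N) ?big_ord0; last by apply/eqP; rewrite subn_eq0 ltnW.
    rewrite big1 // => t _; rewrite /a; case: ifP => [/andP[_ h1]|_]; last by rewrite mul0r.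
    by case: ifP => [/andP[h2 _]|_]; [move: h1 h2 Md hh; clear; lia|rewrite conjc0 mulr0].
  transitivity (\sum_(t < M + H | (h <= t < h + (M - (h - h')))%N) z (t - h')%N * ((z (t - h)%N)^*)%C).
    rewrite [RHS]big_mkcond /=; apply: eq_bigr => t _; rewrite /a.
    case: ifP => h1; case: ifP => h2; rewrite ?mul0r ?conjc0 ?mulr0 //; case: ifP => h3 //;
      by move: h1 h2 h3 dM hh; clear; lia.
  rewrite (big_window (fun t => z (t - h')%N * ((z (t - h)%N)^*)%C)); last first.
    by move: dM hh hH; clear; lia.
  apply: eq_bigr => k _; rewrite addnK; congr (z _ * _); by move: hh; clear; lia.
have aH : \sum_t modc (\sum_(h < H) a h t) ^+ 2 <= H%:R * (2 * \sum_(d < H) modc (corr z M d)).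
  set A := \sum_t _.
  have A0 : 0 <= A by apply: sumr_ge0 => t _; apply: sqr_ge0.
  have AE : (A%:C)%C = \sum_(h < H) \sum_(h' < H) \sum_t a h t * ((a h' t)^*)%C.
    rewrite /A rmorph_sum /=; under eq_bigr => t _ do rewrite modc_sqr rmorph_sum big_distrlr /=.
    rewrite exchange_big /=; apply: eq_bigr => h _; exact: exchange_big.
  rewrite -(modc_real A0) AE; apply: le_trans (modc_sum _ _ _) _.
  rewrite [leRHS](_ : _ = \sum_(h < H) (2 * \sum_(d < H) modc (corr z M d))); last first.
    by rewrite sumr_const card_ord [LHS]mulr_natl.
  apply: ler_sum => h _; apply: le_trans (modc_sum _ _ _) _.
  rewrite (bigID (fun h' : 'I_H => (h' <= h)%N)) /= mulr_natl mulr2n; apply: lerD.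
    apply: le_trans (_ : \sum_(h' < H | (h' <= h)%N) modc (corr z M (h - h')) <= _).
      apply: ler_sum => h' hh; rewrite -(aC h h') ?(ltnW (ltn_ord h)) // -[leRHS]modc_conj rmorph_sum.
      rewrite le_eqVlt; apply/orP; left; apply/eqP; congr modc; apply: eq_bigr => t _.
      by rewrite rmorphM /= conjcK mulrC.
    apply: (@sum_inj_le _ (fun d => modc (corr z M d)) (fun h' => (h' <= h)%N) (fun h' => (h - h')%N)) => [d|i _ _|i j].
    - exact: modc_ge0.
    - by apply: leq_ltn_trans (leq_subr _ _) _.
    by rewrite !unfold_in; clear; lia.
  under eq_bigl => h' do rewrite -ltnNge.
  apply: le_trans (_ : \sum_(h' < H | (h < h')%N) modc (corr z M (h' - h)) <= _).
    by apply: ler_sum => h' hh; rewrite -(aC h' h) // ltnW.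
  apply: (@sum_inj_le _ (fun d => modc (corr z M d)) (fun h' => (h < h')%N) (fun h' => (h' - h)%N)) => [d|i iH _|i j].
  - exact: modc_ge0.
  - by apply: leq_ltn_trans (leq_subr _ _) _.
  by rewrite !unfold_in; clear; lia.
have HS : H%:R * S = \sum_t \sum_(h < H) a h t.
  by rewrite exchange_big /= (eq_bigr _ (fun h _ => aS h)) sumr_const card_ord mulr_natl.
have : (H%:R * modc S) ^+ 2 <= (M + H)%:R * (H%:R * (2 * \sum_(d < H) modc (corr z M d))).
  rewrite -[X in (X * _) ^+ 2](modc_nat R) -modcM HS.
  apply: le_trans (_ : (\sum_t modc (\sum_(h < H) a h t)) ^+ 2 <= _).
    by apply: lerXn2r (modc_sum _ _ _); rewrite ?nnegrE ?modc_ge0 // sumr_ge0 // => t _; apply: modc_ge0.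
  apply: le_trans (sqr_sum_le _ _) _; rewrite card_ord; exact: ler_wpM2l.
rewrite exprMn expr2 -mulrA [(M + H)%:R * _]mulrCA ler_pM2l // => h.
apply: le_trans h _; rewrite mulrCA -mulrA ler_pM2l //.
apply: ler_wpM2l => //; rewrite -(big_mkord predT (fun d => modc (corr z M d))) big_ltn //.
by rewrite lerD2r.
Qed.

Lemma modc_sum_le (I : finType) (P : pred I) (F : I -> R[i]) : (forall i, modc (F i) <= 1) ->
  modc (\sum_(i | P i) F i) <= #|P|%:R.
Proof.
move=> F1; apply: le_trans (modc_sum _ _ _) _.
by rewrite -sumr_const; apply: ler_sum.
Qed.

(** Each of the N shifted windows of length M misses K - M terms of modulus at most 1. The inclusion
    is asked only for M > 0 because M will be a truncated difference. *)
Lemma shift_sum g (K M N : nat) : (forall k, modc (g k) <= 1) -> (0 < M -> M + N <= K)%N ->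
  N%:R * modc (\sum_(k < K) g k) <=
  modc (\sum_(m < M) \sum_(n < N) g (m + n)%N) + N%:R * (K - M)%:R.
Proof.
move=> g1 MK; set S := \sum_(k < K) g k; set T := \sum_(m < M) _.
have H (n : 'I_N) : modc (S - \sum_(m < M) g (m + n)%N) <= (K - M)%:R.
  have [->|M0] := posnP M; first by rewrite big_ord0 subr0 subn0 -[K in leRHS]card_ord; apply: modc_sum_le.
  have nK : (n + M <= K)%N by have := MK M0; have := ltn_ord n; clear; lia.
  rewrite -(big_window g nK) /S (bigID (fun k : 'I_K => (n <= k < n + M)%N)) /= addrAC subrr add0r.
  apply: le_trans (modc_sum_le _ _) _ => [i|]; first exact: g1.
  rewrite ler_nat -(leq_add2r M) subnK; last by apply: leq_trans nK; apply: leq_addl.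
  have ME : #|[pred k : 'I_K | (n <= k < n + M)%N]| = M.
    by rewrite -sum1_card (big_window (fun=> 1%N) nK) sum1_card card_ord.
  have := cardC [pred k : 'I_K | (n <= k < n + M)%N]; rewrite ME card_ord addnC => KE.
  by apply: (@leq_trans _ _ _ _ (eq_leq KE)); rewrite leq_add2r; apply: eq_leq; apply: eq_card.
have -> : N%:R * modc S = modc (N%:R * S) by rewrite modcM modc_nat.
have -> : N%:R * S = T + \sum_(n < N) (S - \sum_(m < M) g (m + n)%N).
  by rewrite sumrB sumr_const card_ord -[S *+ N]mulr_natl addrC /T exchange_big /= subrK.
apply: le_trans (modcD _ _) _; rewrite lerD2l; apply: le_trans (modc_sum _ _ _) _.
by rewrite -[N in leRHS]card_ord mulr_natl -sumr_const; apply: ler_sum.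
Qed.

(** The factor that rotates z to its modulus, with value 0 at 0 as the inverse of zero is zero. It
    turns a sum of moduli into a linear sum whose coefficients depend on the shift alone. *)
Definition dir (z : R[i]) : R[i] := ((modc z)%:C)%C / z.

Lemma modc_dir w : modc (dir w) <= 1.
Proof.
rewrite /dir modcM modcV modc_real ?modc_ge0 //.
by have [->|w0] := eqVneq (modc w) 0; rewrite ?mul0r // mulfV.
Qed.

Lemma dirM w : dir w * w = ((modc w)%:C)%C.
Proof.
rewrite /dir; have [->|w0] := eqVneq w 0; first by rewrite mulr0 modc0.
by rewrite mulfVK.
Qed.

Lemma big_dyadic (V : nmodType) (F : nat -> V) (L : nat) :
  \sum_(1 <= d < 2 ^ L) F d = \sum_(l < L) \sum_(i < 2 ^ l) F (2 ^ l + i)%N.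
Proof.
elim: L => [|L IH]; first by rewrite big_geq ?big_ord0.
rewrite big_ord_recr /= -IH (@big_cat_nat _ _ _ (2 ^ L)%N) ?expn_gt0 ?leq_pexp2l //=; congr (_ + _).
rewrite -{1}[(2 ^ L)%N]add0n big_addn expnS mul2n -addnn addnK big_mkord.
by apply: eq_bigr => i _; rewrite addnC.
Qed.
End Weyl.

(** * The bound on one short piece *)

Section ShortSum.
Variables (R : archiRcfType) (e : R -> R[i]).
Hypothesis he : unit_character e.

Lemma moment_const_ge1 : 1 <= moment_const R.
Proof. by rewrite /moment_const; lra. Qed.

(** Cauchy-Schwarz over m. Fourth powers are compared, which avoids roots: M^2 times the square of
    the second moment is of order P^16 (P^14)^2 = P^44, and the seven logarithms are rounded up to
    eight. *)
Lemma dyadic_class (P X C M L : nat) (g1 g2 g3 : nat -> R) (c : nat -> R[i]) :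
  (0 < P)%N -> (0 < X)%N -> (X <= P ^ 2)%N -> (0 < C)%N -> (M <= P ^ 8)%N -> (8 * P ^ 7 < 2 ^ L)%N ->
  steep2 (P%:R ^- 13) C%:R M g2 -> steep1 (P%:R ^- 13) M g3 ->
  (forall m, (m < M)%N -> g3 m - g3 0%N <= C%:R / P%:R ^+ 5) -> (forall i, modc (c i) <= 1) ->
  \sum_(m < M) modc (\sum_(i < X) \sum_(n < P ^ 3) c i * e (phase g1 g2 g3 (X + i) n m))
  <= moment_const R * C%:R * L.+1%:R ^+ 2 * P%:R ^+ 11.
Proof.
move=> P0 X0 XP C0 MP PL S2 S1 g3C c1.
have := second_moment he g1 P0 X0 XP C0 MP PL S2 S1 g3C c1.
pose T (m : nat) := modc (\sum_(i < X) \sum_(n < P ^ 3) c i * e (phase g1 g2 g3 (X + i) n m)).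
rewrite -/(T _); set S2' := \sum_(m < M) T m ^+ 2; set k := moment_const R => H.
rewrite (eq_bigr (fun m : 'I_M => T m)) //.
have k1 : 1 <= k := moment_const_ge1.
have k0 : 0 <= k by lra.
have T0 m : 0 <= T m by apply: modc_ge0.
have S0 : 0 <= S2' by apply: sumr_ge0 => m _; apply: sqr_ge0.
have B0 : 0 <= k * C%:R * L.+1%:R ^+ 2 * P%:R ^+ 11 by rewrite !mulr_ge0 ?exprn_ge0.
have s0 : 0 <= \sum_(m < M) T m by apply: sumr_ge0.
rewrite -(@ler_pXn2r _ 4) ?nnegrE // (exprM _ 2 2).
apply: le_trans (_ : (M%:R * S2') ^+ 2 <= _).
  apply: lerXn2r; rewrite ?nnegrE ?exprn_ge0 ?mulr_ge0 //.
  by apply: le_trans (sqr_sum_le _ _) _; rewrite card_ord.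
rewrite exprMn; apply: le_trans (_ : (P%:R ^+ 8) ^+ 2 * (k * C%:R ^+ 2 * L.+1%:R ^+ 7 * (P%:R ^+ 2 * P%:R ^+ 12) ^+ 2) <= _).
  apply: ler_pM; rewrite ?sqr_ge0 //.
    by apply: lerXn2r; rewrite ?nnegrE ?exprn_ge0 // -natrX ler_nat.
  apply: le_trans H _; apply: ler_wpM2l; first by rewrite !mulr_ge0 ?exprn_ge0.
  apply: lerXn2r; rewrite ?nnegrE ?mulr_ge0 ?exprn_ge0 //.
  by apply: ler_wpM2r; rewrite ?exprn_ge0 // -natrX ler_nat.
have -> : (P%:R ^+ 8) ^+ 2 * (k * C%:R ^+ 2 * L.+1%:R ^+ 7 * (P%:R ^+ 2 * P%:R ^+ 12) ^+ 2) =
  (k * (C%:R ^+ 2 * L.+1%:R ^+ 7)) * P%:R ^+ 44 by ring.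
have -> : (k * C%:R * L.+1%:R ^+ 2 * P%:R ^+ 11) ^+ 4 = (k ^+ 4 * (C%:R ^+ 4 * L.+1%:R ^+ 8)) * P%:R ^+ 44 by ring.
apply: ler_wpM2r; first exact: exprn_ge0.
apply: ler_pM; rewrite ?mulr_ge0 ?exprn_ge0 //; first by apply: ler_eXnr.
by apply: ler_pM; rewrite ?exprn_ge0 //; apply: ler_weXn2l; rewrite ?ler1n.
Qed.

Theorem short_sum (P C M L : nat) (f f1 f2 f3 : nat -> R) :
  (0 < P)%N -> (0 < C)%N -> (M <= P ^ 8)%N -> (8 * P ^ 7 < 2 ^ L)%N ->
  (forall m n h : nat, (m + n + h < M)%N ->
    `|f (m + n + h)%N - f (m + n)%N - phase f1 f2 f3 h n m| <= C%:R / P%:R ^+ 13 * h%:R * (n + h)%:R ^+ 3) ->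
  steep2 (P%:R ^- 13) C%:R M f2 -> steep1 (P%:R ^- 13) M f3 ->
  (forall m, (m < M)%N -> f3 m - f3 0%N <= C%:R / P%:R ^+ 5) ->
  modc (\sum_(m < M) e (f m)) <= 4 * (moment_const R + 59) * C%:R * L.+1%:R ^+ 2 * P%:R ^+ 7.
Proof.
move=> P0 C0 MP PL Tf S2 S1 f3C.
have Pr : 0 < P%:R :> R by rewrite ltr0n.
have P1 : 1 <= P%:R :> R by rewrite ler1n.
have C1 : 1 <= C%:R :> R by rewrite ler1n.
have L1 : 1 <= L.+1%:R :> R by rewrite ler1n.
set k := moment_const R; have k1 : 1 <= k := moment_const_ge1.
have k0 : 0 <= k by lra.
(* Leaving out the last H + N points keeps m + n + d below M, where the Taylor estimate is
   available. *)
pose H := (P ^ 2)%N; pose N := (P ^ 3)%N; pose M' := (M - (H + N))%N.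
have H0 : (0 < H)%N by rewrite expn_gt0 P0.
have N0 : (0 < N)%N by rewrite expn_gt0 P0.
have HN : (H <= N)%N by rewrite leq_pexp2l.
have HR : H%:R = P%:R ^+ 2 :> R := natrX _ _ _.
have NR : N%:R = P%:R ^+ 3 :> R := natrX _ _ _.
have HL : (H <= 2 ^ L)%N.
  apply: leq_trans (ltnW PL); apply: leq_trans (_ : P ^ 7 <= _)%N; last by rewrite leq_pmull.
  by rewrite leq_pexp2l.
have M'M : (M' <= M)%N := leq_subr _ _.
pose z i := e (f i).
have z1 i : modc (z i) = 1 by apply: modc_char.
pose g d i := z (i + d)%N * ((z i)^*)%C.
have g1 d i : modc (g d i) <= 1 by rewrite modcM modc_conj !z1 mulr1.
pose X d := \sum_(m < M') \sum_(n < N) g d (m + n)%N.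
(* The extension by zero beyond H allows the shifts to be grouped into complete dyadic ranges. *)
pose c d := if (d < H)%N then dir (X d) else 0.
have c1 d : modc (c d) <= 1 by rewrite /c; case: ifP => _; rewrite ?modc_dir ?modc0.
pose T l m := \sum_(i < 2 ^ l) \sum_(n < N) c (2 ^ l + i)%N * e (phase f1 f2 f3 (2 ^ l + i) n m).
pose B := k * C%:R * L.+1%:R ^+ 2 * P%:R ^+ 11.
have B0 : 0 <= B by rewrite !mulr_ge0 ?exprn_ge0.
have TB (l : nat) : \sum_(m < M') modc (T l m) <= B.
  have [lH|Hl] := leqP (2 ^ l) H; last first.
    rewrite big1 // => m _; rewrite /T big1 ?modc0 // => i _; rewrite big1 // => n _.
    by rewrite /c ltnNge (leq_trans (ltnW Hl)) ?leq_addr // mul0r.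
  apply: (@dyadic_class P (2 ^ l) C M' L f1 f2 f3 (fun i => c (2 ^ l + i)%N)) => //.
  - by rewrite expn_gt0.
  - exact: leq_trans M'M MP.
  - by move=> m m' d mm' m'M; apply: S2 => //; apply: leq_trans M'M.
  - by move=> m m' mm' m'M; apply: S1 => //; apply: leq_trans M'M.
  - by move=> m mM; apply: f3C; apply: leq_trans M'M.
have XT : \sum_(1 <= d < H) modc (X d) <= L%:R * B + 56 * C%:R * P%:R ^+ 11.
  set A := \sum_(1 <= d < H) _.
  have A0 : 0 <= A by apply: sumr_ge0 => d _; apply: modc_ge0.
  pose Y := \sum_(1 <= d < 2 ^ L) \sum_(m < M') \sum_(n < N) c d * e (phase f1 f2 f3 d n m).
  have YE : Y = \sum_(l < L) \sum_(m < M') T l m.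
    by rewrite /Y big_dyadic; apply: eq_bigr => l _; rewrite exchange_big.
  have YB : modc Y <= L%:R * B.
    rewrite YE; apply: le_trans (modc_sum _ _ _) _.
    apply: le_trans (_ : \sum_(l < L) B <= _); last by rewrite sumr_const card_ord mulr_natl.
    by apply: ler_sum => l _; apply: le_trans (modc_sum _ _ _) _.
  have tail (F : nat -> R[i]) : \sum_(1 <= d < 2 ^ L) c d * F d = \sum_(1 <= d < H) c d * F d.
    rewrite (@big_cat_nat _ _ _ H) //= [X in _ + X]big_nat_cond [X in _ + X]big1 ?addr0 // => d.
    by rewrite andbT => /andP[Hd _]; rewrite /c ltnNge Hd mul0r.
  have AE : (A%:C)%C = \sum_(1 <= d < H) c d * X d.
    rewrite /A rmorph_sum /= !big_nat; apply: eq_bigr => d /andP[_ dH].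
    by rewrite /c dH dirM.
  have Y2 : Y = \sum_(1 <= d < H) c d * \sum_(m < M') \sum_(n < N) e (phase f1 f2 f3 d n m).
    rewrite -tail /Y; apply: eq_bigr => d _; rewrite mulr_sumr; apply: eq_bigr => m _.
    by rewrite mulr_sumr.
  rewrite -(modc_real A0) (_ : (A%:C)%C = Y + ((A%:C)%C - Y)); last by rewrite addrC subrK.
  apply: le_trans (modcD _ _) _; apply: lerD => //.
  rewrite AE Y2 -sumrB; apply: le_trans (modc_sum _ _ _) _.
  (* Each pair (m, n) contributes an error of at most 7 C P^(-13) P^2 (2 P^3)^3 = 56 C / P^2, and
     there are at most P^11 pairs. Over all shifts this gives 56 C P^11, the order of the main
     term. *)
  apply: le_trans (_ : \sum_(1 <= d < H) (56 * C%:R * P%:R ^+ 9 : R) <= _); last first.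
    rewrite big_const_nat iter_addr_0 -[_ *+ (H - 1)]mulr_natl.
    apply: le_trans (_ : P%:R ^+ 2 * (56 * C%:R * P%:R ^+ 9) <= _).
      by apply: ler_wpM2r; rewrite ?mulr_ge0 ?exprn_ge0 // -natrX ler_nat leq_subr.
    by rewrite le_eqVlt; apply/orP; left; apply/eqP; ring.
  rewrite !big_nat; apply: ler_sum => d /andP[_ dH].
  rewrite -mulrBr modcM; apply: le_trans (_ : 1 * (56 * C%:R * P%:R ^+ 9) <= _); last by rewrite mul1r.
  apply: ler_pM; rewrite ?modc_ge0 // /X -sumrB; apply: le_trans (modc_sum _ _ _) _.
  pose t := 56 * C%:R / P%:R ^+ 2 : R.
  have t0 : 0 <= t by rewrite divr_ge0 ?mulr_ge0 ?exprn_ge0.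
  apply: le_trans (_ : \sum_(m < M') (N%:R * t) <= _); last first.
    rewrite sumr_const card_ord -[_ *+ M']mulr_natl; apply: le_trans (_ : P%:R ^+ 8 * (N%:R * t) <= _).
      by apply: ler_wpM2r; [rewrite mulr_ge0|rewrite -natrX ler_nat (leq_trans M'M)].
    by rewrite le_eqVlt; apply/orP; left; apply/eqP; rewrite NR /t; field; rewrite gt_eqF.
  apply: ler_sum => m _; rewrite -sumrB; apply: le_trans (modc_sum _ _ _) _.
  apply: le_trans (_ : \sum_(n < N) t <= _); last by rewrite sumr_const card_ord mulr_natl.
  apply: ler_sum => n _.
  have mnd : (m + n + d < M)%N.
    by have := ltn_ord m; have := ltn_ord n; rewrite /M'; move: dH HN; clear; lia.
  have -> : g d (m + n)%N = e (f (m + n + d)%N - f (m + n)%N) by rewrite /g /z (charD he) (charN he).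
  apply: le_trans (char_dist he _ _) _.
  apply: le_trans (_ : 7 * (C%:R / P%:R ^+ 13 * d%:R * (n + d)%:R ^+ 3) <= _).
    by apply: ler_wpM2l => //; apply: Tf.
  apply: le_trans (_ : 7 * (C%:R / P%:R ^+ 13 * P%:R ^+ 2 * (2 * P%:R ^+ 3) ^+ 3) <= _); last first.
    by rewrite le_eqVlt; apply/orP; left; apply/eqP; rewrite /t; field; rewrite gt_eqF.
  apply: ler_wpM2l => //; apply: ler_pM; rewrite ?mulr_ge0 ?invr_ge0 ?exprn_ge0 //.
    apply: ler_wpM2l; first by rewrite divr_ge0 ?exprn_ge0.
    by rewrite -HR ler_nat ltnW.
  apply: lerXn2r; rewrite ?nnegrE ?mulr_ge0 ?exprn_ge0 // -NR -natrM ler_nat.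
  by have := ltn_ord n; move: dH HN; clear; lia.
have corrB : \sum_(1 <= d < H) modc (corr z M d) <= (k + 58) * (C%:R * L.+1%:R ^+ 3) * P%:R ^+ 8.
  rewrite -(ler_pM2l (exprn_gt0 3 Pr)) -NR mulr_sumr.
  apply: le_trans (_ : \sum_(1 <= d < H) (modc (X d) + N%:R * (H + N)%:R) <= _).
    rewrite !big_nat; apply: ler_sum => d /andP[_ dH].
    apply: le_trans (shift_sum (M := M') (N := N) (g1 d) _) _.
      by rewrite /M'; move: dH; clear; lia.
    rewrite lerD2l; apply: ler_wpM2l => //; rewrite ler_nat /M'; move: dH; clear; lia.
  rewrite big_split /= big_const_nat iter_addr_0 -[_ *+ (H - 1)]mulr_natl.
  apply: le_trans (lerD XT (_ : _ <= P%:R ^+ 2 * (P%:R ^+ 3 * (2 * P%:R ^+ 3)))) _.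
    have q1 : (H - 1)%:R <= P%:R ^+ 2 :> R by rewrite -HR ler_nat leq_subr.
    have q2 : (H + N)%:R <= 2 * P%:R ^+ 3 :> R by rewrite -NR -natrM ler_nat; move: HN; clear; lia.
    by apply: ler_pM; rewrite ?mulr_ge0 // NR; apply: ler_wpM2l; rewrite ?exprn_ge0.
  have -> : P%:R ^+ 2 * (P%:R ^+ 3 * (2 * P%:R ^+ 3)) = 2 * P%:R ^+ 8 :> R by ring.
  rewrite NR (_ : P%:R ^+ 3 * _ = (k + 58) * (C%:R * L.+1%:R ^+ 3) * P%:R ^+ 11); last by ring.
  rewrite /B; set u := C%:R * L.+1%:R ^+ 3; set p := P%:R ^+ 11.
  have p0 : 0 <= p by apply: exprn_ge0.
  have uC : C%:R <= u by rewrite /u ler_peMr // exprn_ege1.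
  have pp : P%:R ^+ 8 <= p by apply: ler_weXn2l.
  have b1 : L%:R * (k * C%:R * L.+1%:R ^+ 2 * p) <= k * u * p.
    rewrite (_ : k * u * p = L.+1%:R * (k * C%:R * L.+1%:R ^+ 2 * p)); last by rewrite /u; ring.
    by apply: ler_wpM2r; rewrite ?mulr_ge0 ?exprn_ge0 // ler_nat.
  have b2 : C%:R * p <= u * p by apply: ler_wpM2r.
  have b3 : p <= u * p by rewrite ler_peMl //; lra.
  move: b1 b2 b3 pp; rewrite -mulrA [_ * _ * C%:R]mulrC; clear; move: (L%:R * _) => v; nra.
have W : H%:R * modc (\sum_(m < M) z m) ^+ 2 <= 2 * (M + H)%:R * (M%:R + \sum_(1 <= d < H) modc (corr z M d)).
  by apply: weyl => // i; rewrite z1.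
set S := modc _ in W *; set u := C%:R * L.+1%:R ^+ 3 in corrB.
have u1 : 1 <= u by rewrite mulr_ege1 ?exprn_ege1.
have MH : (M + H)%:R <= 2 * P%:R ^+ 8 :> R.
  rewrite -natrX -natrM ler_nat mul2n -addnn leq_add //; exact: leq_pexp2l.
have MS : M%:R + \sum_(1 <= d < H) modc (corr z M d) <= (k + 59) * u * P%:R ^+ 8.
  have MR : M%:R <= P%:R ^+ 8 :> R by rewrite -natrX ler_nat.
  have : P%:R ^+ 8 <= u * P%:R ^+ 8 by rewrite ler_peMl ?exprn_ge0.
  by move: corrB MR; clear; move: (\sum_(_ <= _ < _) _) (P%:R ^+ 8) => x p; lra.
have c0 : 0 <= \sum_(1 <= d < H) modc (corr z M d) by apply: sumr_ge0 => d _; apply: modc_ge0.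
have S0 : 0 <= S by apply: modc_ge0.
have S2b : S ^+ 2 <= 4 * (k + 59) * u * P%:R ^+ 14.
  rewrite -(ler_pM2l (exprn_gt0 2 Pr)) -HR; apply: le_trans W _.
  rewrite -mulrA; apply: le_trans (_ : 2 * (2 * P%:R ^+ 8 * ((k + 59) * u * P%:R ^+ 8)) <= _).
    by apply: ler_wpM2l => //; apply: ler_pM => //; apply: addr_ge0.
  by rewrite le_eqVlt HR; apply/orP; left; apply/eqP; ring.
have K0 : 1 <= 4 * (k + 59) by lra.
rewrite -(@ler_pXn2r _ 2) ?nnegrE //; last by rewrite !mulr_ge0 ?exprn_ge0 //; lra.
apply: le_trans S2b _; set q := 4 * (k + 59) in K0 *.
rewrite (_ : (q * C%:R * L.+1%:R ^+ 2 * P%:R ^+ 7) ^+ 2 =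
  (q ^+ 2 * (C%:R ^+ 2 * L.+1%:R ^+ 4)) * P%:R ^+ 14); last by ring.
apply: ler_wpM2r; first exact: exprn_ge0.
have q0 : 0 <= q by lra.
apply: ler_pM; rewrite ?ler_eXnr //; first by lra.
by apply: ler_pM; rewrite ?exprn_ge0 ?ler_eXnr //; apply: ler_weXn2l.
Qed.
End ShortSum.

(** * Exponential sums over the reals *)

Lemma sum_pieces (R : rcfType) (z : nat -> R[i]) (D q r s : nat) (B : R) : (r <= D)%N ->
  (forall s n, (n <= D)%N -> modc (\sum_(i < n) z (s + i)%N) <= B) ->
  modc (\sum_(i < q * D + r) z (s + i)%N) <= q.+1%:R * B.
Proof.
move=> rD H; elim: q s => [|q IH] s; first by rewrite mul1r; apply: H.
rewrite mulSn -addnA big_split_ord /=; apply: le_trans (modcD _ _) _.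
rewrite -[q.+2%:R]natr1 mulrDl mul1r addrC; apply: lerD; last exact: H.
by under eq_bigr => i _ do rewrite addnA; apply: IH.
Qed.

Lemma mul_exp_shift (K : fieldType) (a b : K) (m n : nat) : b != 0 -> a * b ^- (n + m) * b ^+ m = a / b ^+ n.
Proof. by move=> b0; rewrite exprD; field; rewrite !expf_neq0. Qed.

Lemma sum_pieces_bound (F : realFieldType) (K q p x l k : F) : 0 <= K -> 0 <= q -> 0 <= p -> 0 <= l ->
  q * p <= x -> l <= 7 * k -> (q + 1) * (K * l ^+ 2 * p) <= K * 49 * k ^+ 2 * (x + p).
Proof.
move=> K0 q0 p0 l0 qp lk.
rewrite (_ : (q + 1) * _ = K * l ^+ 2 * (q * p + p)); last by ring.
rewrite (_ : K * 49 * _ = K * (7 * k) ^+ 2); last by ring.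
apply: ler_pM; rewrite ?lerD2r //.
- by rewrite mulr_ge0 ?exprn_ge0.
- by rewrite addr_ge0 ?mulr_ge0.
by apply: ler_wpM2l => //; apply: lerXn2r; rewrite ?nnegrE // (le_trans l0).
Qed.

From Stdlib Require Import Reals.
From Coquelicot Require Import Coquelicot.
From mathcomp Require Import Rstruct.
Import ssrnat Analysis Assembly.
Delimit Scope nat_scope with N.
Delimit Scope ring_scope with R.
Local Open Scope ring_scope.

Definition cexp (x : R) : R[i] := Complex (e x).1 (e x).2.

Lemma modc_sqrt (z : R[i]) : modc z = sqrt (Rplus (pow (complex.Re z) 2) (pow (complex.Im z) 2)).
Proof. by rewrite RsqrtE !RpowE /modc normc_def. Qed.

Lemma cexp_character : unit_character cexp.
Proof.
split.
- move=> x y; rewrite /cexp -RplusE e_add /=; apply/eqP; rewrite eq_complex /=.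
  by apply/andP; split.
- by move=> x; rewrite -modcE modc_sqrt [X in sqrt X](e_norm x) sqrt_1.
- move=> x; rewrite modc_sqrt -RabsE; apply/RleP.
  have E7 : 7 = IZR 7 :> R by rewrite -[7]/(7%:R) -INRE INR_IZR_INZ.
  have -> : 7 * Rabs x = sqrt (pow (Rmult (IZR 7) x) 2).
    rewrite -Rsqr_pow2 sqrt_Rsqr_abs Rabs_mult RmultE E7; congr (_ * _).
    by rewrite RabsE -E7 ger0_norm.
  apply: sqrt_le_1_alt; have := e_dist1 x; rewrite /= !RminusE subr0. done.
- by rewrite /cexp e_1.
move=> x /andP[/RltP x0 /RltP x1]; apply/eqP => /(congr1 (@complex.Re R)) /=.
exact: e_neq1.
Qed.

Lemma expsumE f M : expsum f M = let z := \sum_(i < M) cexp (f (INR i.+1)) in (complex.Re z, complex.Im z).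
Proof.
elim: M => [|M IH]; first by rewrite /expsum sum_n_m_zero ?big_ord0 //; apply/ltP.
rewrite /expsum (sum_n_Sm _ 1 M (le_n_S _ _ (le_0_n M))).
rewrite big_ord_recr /= raddfD [complex.Im _]raddfD /=.
by rewrite -/(expsum f M) IH.
Qed.

Lemma Cmod_expsum f M : Cmod (expsum f M) = modc (\sum_(i < M) cexp (f (INR i.+1))).
Proof. by rewrite expsumE modc_sqrt. Qed.

Section Bridge.
Variables (P C k : nat) (C0 lam : R) (F F1 F2 F3 F4 : R -> R).
Hypotheses (P0 : (0 < P)%N) (l0 : 0 < lam) (Q : quartic lam (Rmult C0 lam) F F1 F2 F3 F4).
Hypotheses (Pl : P%:R ^- 13 <= lam) (Cl : C0 * lam <= C%:R * P%:R ^- 13).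

(** The offset [s] is the start of a piece; the successor is there because the sum begins at m =
    1. *)
Let node (G : R -> R) (s i : nat) : R := G ((s + i).+1%:R).

Lemma quartic_difference s n :
  steep2 (P%:R ^- 13) C%:R n (node F2 s) /\ steep1 (P%:R ^- 13) n (node F3 s) /\
  (forall m m', (m <= m')%N -> node F3 s m' - node F3 s m <= C0 * lam * (m' - m)%:R).
Proof.
have E (m m' : nat) : (m <= m')%N -> (s + m').+1%:R - (s + m).+1%:R = (m' - m)%:R :> R.
  by move=> mm'; rewrite -natrB ?ltnS ?leq_add2l // subSS subnDl.
have St m m' : (m <= m')%N ->
    lam * (m' - m)%:R <= node F3 s m' - node F3 s m <= C0 * lam * (m' - m)%:R.
  move=> mm'; have /RleP mmR : ((s + m).+1%:R : R) <= (s + m').+1%:R by rewrite ler_nat ltnS leq_add2l.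
  have [/RleP H1 /RleP H2] := quartic_steep1 _ _ _ _ _ _ _ Q _ _ mmR.
  by rewrite -(E _ _ mm') H1.
split=> [m m' d mm' _|]; last first.
  split=> [m m' mm' _|m m' mm']; last by case/andP: (St _ _ mm').
  case/andP: (St _ _ mm') => + _; apply: le_trans; exact: ler_wpM2r.
have /RleP mmR : ((s + m).+1%:R : R) <= (s + m').+1%:R by rewrite ler_nat ltnS leq_add2l.
have /RleP d0 : 0 <= d%:R :> R by [].
have [/RleP H1 /RleP H2] := quartic_steep2 _ _ _ _ _ _ _ Q _ _ _ mmR d0.
have ed i : node F2 s (i + d)%N = F2 (Rplus d%:R (s + i).+1%:R).
  by rewrite /node RplusE -natrD addnA [(d + _)%N]addnC addSn.
rewrite !ed; apply/andP; split.
  by apply: le_trans H1; rewrite !RealsE E // ; apply: ler_wpM2r => //; apply: ler_wpM2r.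
apply: le_trans H2 _; rewrite !RealsE E //; apply: ler_wpM2r => //; exact: ler_wpM2r.
Qed.

Lemma quartic_phase s m n h :
  `|node F s (m + n + h)%N - node F s (m + n)%N - phase (node F1 s) (node F2 s) (node F3 s) h n m|
  <= C%:R / P%:R ^+ 13 * h%:R * (n + h)%:R ^+ 3.
Proof.
have /RleP n0 : 0 <= n%:R :> R by [].
have /RleP h0 : 0 <= h%:R :> R by [].
have /RleP lR : 0 <= lam by apply: ltW.
have /RleP H := quartic_taylor _ _ _ _ _ _ _ Q lR (s + m).+1%:R _ _ n0 h0.
rewrite !RealsE in H.
change (nat_of_pos 2) with 2%N in H; change (nat_of_pos 3) with 3%N in H.
change (nat_of_pos 24) with 24%N in H.
apply: le_trans (_ : C0 * lam * h%:R * (n + h)%:R ^+ 3 <= _); last first.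
  by apply: ler_wpM2r; rewrite ?exprn_ge0 //; apply: ler_wpM2r.
have -> : node F s (m + n + h)%N = F ((s + m).+1%:R + n%:R + h%:R)%R.
  by rewrite /node -!natrD !addnA !addSn.
have -> : node F s (m + n)%N = F ((s + m).+1%:R + n%:R)%R by rewrite /node -!natrD !addnA !addSn.
rewrite [(n + h)%:R]natrD; apply: le_trans H; rewrite le_eqVlt; apply/orP; left; apply/eqP.
congr (`|_ - _|); rewrite /phase /node !(natrD, natrM, natrX).
by [].
Qed.
End Bridge.

Lemma exists_short_bound (C0 : R) : Rle 1 C0 -> exists2 K0, Rle 0 K0 & short_bound K0 C0.
Proof.
(* As lambda <= (2 / P)^13, replacing lambda by P^(-13) costs 2^13 in the upper bound for the fourth
   derivative. *)
move=> /RleP C01; pose C := (Num.truncn (2 ^+ 13 * C0)).+1.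
have C8 : 2 ^+ 13 * C0 <= C%:R.
  by have /andP[_ /ltW] := truncn_itv (mulr_ge0 (exprn_ge0 13 (ler0n R 2)) (le_trans ler01 C01)).
have k1 := moment_const_ge1 R.
have kC0 : 0 <= 4 * (moment_const R + 59) * C%:R.
  by rewrite !mulr_ge0 // addr_ge0 // (le_trans ler01 k1).
exists (4 * (moment_const R + 59) * C%:R * 49); first by apply/RleP; rewrite mulr_ge0.
move=> M lam f f4 P k /ssrnat.leP M1 /RltP l0 Df Bf /ssrnat.leP P1 /RleP Pl /RleP lP /RltP Pk.
have /RleP M1R : 1 <= INR M by rewrite INRE ler1n.
have [F [F1 [F2 [F3 [F4 [Q FE]]]]]] := extend_quartic _ _ _ _ _ _ M1R Df Bf.
have Pr : 0 < P%:R :> R by rewrite ltr0n.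
rewrite !RealsE in Pl lP Pk; change (nat_of_pos 2) with 2%N in lP, Pk.
have Cl : C0 * lam <= C%:R * P%:R ^- 13.
  apply: le_trans (_ : C0 * (2 ^+ 13 * P%:R ^- 13) <= _).
    by apply: ler_wpM2l; [exact: le_trans C01|rewrite -exprVn -exprMn].
  by rewrite mulrA [C0 * _]mulrC; apply: ler_wpM2r; rewrite ?invr_ge0 ?exprn_ge0.
(* From P < 2^k one gets 8 P^7 < 2^(4 + 7 k); moreover L + 1 <= 7 (k + 1), whose square is the
   factor 49 of the constant. *)
pose L := (4 + 7 * k)%N.
have PL : (8 * P ^ 7 < 2 ^ L)%N.
  have Pk' : (P < 2 ^ k)%N by rewrite -(ltr_nat R) natrX.
  have : (P ^ 7 <= (2 ^ k) ^ 7)%N by rewrite leq_exp2r // ltnW.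
  rewrite -expnM mulnC /L expnD; have : (0 < 2 ^ (7 * k))%N by rewrite expn_gt0.
  by move: (2 ^ (7 * k))%N (P ^ 7)%N => a b; rewrite (_ : 2 ^ 4 = 16)%N //; clear; lia.
pose D := (P ^ 8)%N; have D0 : (0 < D)%N by rewrite expn_gt0 P1.
pose B := 4 * (moment_const R + 59) * C%:R * L.+1%:R ^+ 2 * P%:R ^+ 7.
have piece s n : (n <= D)%N -> modc (\sum_(i < n) cexp (F (s + i).+1%:R)) <= B.
  move=> nD; have [S2 [S1 S1u]] := quartic_difference Q Pl Cl s n.
  apply: (@short_sum _ _ cexp_character P C n L (fun i => F (s + i).+1%:R) _ _ _ P1 (ltn0Sn _) nD PL _ S2 S1).
    by move=> m n' h _; apply: (quartic_phase l0 Q Cl).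
  (* Over a piece of length at most P^8 the third derivative varies by at most C P^(-13) P^8 = C /
     P^5, as the sieve requires. *)
  move=> m mn; apply: le_trans (S1u _ _ (leq0n m)) _; rewrite subn0.
  apply: le_trans (_ : C%:R * P%:R ^- 13 * P%:R ^+ 8 <= _).
    apply: ler_pM => //; first by rewrite mulr_ge0 ?ltW // (lt_le_trans ltr01).
    by rewrite -natrX ler_nat (leq_trans (ltnW mn)).
  by rewrite -[leRHS](mul_exp_shift _ 8) ?gt_eqF.
have -> : Cmod (expsum f M) = modc (\sum_(i < M) cexp (F i.+1%:R)).
  rewrite Cmod_expsum; congr modc; apply: eq_bigr => i _; rewrite -FE ?INRE //.
  by split; apply/RleP; rewrite ?R1E ?INRE ?ler1n ?ler_nat // ltn_ord.
have := sum_pieces (z := fun i => cexp (F i.+1%:R)) (M %/ D) 0 (ltnW (ltn_pmod M D0)) piece.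
rewrite -divn_eq => H; apply/RleP; apply: le_trans H _.
rewrite !RealsE; set K := 4 * _ * _ in B piece *.
have q8 : (M %/ D)%:R * P%:R ^+ 7 <= M%:R / P%:R :> R.
  rewrite ler_pdivlMr // -mulrA -exprSr -natrX -natrM ler_nat; exact: leq_trunc_div.
have L7 : L.+1%:R <= 7 * (k%:R + 1) :> R.
  by rewrite natr1 -natrM ler_nat /L; clear; lia.
by rewrite /B -natr1; apply: sum_pieces_bound => //; apply: exprn_ge0.
Qed.

(* Gives [%nat] inequalities their Stdlib meaning again. *)
Import Peano.
Local Close Scope ring_scope.
Open Scope R_scope.

Theorem theorem1 :
  forall eps C0 c : R, 0 < eps -> 1 <= C0 -> 0 < c ->
  exists K : R,
    forall (M : nat) (lambda : R) (f f4 : R -> R),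
      (1 <= M)%nat ->
      0 < lambda ->
      Cn_deriv_on 4 (Icc 1 (INR M)) f f4 ->
      (forall x : R, 1 <= x <= INR M -> lambda <= f4 x <= C0 * lambda) ->
      Cmod (expsum f M)
        <= K * Rpower (INR M) eps
             * (INR M * Rpower lambda (1 / 13) + Rpower lambda (- (7 / 13)))
      /\
      (c * Rpower lambda (- (8 / 13)) <= INR M ->
       Cmod (expsum f M)
         <= K * Rpower (INR M) (1 + eps) * Rpower lambda (1 / 13)).
Proof.
move=> eps C0 c e0 C01 c0; have [K0 K00 H] := exists_short_bound C01.
exact: assembly H K00 e0 c0.
Qed.
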